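(* Let $(A,\mathfrak{m})$ be a Cohen-Macaulay analytically unramified local ring with $\dim A\ge 2$. Let $\mathfrak{a}$ be an $\mathfrak{m}$-primary ideal of $A$ and let $\mathcal{F}=\{\mathfrak{a}_n\}_{n\ge 0}$ be an asymptotic integral closure filtration with respect to $\mathfrak{a}$. Then $\operatorname{depth}G_{\mathcal{F}^{<m>}}(A)\ge 2$ for all $m\gg 0$.
   Context: All rings are commutative Noetherian. A local ring $A$ is analytically unramified if its completion is reduced. $I^*$ denotes the integral closure of an ideal $I$ in $A$. A multiplicative $\mathfrak{a}$-stable filtration is a decreasing sequence $\mathcal{F}=\{\mathfrak{a}_n\}_{n\ge 0}$ of ideals of $A$ such that $\mathfrak{a}_0=A$; $\mathfrak{a}\subseteq\mathfrak{a}_1$ and $\mathfrak{a}_1\ne A$; $\mathfrak{a}_n\mathfrak{a}_m\subseteq\mathfrak{a}_{n+m}$ for all $n,m\ge 0$; and $\mathfrak{a}\mathfrak{a}_n=\mathfrak{a}_{n+1}$ for all $n\gg 0$. It is an asymptotic integral closure filtration with respect to $\mathfrak{a}$ if in addition $\mathfrak{a}_n=(\mathfrak{a}^n)^*$ for all $n\gg 0$. For $m\ge 1$, $\mathcal{F}^{<m>}=\{\mathfrak{a}_{nm}\}_{n\ge 0}$ and $G_{\mathcal{F}^{<m>}}(A)=\bigoplus_{n\ge 0}\mathfrak{a}_{nm}/\mathfrak{a}_{(n+1)m}$, a finitely generated graded module over $G_{\mathfrak{a}^m}(A)=\bigoplus_{n\ge 0}\mathfrak{a}^{nm}/\mathfrak{a}^{(n+1)m}$.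 Depth is taken with respect to the homogeneous maximal ideal of $G_{\mathfrak{a}^m}(A)$ (equivalently of the Rees algebra $A[\mathfrak{a}^m t]$). *)

(* Defs.v *)
From HB Require Import structures.
From mathcomp Require Import all_boot all_algebra generic_quotient.
From mathcomp Require Import boolp classical_sets functions.

Set Implicit Arguments.
Unset Strict Implicit.
Unset Printing Implicit Defensive.

Import GRing.Theory.

Local Open Scope classical_set_scope.
Local Open Scope ring_scope.
Local Open Scope quotient_scope.

Section Ideals.
Variable A : comNzRingType.
Implicit Types (I J m : set A) (x y : A).

Definition is_ideal I : Prop :=
  [/\ I 0, forall x y, I x -> I y -> I (x + y) & forall c x, I x -> I (c * x)].

Definition ideal_gen (S : set A) : set A := smallest is_ideal S.

Definition noetherian : Prop :=
  forall I, is_ideal I -> exists s : seq A, I = ideal_gen [set` s].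

Definition idealM I J : set A :=
  ideal_gen [set z | exists x y, [/\ I x, J y & z = x * y]].

Fixpoint idealX I (n : nat) : set A :=
  if n is n'.+1 then idealM I (idealX I n') else [set: A].

Definition is_prime I : Prop :=
  [/\ is_ideal I, ~ I 1 & forall x y, I (x * y) -> I x \/ I y].

Definition is_maximal I : Prop :=
  [/\ is_ideal I, ~ I 1
    & forall J, is_ideal J -> I `<=` J -> J = I \/ J = [set: A]].

Definition is_local m : Prop :=
  is_maximal m /\ forall J, is_maximal J -> J = m.

Definition radical I : set A := [set x | exists n : nat, I (x ^+ n)].

Definition is_primary_to m I : Prop :=
  [/\ is_ideal I, ~ I 1, (forall x y, I (x * y) -> I x \/ radical I y)
    & radical I = m].

Definition int_closure I : set A :=
  [set x | exists (n : nat) (c : nat -> A),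
     [/\ (0 < n)%N, (forall i, (1 <= i <= n)%N -> idealX I i (c i))
       & x ^+ n + \sum_(1 <= i < n.+1) c i * x ^+ (n - i) = 0]].

Lemma ideal_gen_ideal S : is_ideal (ideal_gen S).
Proof.
split=> [J [[J0 _ _] _] //|x y Ix Iy J HJ|c x Ix J HJ].
  by case: (HJ) => [[_ JD _] _]; apply: JD; [exact: Ix | exact: Iy].
by case: (HJ) => [[_ _ JM] _]; apply: JM; exact: Ix.
Qed.

Lemma ideal_genP (S I : set A) : is_ideal I -> S `<=` I -> ideal_gen S `<=` I.
Proof. by move=> hI SI x; apply. Qed.

Lemma idealX_ideal I n : is_ideal (idealX I n).
Proof. by case: n => [|n] /=; last exact: ideal_gen_ideal. Qed.

Lemma is_idealN I x : is_ideal I -> I x -> I (- x).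
Proof. by case=> _ _ IM Ix; rewrite -mulN1r; exact: IM. Qed.

Lemma is_idealB I x y : is_ideal I -> I x -> I y -> I (x - y).
Proof. by move=> hI Ix Iy; case: (hI) => _ ID _; apply: ID => //; exact: is_idealN. Qed.

Lemma is_ideal_sum I (T : Type) (r : seq T) (P : pred T) (f : T -> A) :
  is_ideal I -> (forall i, P i -> I (f i)) -> I (\sum_(i <- r | P i) f i).
Proof. by move=> [I0 ID _] If; apply: big_ind. Qed.

Lemma idealM_mul I J x y : I x -> J y -> idealM I J (x * y).
Proof. by move=> Ix Jy K [_]; apply; exists x, y. Qed.

Lemma idealM_sub I J K : is_ideal K ->
  (forall x y, I x -> J y -> K (x * y)) -> idealM I J `<=` K.
Proof. by move=> hK H; apply: ideal_genP => // z [x [y [Ix Jy ->]]]; exact: H. Qed.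

Lemma idealX_mul I n p x y :
  idealX I n x -> idealX I p y -> idealX I (n + p) (x * y).
Proof.
move=> Ix Iy; elim: n x Ix => [|n IH] x Ix.
  by rewrite add0n; case: (idealX_ideal I p) => _ _; exact.
pose K := [set z | idealX I (n.+1 + p) (z * y)].
case: (idealX_ideal I (n.+1 + p)) => X0 XD XM.
suff : idealM I (idealX I n) `<=` K by exact.
apply: idealM_sub => [|u v Iu Iv]; last first.
  by rewrite /K /= -mulrA; apply: idealM_mul => //; exact: IH.
split; rewrite /K /=; first by rewrite mul0r.
  by move=> u v Ku Kv; rewrite mulrDl; exact: XD.
by move=> c u Ku; rewrite -mulrA; exact: XM.
Qed.

Lemma idealX_succ_sub I n : idealX I n.+1 `<=` idealX I n.
Proof.
apply: idealM_sub; first exact: idealX_ideal.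
by move=> x y _ Iy; case: (idealX_ideal I n) => _ _; exact.
Qed.

End Ideals.

Definition krull_dim_ge (A : comNzRingType) (n : nat) : Prop :=
  exists P : nat -> set A, (forall i, (i <= n)%N -> is_prime (P i)) /\
    (forall i, (i < n)%N -> P i `<` P i.+1).

Section Depth.
Variables (R : comPzRingType) (M : lmodType R).

Definition smulM (s : seq R) : set M :=
  [set z | exists y : nat -> M, z = \sum_(i < size s) s`_i *: y i].

Definition regular_seq (s : seq R) : Prop :=
  (forall i, (i < size s)%N -> forall z : M,
     smulM (take i s) (s`_i *: z) -> smulM (take i s) z)
  /\ smulM s <> [set: M].

Definition depth_ge (I : set R) (n : nat) : Prop :=
  exists s : seq R,
    [/\ (n <= size s)%N, forall x, x \in s -> I x & regular_seq s].

End Depth.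
Arguments depth_ge {R} M I n.

(* depth A = dim A, where both sides are suprema of lengths. *)
Definition cohen_macaulay (A : comNzRingType) (m : set A) : Prop :=
  forall n, depth_ge (A^o : lmodType A) m n <-> krull_dim_ge A n.

(* The library's {ideal_quot _} is restricted to proper ideals. *)
HB.mixin Record isAbsorbing (R : pzRingType) (S : R -> bool) := {
  absorbing_subproof : forall a u, u \in S -> a * u \in S
}.

#[short(type="ideal_pred")]
HB.structure Definition IdealPred (R : pzRingType) :=
  {S of GRing.ZmodClosed R S & isAbsorbing R S}.

Section QuotientRing.
Variables (R : comPzRingType) (J : ideal_pred R).

Definition quot_ring : Type := Quotient.quot J.
HB.instance Definition _ := Choice.on quot_ring.
HB.instance Definition _ := EqQuotient.on quot_ring.
HB.instance Definition _ := GRing.Zmodule.on quot_ring.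

Lemma quot_ring_eqP (x y : R) :
  reflect (\pi_quot_ring x = \pi_quot_ring y) (x - y \in J).
Proof. by rewrite (Quotient.idealrBE J); exact: eqP. Qed.

Definition quot_one : quot_ring := \pi_quot_ring (1 : R).
Definition quot_mul (x y : quot_ring) : quot_ring :=
  \pi_quot_ring (repr x * repr y : R).

Lemma quot_addE (x y : R) : \pi_quot_ring (x + y) = \pi x + \pi y.
Proof. exact: (@Quotient.pi_add R J). Qed.

Lemma quot_mulE (x y : R) : \pi_quot_ring (x * y) = quot_mul (\pi x) (\pi y).
Proof.
apply/quot_ring_eqP; set x' := repr _; set y' := repr _.
have hx : x - x' \in J by apply/quot_ring_eqP; rewrite reprK.
have hy : y - y' \in J by apply/quot_ring_eqP; rewrite reprK.
have -> : x * y - x' * y' = y * (x - x') + x' * (y - y').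
  by rewrite !mulrBr (mulrC y x) (mulrC y x') addrA subrK.
by apply: rpredD; apply: absorbing_subproof.
Qed.

Lemma quot_mulA : associative quot_mul.
Proof.
move=> x y z; rewrite -[x]reprK -[y]reprK -[z]reprK.
move: (repr x) (repr y) (repr z) => {}x {}y {}z.
by rewrite -(quot_mulE y z) -(quot_mulE x y) -(quot_mulE x (y * z))
  -(quot_mulE (x * y) z) mulrA.
Qed.

Lemma quot_mulC : commutative quot_mul.
Proof. by move=> x y; rewrite /quot_mul mulrC. Qed.

Lemma quot_mul1 : left_id quot_one quot_mul.
Proof.
move=> x; rewrite -[x]reprK; move: (repr x) => {}x.
by rewrite -(quot_mulE 1 x) mul1r.
Qed.

Lemma quot_mulD : left_distributive quot_mul +%R.
Proof.
move=> x y z; rewrite -[x]reprK -[y]reprK -[z]reprK.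
move: (repr x) (repr y) (repr z) => {}x {}y {}z.
by rewrite -(quot_addE x y) -(quot_mulE x z) -(quot_mulE y z)
  -(quot_mulE (x + y) z) mulrDl -(quot_addE (x * z)).
Qed.

HB.instance Definition _ := GRing.Zmodule_isComPzRing.Build quot_ring
  quot_mulA quot_mulC quot_mul1 quot_mulD.

End QuotientRing.

Section QuotientModule.
Variables (R : comPzRingType) (J : ideal_pred R).
Variables (M : lmodType R) (N : zmodClosed M).
Hypothesis NZ : GRing.scaler_closed N.
Hypothesis JM : forall r (x : M), r \in J -> r *: x \in N.

Definition quot_mod of GRing.scaler_closed N
    & (forall r (x : M), r \in J -> r *: x \in N) : Type :=
  Quotient.quot N.
Local Notation Q := (quot_mod NZ JM).
HB.instance Definition _ := Choice.on Q.
HB.instance Definition _ := EqQuotient.on Q.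
HB.instance Definition _ := GRing.Zmodule.on Q.

Lemma quot_mod_eqP (x y : M) : reflect (\pi_Q x = \pi_Q y) (x - y \in N).
Proof. by rewrite (Quotient.idealrBE N); exact: eqP. Qed.

Definition quot_scale (r : quot_ring J) (x : Q) : Q :=
  \pi_Q ((repr r : R) *: (repr x : M)).

Lemma quot_mod_addE (x y : M) : \pi_Q (x + y) = \pi x + \pi y.
Proof. exact: (@Quotient.pi_add M N). Qed.

Lemma quot_scaleE (r : R) (x : M) :
  \pi_Q (r *: x) = quot_scale (\pi r) (\pi x).
Proof.
apply/quot_mod_eqP; set r' := repr _; set x' := repr _.
have hr : r - r' \in J by apply/quot_ring_eqP; rewrite reprK.
have hx : x - x' \in N by apply/quot_mod_eqP; rewrite reprK.
have -> : r *: x - r' *: x' = (r - r') *: x + r' *: (x - x').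
  by rewrite scalerBl scalerBr addrA subrK.
by apply: rpredD; [exact: JM | exact: NZ].
Qed.

Lemma quot_scaleA a b x :
  quot_scale a (quot_scale b x) = quot_scale (a * b) x.
Proof.
rewrite -[a]reprK -[b]reprK -[x]reprK.
move: (repr a) (repr b) (repr x) => {}a {}b {}x.
rewrite -(quot_scaleE b x) -(quot_scaleE a (b *: x)) scalerA.
by rewrite (quot_scaleE (a * b)) quot_mulE.
Qed.

Lemma quot_scale1 : left_id 1 quot_scale.
Proof.
move=> x; rewrite -[x]reprK; move: (repr x) => {}x.
by rewrite -(quot_scaleE 1 x) scale1r.
Qed.

Lemma quot_scaleDr : right_distributive quot_scale +%R.
Proof.
move=> a x y; rewrite -[a]reprK -[x]reprK -[y]reprK.
move: (repr a) (repr x) (repr y) => {}a {}x {}y.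
by rewrite -(quot_mod_addE x y) -(quot_scaleE a x) -(quot_scaleE a y)
  -(quot_scaleE a (x + y)) scalerDr -(quot_mod_addE (a *: x)).
Qed.

Lemma quot_scaleDl x : {morph quot_scale^~ x : a b / a + b}.
Proof.
move=> a b; rewrite -[a]reprK -[b]reprK -[x]reprK.
move: (repr a) (repr b) (repr x) => {}a {}b {}x.
by rewrite -(quot_addE J a b) -(quot_scaleE a x) -(quot_scaleE b x)
  -(quot_scaleE (a + b) x) scalerDl -(quot_mod_addE (a *: x)).
Qed.

HB.instance Definition _ := GRing.Zmodule_isLmodule.Build (quot_ring J) Q
  quot_scaleA quot_scale1 quot_scaleDr quot_scaleDl.

End QuotientModule.

Definition reduced (R : pzRingType) : Prop :=
  forall (x : R) (n : nat), x ^+ n = 0 -> x = 0.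

Section Completion.
Variables (A : comNzRingType) (m : set A).

Definition cauchy_pred : {pred nat -> A} := fun u =>
  `[< forall n : nat, exists N : nat, forall i j : nat,
      (N <= i)%N -> (N <= j)%N -> idealX m n (u i - u j) >].

Lemma cauchy_subring : subring_closed cauchy_pred.
Proof.
split=> [|u v /asboolP hu /asboolP hv|u v /asboolP hu /asboolP hv];
  apply/asboolP => n.
- by exists 0%N => i j _ _ /=; rewrite subrr; case: (idealX_ideal m n).
- have [N1 h1] := hu n; have [N2 h2] := hv n.
  exists (maxn N1 N2) => i j; rewrite !geq_max => /andP[i1 i2] /andP[j1 j2].
  have -> : (u - v) i - (u - v) j = (u i - u j) - (v i - v j).
    by rewrite /= !fctE !opprD [LHS]addrACA.
  by apply: is_idealB; [exact: idealX_ideal | exact: h1 | exact: h2].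
- have [N1 h1] := hu n; have [N2 h2] := hv n.
  exists (maxn N1 N2) => i j; rewrite !geq_max => /andP[i1 i2] /andP[j1 j2].
  have -> : (u * v) i - (u * v) j = v i * (u i - u j) + u j * (v i - v j).
    by rewrite /= !fctE !mulrBr (mulrC (v i) (u i)) (mulrC (v i) (u j)) addrA subrK.
  case: (idealX_ideal m n) => _ ID IM.
  by apply: ID; apply: IM; [exact: h1 | exact: h2].
Qed.

HB.instance Definition _ :=
  GRing.isSubringClosed.Build (nat -> A) cauchy_pred cauchy_subring.

Record cauchy_seq : Type := CauchySeq
  { cauchy_val :> nat -> A; _ : cauchy_val \in cauchy_pred }.
HB.instance Definition _ := [isSub for cauchy_val].
HB.instance Definition _ := [Choice of cauchy_seq by <:].
HB.instance Definition _ := [SubChoice_isSubComNzRing of cauchy_seq by <:].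

Definition null_pred : {pred cauchy_seq} := fun u =>
  `[< forall n : nat, exists N : nat, forall i : nat,
      (N <= i)%N -> idealX m n (u i) >].

Lemma null_zmod : zmod_closed null_pred.
Proof.
split=> [|u v /asboolP hu /asboolP hv]; apply/asboolP => n.
  by exists 0%N => i _; case: (idealX_ideal m n).
have [N1 h1] := hu n; have [N2 h2] := hv n.
exists (maxn N1 N2) => i; rewrite !geq_max => /andP[i1 i2].
by apply: is_idealB; [exact: idealX_ideal | exact: h1 | exact: h2].
Qed.

Lemma null_absorbing a u : u \in null_pred -> a * u \in null_pred.
Proof.
move=> /asboolP hu; apply/asboolP => n; have [N h] := hu n.
by exists N => i Ni; case: (idealX_ideal m n) => _ _; apply; exact: h.
Qed.

HB.instance Definition _ := GRing.isZmodClosed.Build cauchy_seq null_pred null_zmod.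
HB.instance Definition _ := isAbsorbing.Build cauchy_seq null_pred null_absorbing.

(* m-adic Cauchy sequences modulo null sequences. *)
Definition completion : comPzRingType := quot_ring null_pred.

Definition analytically_unramified : Prop := reduced completion.

End Completion.

Section Filtrations.
Variable A : comNzRingType.

Record filtration (a : set A) := Filtration {
  filt :> nat -> set A;
  filt_ideal : forall n, is_ideal (filt n);
  filt0 : filt 0%N = [set: A];
  filt_decr : forall n, filt n.+1 `<=` filt n;
  filt_base : a `<=` filt 1%N;
  filt_mul : forall n p, idealM (filt n) (filt p) `<=` filt (n + p)%N
}.

Definition stable_filtration (a : set A) (F : filtration a) : Prop :=
  F 1%N <> [set: A] /\
  exists N : nat, forall n, (N <= n)%N -> idealM a (F n) = F n.+1.

Definition asymptotic_ic_filtration (a : set A) (F : filtration a) : Prop :=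
  stable_filtration F /\
  exists N : nat, forall n, (N <= n)%N -> F n = int_closure (idealX a n).

Lemma filt_idealX (a : set A) (F : filtration a) n : idealX a n `<=` F n.
Proof.
elim: n => [|n IH]; first by rewrite filt0.
apply: idealM_sub => [|x y ax ay]; first exact: filt_ideal.
apply: (@filt_mul _ F 1 n); apply: idealM_mul; last exact: IH.
exact: filt_base.
Qed.

Lemma filt_le (a : set A) (F : filtration a) n p :
  (n <= p)%N -> F p `<=` F n.
Proof.
move=> /subnK <-; elim: (p - n)%N => [|k IH] //.
by rewrite addSn; apply: subset_trans IH; exact: filt_decr.
Qed.

Section Veronese.
Variables (a : set A) (F : filtration a) (k : nat).

Let V (n : nat) : set A := F (n * k)%N.

Lemma veronese_ideal n : is_ideal (V n). Proof. exact: filt_ideal. Qed.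
Lemma veronese0 : V 0%N = [set: A]. Proof. exact: filt0. Qed.
Lemma veronese_decr n : V n.+1 `<=` V n.
Proof. by apply: filt_le; rewrite leq_mul2r leqnSn orbT. Qed.
Lemma veronese_base : idealX a k `<=` V 1%N.
Proof. by rewrite /V mul1n; exact: filt_idealX. Qed.
Lemma veronese_mul n p : idealM (V n) (V p) `<=` V (n + p)%N.
Proof. by rewrite /V mulnDl; exact: filt_mul. Qed.

Definition veronese : filtration (idealX a k) :=
  @Filtration _ (fun n => F (n * k)%N)
    veronese_ideal veronese0 veronese_decr veronese_base veronese_mul.

End Veronese.
End Filtrations.

Section Graded.
Variable A : comNzRingType.

Section Ring.
Variable a : set A.

Definition rees_pred : {pred {poly A}} :=
  fun p => `[< forall n : nat, idealX a n p`_n >].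

Lemma rees_subring : subring_closed rees_pred.
Proof.
split=> [|p q /asboolP hp /asboolP hq|p q /asboolP hp /asboolP hq];
  apply/asboolP => n.
- by case: n => [//|n]; rewrite coef1; case: (idealX_ideal a n.+1).
- by rewrite coefB; apply: is_idealB => //;
  exact: idealX_ideal.
- rewrite coefM; apply: is_ideal_sum => [|i _]; first exact: idealX_ideal.
  by rewrite -{1}(subnKC (leq_ord i)); exact: idealX_mul.
Qed.

HB.instance Definition _ :=
  GRing.isSubringClosed.Build {poly A} rees_pred rees_subring.

(* The Rees algebra A[at], as a subring of A[t]. *)
Record rees : Type := Rees { rees_val :> {poly A}; _ : rees_val \in rees_pred }.
HB.instance Definition _ := [isSub for rees_val].
HB.instance Definition _ := [Choice of rees by <:].
HB.instance Definition _ := [SubChoice_isSubComNzRing of rees by <:].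

(* The ideal a A[at], with degree n component a^(n+1). *)
Definition rees_shift_pred : {pred rees} :=
  fun p => `[< forall n : nat, idealX a n.+1 (rees_val p)`_n >].

Lemma rees_coef (p : rees) n : idealX a n (rees_val p)`_n.
Proof. by case: p => p /= /asboolP. Qed.

Lemma rees_shift_zmod : zmod_closed rees_shift_pred.
Proof.
split=> [|p q /asboolP hp /asboolP hq]; apply/asboolP => n.
  by rewrite (_ : rees_val 0 = 0) // coef0; case: (idealX_ideal a n.+1).
by rewrite (_ : rees_val (p - q) = rees_val p - rees_val q) // coefB;
  apply: (@is_idealB _ (idealX a n.+1)) => //; exact: idealX_ideal.
Qed.

Lemma rees_shift_absorbing p q :
  q \in rees_shift_pred -> p * q \in rees_shift_pred.
Proof.
move=> /asboolP hq; apply/asboolP => n.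
rewrite (_ : rees_val (p * q) = rees_val p * rees_val q) // coefM.
apply: is_ideal_sum => [|i _]; first exact: idealX_ideal.
rewrite -{1}(subnKC (leq_ord i)) -addnS; apply: idealX_mul => //.
exact: rees_coef.
Qed.

HB.instance Definition _ :=
  GRing.isZmodClosed.Build rees rees_shift_pred rees_shift_zmod.
HB.instance Definition _ :=
  isAbsorbing.Build rees rees_shift_pred rees_shift_absorbing.

Definition gr_ring : comPzRingType := quot_ring rees_shift_pred.

(* m/a in degree 0 and everything in positive degrees; the homogeneous
   maximal ideal of gr_ring when m is the maximal ideal of A and a <= m. *)
Definition gr_max_ideal (m : set A) : set gr_ring :=
  [set \pi_(quot_ring rees_shift_pred) p
     | p in [set p : rees | m (rees_val p)`_0]].

End Ring.

Section Module.
Variables (a : set A) (F : filtration a).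

Definition filt_pred : {pred {poly A}} :=
  fun p => `[< forall n : nat, F n p`_n >].

Lemma filt_zmod : zmod_closed filt_pred.
Proof.
split=> [|p q /asboolP hp /asboolP hq]; apply/asboolP => n.
  by rewrite coef0; case: (filt_ideal F n).
by rewrite coefB; apply: is_idealB => //;
  exact: filt_ideal.
Qed.

HB.instance Definition _ :=
  GRing.isZmodClosed.Build {poly A} filt_pred filt_zmod.

(* The Rees module \bigoplus_n F_n t^n. *)
Record filt_mod : Type :=
  FiltMod { filt_val :> {poly A}; _ : filt_val \in filt_pred }.
HB.instance Definition _ := [isSub for filt_val].
HB.instance Definition _ := [Choice of filt_mod by <:].
HB.instance Definition _ := [SubChoice_isSubZmodule of filt_mod by <:].

Lemma filt_coef (x : filt_mod) n : F n (filt_val x)`_n.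
Proof. by case: x => x /= /asboolP. Qed.

Lemma filt_coefM (r : rees a) (p : {poly A}) k :
  (forall n, F (n + k)%N p`_n) -> forall n, F (n + k)%N (rees_val r * p)`_n.
Proof.
move=> hp n; rewrite coefM; apply: is_ideal_sum => [|i _]; first exact: filt_ideal.
rewrite -{1}(subnKC (leq_ord i)) -addnA; apply: (@filt_mul _ _ F).
by apply: idealM_mul => //; apply/filt_idealX/rees_coef.
Qed.

Lemma filt_scale_subproof (r : rees a) (x : filt_mod) :
  rees_val r * filt_val x \in filt_pred.
Proof.
apply/asboolP => n; rewrite -[n in F n]addn0; apply: filt_coefM => k.
by rewrite addn0; exact: filt_coef.
Qed.

Definition filt_scale (r : rees a) (x : filt_mod) : filt_mod :=
  FiltMod (filt_scale_subproof r x).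

Lemma filt_scaleA r s x : filt_scale r (filt_scale s x) = filt_scale (r * s) x.
Proof. by apply: val_inj; rewrite /= mulrA. Qed.
Lemma filt_scale1 : left_id 1 filt_scale.
Proof. by move=> x; apply: val_inj; rewrite /= mul1r. Qed.
Lemma filt_scaleDr : right_distributive filt_scale +%R.
Proof. by move=> r x y; apply: val_inj; rewrite /= mulrDr. Qed.
Lemma filt_scaleDl x : {morph filt_scale^~ x : r s / r + s}.
Proof. by move=> r s; apply: val_inj; rewrite /= mulrDl. Qed.

HB.instance Definition _ := GRing.Zmodule_isLmodule.Build (rees a) filt_mod
  filt_scaleA filt_scale1 filt_scaleDr filt_scaleDl.

Definition filt_shift_pred : {pred filt_mod} :=
  fun x => `[< forall n : nat, F n.+1 (filt_val x)`_n >].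

Lemma filt_shift_zmod : zmod_closed filt_shift_pred.
Proof.
split=> [|x y /asboolP hx /asboolP hy]; apply/asboolP => n.
  by rewrite (_ : filt_val 0 = 0) // coef0; case: (filt_ideal F n.+1).
rewrite (_ : filt_val (x - y) = filt_val x - filt_val y) // coefB.
by apply: is_idealB => //; exact: filt_ideal.
Qed.

Lemma filt_shift_scale : GRing.scaler_closed filt_shift_pred.
Proof.
move=> r x /asboolP hx; apply/asboolP => n.
by rewrite -addn1; apply: filt_coefM => k; rewrite addn1; exact: hx.
Qed.

HB.instance Definition _ :=
  GRing.isZmodClosed.Build filt_mod filt_shift_pred filt_shift_zmod.

Lemma filt_shift_annihil (r : rees a) (x : filt_mod) :
  r \in @rees_shift_pred a -> r *: x \in filt_shift_pred.
Proof.
move=> /asboolP hr; apply/asboolP => n /=; rewrite coefM.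
apply: is_ideal_sum => [|i _]; first exact: filt_ideal.
rewrite -{1}(subnKC (leq_ord i)) -addSn; apply: (@filt_mul _ _ F).
by apply: idealM_mul; [apply: (filt_idealX F); exact: hr | exact: filt_coef].
Qed.

(* \bigoplus_n F_n / F_(n+1) as a module over \bigoplus_n a^n / a^(n+1). *)
Definition gr_mod : lmodType (gr_ring a) :=
  quot_mod filt_shift_scale filt_shift_annihil.

End Module.
End Graded.
Arguments gr_max_ideal {A} a m.

(* Main.v *)
(* Superficial elements x_1, ..., x_d for F are chosen as long as the depth of the
   quotient is positive; A being Cohen-Macaulay, they then generate an m-primary
   ideal.  Suitable powers of them, all of the same degree s, generate an ideal I
   with F_(n0 + sj) <= I^j.  Let x and y be the first two of these powers.  The
   initial forms of x^k and y^k form a regular sequence as soon as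
       y^k z - x^k w \in F_(nk + sk)  implies  z \in F_(nk) + x^k A.
   For n > s and k large this follows from superficiality, by filtering A/x^k A.
   For n <= s it is a form of a theorem of Itoh, and z itself lies in F_(nk): the
   fractions u = z/x^k and v = w/y^k differ by an element of asymptotic I-order at
   least (n - s)k/s, so if u had a smaller (hence negative) order, u^j and v^j
   would have the same leading form for all j.  These leading forms lie in
   B_x \cap B_y, where B is the associated graded ring of the asymptotic I-order,
   and their degrees tend to -oo.  But B is a finite torsion-free module over the
   polynomial ring gr_I(A)/m gr_I(A), hence is contained in a free module up to
   multiplication by a nonzero form, and there B_x \cap B_y is bounded below. *)
From HB Require Import structures.
Require Import Defs.
From mathcomp Require Import all_boot all_algebra generic_quotient.
From mathcomp Require Import boolp classical_sets.
From mathcomp Require Import zify ring.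

Set Implicit Arguments.
Unset Strict Implicit.
Unset Printing Implicit Defensive.

Import GRing.Theory.

Local Open Scope classical_set_scope.
Local Open Scope ring_scope.

(** * Ideals of a Noetherian local ring *)

(** The residue field may be finite, so a superficial element need not exist in a itself; it is
    found in some power a^s. This is why degrees accompany the elements throughout and are equalised
    only afterwards, by taking powers. Graded modules are not formed before the last step: a graded
    submodule is a sequence of ideals of A, a class vanishes when a representative lies in the next
    ideal, and Noetherianity comes from a surjection of an iterated polynomial ring onto the Rees
    algebra. The Cohen-Macaulay hypothesis enters as equality of depth and dimension: a regular
    sequence whose quotient has depth 0 is of maximal length, so it has at least two terms and
    generates an m-primary ideal. Integral closure enters only through bounds b^j in a^(nj - C) for
    all j, with C fixed, which put b in F_n once n is at least a fixed N. Each estimate may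
    therefore lose a bounded amount, and orders i/q with q growing recover the exact statement in
    the limit. *)

Lemma decreasing_sub (T : Type) (F : nat -> set T) :
  (forall n, F n.+1 `<=` F n) -> forall n p, (n <= p)%N -> F p `<=` F n.
Proof.
move=> Fdec n p /subnK <-; elim: (p - n)%N => [|k IH]; first exact: subset_refl.
by rewrite addSn; apply: subset_trans IH; apply: Fdec.
Qed.

Section IdealBasics.
Variable A : comNzRingType.
Implicit Types (I J K Q m : set A) (x y z : A).

(** J + xA by a witness instead of as a generated ideal: membership destructs into a congruence
    modulo J. *)
Definition addgen J x : set A := [set w | exists c, J (w - c * x)].
Definition idealD I J : set A := [set w | exists2 f, I f & J (w - f)].

Lemma ideal0 I : is_ideal I -> I 0. Proof. by case. Qed.
Lemma ideal_add I x y : is_ideal I -> I x -> I y -> I (x + y).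
Proof. by case=> _ ID _; apply: ID. Qed.
Lemma ideal_mull I c x : is_ideal I -> I x -> I (c * x).
Proof. by case=> _ _; apply. Qed.
Lemma ideal_mulr I c x : is_ideal I -> I x -> I (x * c).
Proof. by rewrite mulrC; apply: ideal_mull. Qed.
Lemma ideal_subr I x y : is_ideal I -> I y -> I (x + y) -> I x.
Proof. by move=> hI Iy Ixy; rewrite -(addrK y x); apply: is_idealB. Qed.

Lemma ideal_eqB I x y : is_ideal I -> I (x - y) -> I y -> I x.
Proof. by move=> hI Ixy Iy; rewrite -(subrK y x); apply: ideal_add. Qed.

Lemma idealM_ideal I J : is_ideal (idealM I J).
Proof. exact: ideal_gen_ideal. Qed.

Lemma is_ideal_zero : is_ideal [set (0 : A)].
Proof. by split=> //= [x y -> ->|c x ->]; rewrite ?addr0 ?mulr0. Qed.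

Lemma addgen_ideal J x : is_ideal J -> is_ideal (addgen J x).
Proof.
move=> hJ; split.
- by exists 0; rewrite mul0r subrr; apply: ideal0.
- move=> u v [c Jc] [d Jd]; exists (c + d).
  have -> : u + v - (c + d) * x = (u - c * x) + (v - d * x) by ring.
  exact: ideal_add.
- move=> c u [d Jd]; exists (c * d).
  have -> : c * u - c * d * x = c * (u - d * x) by ring.
  exact: ideal_mull.
Qed.

Lemma addgen_sub J x : is_ideal J -> J `<=` addgen J x.
Proof. by move=> hJ u Ju; exists 0; rewrite mul0r subr0. Qed.

Lemma addgen_gen J x : is_ideal J -> addgen J x x.
Proof. by move=> hJ; exists 1; rewrite mul1r subrr; apply: ideal0. Qed.

Lemma addgen_mul J x c : is_ideal J -> addgen J x (c * x).
Proof. by move=> hJ; exists c; rewrite subrr; apply: ideal0. Qed.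

Lemma addgen_le J K x : is_ideal K -> J `<=` K -> K x -> addgen J x `<=` K.
Proof.
move=> hK JK Kx u [c Jc]; rewrite -(subrK (c * x) u).
by apply: ideal_add => //; [apply: JK | apply: ideal_mull].
Qed.

Lemma addgenC J x y : addgen (addgen J x) y = addgen (addgen J y) x.
Proof.
by apply/seteqP; split=> w [c [d H]]; exists d; exists c; move: H;
  rewrite -!addrA [- _ - _]addrC.
Qed.

Lemma idealD_ideal I J : is_ideal I -> is_ideal J -> is_ideal (idealD I J).
Proof.
move=> hI hJ; split.
- by exists 0; rewrite ?subrr; apply: ideal0.
- move=> u v [f If Jf] [g Ig Jg]; exists (f + g); first exact: ideal_add.
  have -> : u + v - (f + g) = (u - f) + (v - g) by ring.
  exact: ideal_add.
- move=> c u [f If Jf]; exists (c * f); first exact: ideal_mull.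
  by rewrite -mulrBr; apply: ideal_mull.
Qed.

Lemma idealD_subl I J : is_ideal J -> I `<=` idealD I J.
Proof. by move=> hJ u Iu; exists u => //; rewrite subrr; apply: ideal0. Qed.

Lemma idealD_subr I J : is_ideal I -> J `<=` idealD I J.
Proof. by move=> hI u Ju; exists 0; [apply: ideal0 | rewrite subr0]. Qed.

Lemma idealD_le I J K : is_ideal K -> I `<=` K -> J `<=` K -> idealD I J `<=` K.
Proof.
move=> hK IK JK u [f If Jf]; rewrite -(subrK f u).
by apply: ideal_add => //; [apply: JK | apply: IK].
Qed.

Lemma idealDS I I' J J' : I `<=` I' -> J `<=` J' -> idealD I J `<=` idealD I' J'.
Proof. by move=> II' JJ' u [f If Jf]; exists f; [apply: II' | apply: JJ']. Qed.

Lemma idealMS I I' J J' : I `<=` I' -> J `<=` J' -> idealM I J `<=` idealM I' J'.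
Proof.
move=> II' JJ'; apply: idealM_sub; first exact: idealM_ideal.
by move=> x y Ix Jy; apply: idealM_mul; [apply: II'|apply: JJ'].
Qed.

Lemma idealM_subr I J : is_ideal J -> idealM I J `<=` J.
Proof. by move=> hJ; apply: idealM_sub => // x y _ Jy; apply: ideal_mull. Qed.

Lemma idealM_subl I J : is_ideal I -> idealM I J `<=` I.
Proof. by move=> hI; apply: idealM_sub => // x y Ix _; apply: ideal_mulr. Qed.

Lemma idealMC I J : idealM I J = idealM J I.
Proof.
by apply/seteqP; split; apply: idealM_sub; try exact: idealM_ideal;
  move=> x y hx hy; rewrite mulrC; apply: idealM_mul.
Qed.

Lemma colon_ideal K y : is_ideal K -> is_ideal [set z | K (z * y)].
Proof.
move=> hK; split=> /=; first by rewrite mul0r; apply: ideal0.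
  by move=> u v Ku Kv; rewrite mulrDl; apply: ideal_add.
by move=> c u Ku; rewrite -mulrA; apply: ideal_mull.
Qed.

Lemma idealM_mul_le I J K y : is_ideal K ->
  (forall u v, I u -> J v -> K (u * v * y)) ->
  forall w, idealM I J w -> K (w * y).
Proof. by move=> hK H; apply: idealM_sub => //; apply: colon_ideal. Qed.

Lemma idealMA I J K : idealM I (idealM J K) = idealM (idealM I J) K.
Proof.
apply/seteqP; split; apply: idealM_sub; try exact: idealM_ideal.
  move=> x y Ix; rewrite mulrC.
  apply: idealM_mul_le; first exact: idealM_ideal.
  move=> u v Ju Kv; rewrite -mulrA [v * x]mulrC mulrA [u * x]mulrC.
  by apply: idealM_mul => //; apply: idealM_mul.
move=> x y IJx Ky; apply: idealM_mul_le IJx; first exact: idealM_ideal.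
by move=> u v Iu Jv; rewrite -mulrA; do 2 apply: idealM_mul => //.
Qed.

Lemma idealM1 I : is_ideal I -> idealM [set: A] I = I.
Proof.
move=> hI; apply/seteqP; split; first exact: idealM_subr.
by move=> x Ix; rewrite -[x]mul1r; apply: idealM_mul.
Qed.

Lemma idealX1 I : is_ideal I -> idealX I 1 = I.
Proof. by move=> hI; rewrite /= idealMC idealM1. Qed.

Lemma idealXD I n p : idealX I (n + p) = idealM (idealX I n) (idealX I p).
Proof.
elim: n => [|n IH] /=; first by rewrite idealM1 //; apply: idealX_ideal.
by rewrite IH idealMA.
Qed.

Lemma idealXM I n p : idealX I (n * p) = idealX (idealX I n) p.
Proof.
elim: p => [|p IH]; first by rewrite muln0.
by rewrite mulnS idealXD IH.
Qed.

Lemma idealX_le I n p : (n <= p)%N -> idealX I p `<=` idealX I n.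
Proof. by apply: decreasing_sub => k; apply: idealX_succ_sub. Qed.

Lemma idealXS I J n : I `<=` J -> idealX I n `<=` idealX J n.
Proof. by move=> IJ; elim: n => //= n IH; apply: idealMS. Qed.

Lemma idealX_expr I x n : I x -> idealX I n (x ^+ n).
Proof. by move=> Ix; elim: n => //= n IH; rewrite exprS; apply: idealM_mul. Qed.

Lemma idealX_exprM I x n p : idealX I n x -> idealX I (n * p) (x ^+ p).
Proof. by move=> Ix; rewrite idealXM; apply: idealX_expr. Qed.

Lemma idealX_subI I n : is_ideal I -> idealX I n.+1 `<=` I.
Proof. by move=> hI; apply: idealM_subl. Qed.

Lemma ideal_genS (S T : set A) : S `<=` ideal_gen T -> ideal_gen S `<=` ideal_gen T.
Proof. by move=> ST; apply: ideal_genP => //; apply: ideal_gen_ideal. Qed.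

Lemma ideal_gen_in (S : set A) x : S x -> ideal_gen S x.
Proof. by move=> Sx J [_]; apply. Qed.

Lemma ideal_gen_cons x (s : seq A) :
  ideal_gen [set` (x :: s)] = addgen (ideal_gen [set` s]) x.
Proof.
have hs := ideal_gen_ideal [set` s].
apply/seteqP; split.
  apply: ideal_genP; first exact: addgen_ideal.
  move=> z /=; rewrite inE => /orP[/eqP ->|zs]; first exact: addgen_gen.
  by apply: addgen_sub => //; apply: ideal_gen_in.
apply: addgen_le; first exact: ideal_gen_ideal.
  apply: ideal_genS => z /= zs; apply: ideal_gen_in => /=.
  by rewrite inE zs orbT.
by apply: ideal_gen_in; rewrite /= mem_head.
Qed.

Lemma ideal_gen_nil : ideal_gen [set` ([::] : seq A)] = [set 0].
Proof.
apply/seteqP; split; first by apply: ideal_genP; [exact: is_ideal_zero|].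
by move=> z ->; apply: ideal0; apply: ideal_gen_ideal.
Qed.

End IdealBasics.

Section Noetherian.
Variable A : comNzRingType.
Hypothesis noethA : noetherian A.
Implicit Types (I J K Q m : set A) (x y z : A).

(** The union of a nonempty chain in C is generated by finitely many elements, all lying in one
    member of the chain, which is therefore an upper bound; Zorn's lemma applies without any closure
    property of C. *)
Lemma noeth_max (C : set (set A)) : C `<=` @is_ideal A -> C !=set0 ->
  exists2 I, C I & forall J, C J -> I `<=` J -> J = I.
Proof.
move=> CI [I0 CI0].
pose R (I J : {I | C I}) := `[< sval I `<=` sval J >].
have [||I J|F totF|[I hI] maxI] := @Zorn {I | C I} R.
- by move=> I; apply/asboolP.
- by move=> I J K /asboolP IJ /asboolP JK; apply/asboolP; apply: subset_trans JK.
- case: I J => [I hI] [J hJ] /asboolP /= IJ /asboolP /= JI.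
  by apply/eq_exist/seteqP.
- have [[J0 FJ0]|F0] := pselect (F !=set0); last first.
    by exists (exist _ I0 CI0) => J FJ; case: F0; exists J.
  pose U := \bigcup_(J in F) sval J.
  have hU : is_ideal U.
    split.
    + by exists J0 => //; apply: ideal0; apply: CI; apply: (svalP J0).
    + move=> x y [J FJ Jx] [K FK Ky].
      have [/asboolP JK|/asboolP KJ] := totF _ _ FJ FK.
        exists K => //; apply: ideal_add => //; last exact: JK.
        by apply: CI; apply: svalP.
      exists J => //; apply: ideal_add => //; last exact: KJ.
      by apply: CI; apply: svalP.
    + move=> c x [J FJ Jx]; exists J => //; apply: ideal_mull => //.
      by apply: CI; apply: svalP.
  have [s Us] := noethA hU.
  have [J FJ sJ] : exists2 J, F J & [set` s] `<=` sval J.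
    have : [set` s] `<=` U by rewrite Us => z sz; apply: ideal_gen_in.
    elim: (s) => [|x t IH] tU; first by exists J0.
    have [|J FJ tJ] := IH; first by move=> z tz; apply: tU; rewrite /= inE tz orbT.
    have [K FK Kx] := tU x (mem_head _ _).
    have [/asboolP JK|/asboolP KJ] := totF _ _ FJ FK.
      exists K => // z /=; rewrite inE => /orP[/eqP -> //|tz].
      by apply: JK; apply: tJ.
    exists J => // z /=; rewrite inE => /orP[/eqP -> |tz]; first exact: KJ.
    exact: tJ.
  exists J => K FK; apply/asboolP => z Kz.
  have : U z by exists K.
  by rewrite Us; apply: ideal_genP sJ _; apply: CI; apply: svalP.
- exists I => // J hJ IJ.
  have /(congr1 sval) //= := maxI (exist _ J hJ) (asboolT IJ).
Qed.

Lemma is_maximal_exists I : is_ideal I -> ~ I 1 ->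
  exists2 M, is_maximal M & I `<=` M.
Proof.
move=> hI I1; have [|| M [hM M1 IM] maxM] :=
  @noeth_max [set J | [/\ is_ideal J, ~ J 1 & I `<=` J]].
- by move=> L [].
- by exists I; split=> //; apply: subset_refl.
exists M => //; split=> // J hJ MJ.
have [J1|J1] := pselect (J 1).
  right; apply/seteqP; split=> // z _; rewrite -[z]mulr1; exact: ideal_mull.
by left; apply: maxM => //; split=> //; apply: subset_trans MJ.
Qed.

End Noetherian.

Section Local.
Variables (A : comNzRingType) (m : set A).
Hypotheses (noethA : noetherian A) (locA : is_local m).
Implicit Types (I J K Q : set A) (x y z : A).

Lemma local_ideal : is_ideal m. Proof. by case: locA => [[]]. Qed.
Lemma local_proper : ~ m 1. Proof. by case: locA => [[]]. Qed.

Lemma proper_sub_local I : is_ideal I -> ~ I 1 -> I `<=` m.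
Proof.
move=> hI I1; have [M hM IM] := is_maximal_exists noethA hI I1.
by case: locA => _ /(_ _ hM) <-.
Qed.

Lemma local_unit c : ~ m c -> exists d, d * c = 1.
Proof.
move=> mc; apply: contrapT => hc; apply: mc.
have hz := @is_ideal_zero A.
apply: (@proper_sub_local (addgen [set 0] c)).
- exact: addgen_ideal.
- by move=> [d] /= /eqP; rewrite subr_eq0 => /eqP e; apply: hc; exists d.
- exact: addgen_gen.
Qed.

Lemma unit_cancel K c z : is_ideal K -> ~ m c -> K (c * z) -> K z.
Proof.
move=> hK /local_unit[d dc] Kcz; rewrite -[z]mul1r -dc -mulrA.
exact: ideal_mull.
Qed.

Lemma is_prime_local : is_prime m.
Proof.
split; [exact: local_ideal|exact: local_proper|] => x y mxy.
have [mx|mx] := pselect (m x); [by left|right].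
by apply: unit_cancel mxy => //; apply: local_ideal.
Qed.

Lemma sub1_local r : m r -> ~ m (1 - r).
Proof.
move=> mr mr1; apply: local_proper; rewrite -(subrK r 1).
by apply: ideal_add => //; apply: local_ideal.
Qed.

(* A submodule K' of K maximal among the proper ones containing Q satisfies
   m K <= K'. *)
Lemma nakayama a K Q : is_ideal K -> is_ideal Q -> a `<=` m ->
  K `<=` idealD (idealM a K) Q -> K `<=` Q.
Proof.
move=> hK hQ am KaK; apply: contrapT => KQ.
have QK : idealD Q K `<=` idealD (idealM a (idealD Q K)) Q.
  apply: idealD_le.
  - by apply: idealD_ideal => //; apply: idealM_ideal.
  - by apply: idealD_subr; apply: idealM_ideal.
  - apply: subset_trans KaK _; apply: idealDS => //.
    by apply: idealMS => //; apply: idealD_subr.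
set K1 := idealD Q K in QK; have hK1 : is_ideal K1 by apply: idealD_ideal.
have [||L [hL QL LK1 LnK] maxL] := @noeth_max _ noethA
   [set L | [/\ is_ideal L, Q `<=` L, L `<=` K1 & ~ K1 `<=` L]].
- by move=> L [].
- exists Q; split=> //; first exact: idealD_subl.
  by move=> H; apply: KQ; apply: subset_trans H; apply: idealD_subr.
have [z K1z Lz] : exists2 z, K1 z & ~ L z.
  apply: contrapT => H; apply: LnK => z K1z; apply: contrapT => Lz.
  by apply: H; exists z.
have addz w : K1 w -> ~ L w -> K1 `<=` addgen L w.
  move=> K1w Lw; apply: contrapT => H; apply: Lw.
  rewrite -(maxL (addgen L w)); first exact: addgen_gen.
    split=> //; first exact: addgen_ideal.
      by apply: subset_trans QL _; apply: addgen_sub.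
    exact: addgen_le.
  exact: addgen_sub.
(* If r z were outside L, maximality would give z = c r z modulo L, and 1 - c r is a unit. *)
have mz r : m r -> L (r * z).
  move=> mr; apply: contrapT => Lrz.
  have [c Lc] := addz _ (ideal_mull r hK1 K1z) Lrz _ K1z.
  apply: Lz; apply: (@unit_cancel _ (1 - c * r)) => //.
    by apply: sub1_local; apply: ideal_mull => //; apply: local_ideal.
  by rewrite mulrBl mul1r -mulrA.
apply: LnK; apply: subset_trans QK _; apply: idealD_le => //.
apply: idealM_sub => // r w /am mr /(addz _ K1z Lz) [c Lc].
have -> : r * w = r * (w - c * z) + c * (r * z) by ring.
by apply: ideal_add => //; apply: ideal_mull => //; apply: mz.
Qed.

End Local.

(** * Hilbert's basis theorem and Rees algebras *)

Section Hilbert.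
Variable R : comNzRingType.
Hypothesis noethR : noetherian R.
Implicit Types (L : set {poly R}) (n : nat).

Definition lead_ideal L n : set R :=
  [set c | exists p, [/\ L p, (size p <= n.+1)%N & p`_n = c]].

Lemma lead_ideal_ideal L n : is_ideal L -> is_ideal (lead_ideal L n).
Proof.
move=> hL; split.
- by exists 0; rewrite size_poly0 coef0; split=> //; apply: ideal0.
- move=> _ _ [p [Lp sp <-]] [q [Lq sq <-]]; exists (p + q).
  rewrite coefD; split=> //; first exact: ideal_add.
  by rewrite (leq_trans (size_polyD _ _)) // geq_max sp.
- move=> c _ [p [Lp sp <-]]; exists (c%:P * p).
  rewrite coefCM; split=> //; first exact: ideal_mull.
  by rewrite mul_polyC (leq_trans (size_scale_leq _ _)).
Qed.

Lemma lead_ideal_le L n k : is_ideal L -> (n <= k)%N ->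
  lead_ideal L n `<=` lead_ideal L k.
Proof.
move=> hL nk _ [p [Lp sp <-]]; exists ('X^(k - n) * p); split.
- exact: ideal_mull.
- rewrite (leq_trans (size_polyMleq _ _)) // size_polyXn; lia.
- by rewrite coefXnM ltnNge leq_subr /= subKn.
Qed.

Lemma lead_idealS L L' n : L `<=` L' -> lead_ideal L n `<=` lead_ideal L' n.
Proof. by move=> LL' _ [p [Lp sp <-]]; exists p; split=> //; apply: LL'. Qed.

(** The ideals of leading coefficients grow with the degree and are constant from some n0 on.
    Elements of L lifting generators of those in degrees up to n0 suffice: subtracting a combination
    of them lowers the size of any member of L. *)
Lemma hilbert_basis : noetherian {poly R}.
Proof.
move=> L hL.
have hl n := lead_ideal_ideal n hL.
have [||_ [n0 _ <-] max0] := @noeth_max _ noethR (range (lead_ideal L)).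
- by move=> _ [n _ <-].
- by exists (lead_ideal L 0); exists 0%N.
have lead_fg n : exists2 s : seq {poly R}, [set` s] `<=` L &
    lead_ideal L n `<=` lead_ideal (ideal_gen [set` s]) n.
  have [t tE] := noethR (hl n).
  have tL : [set` t] `<=` lead_ideal L n by rewrite tE => z tz; apply: ideal_gen_in.
  rewrite tE {tE}; elim: t tL => [|c t IH] tL.
    exists [::] => //; rewrite ideal_gen_nil => _ ->; apply: ideal0.
    by apply: lead_ideal_ideal; apply: ideal_gen_ideal.
  have [|s sL ts] := IH; first by move=> z tz; apply: tL; rewrite /= inE tz orbT.
  have [p [Lp sp pc]] := tL c (mem_head _ _).
  exists (p :: s).
    by move=> z /=; rewrite inE => /orP[/eqP ->//|sz]; apply: sL.
  have hs := ideal_gen_ideal [set` s].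
  rewrite !ideal_gen_cons; apply: addgen_le.
  - by apply: lead_ideal_ideal; apply: addgen_ideal.
  - by apply: subset_trans ts _; apply: lead_idealS; apply: addgen_sub.
  - by exists p; split=> //; apply: addgen_gen.
have [s sL ls] : exists2 s : seq {poly R}, [set` s] `<=` L &
    forall n, (n <= n0)%N -> lead_ideal L n `<=` lead_ideal (ideal_gen [set` s]) n.
  elim: (n0) => [|k [s sL ls]].
    by have [s sL ls] := lead_fg 0%N; exists s => // n; rewrite leqn0 => /eqP ->.
  have [t tL lt] := lead_fg k.+1; exists (s ++ t).
    by move=> z /=; rewrite mem_cat => /orP[/sL|/tL].
  move=> n; rewrite leq_eqVlt ltnS => /orP[/eqP ->|/ls].
    apply: subset_trans lt _; apply: lead_idealS; apply: ideal_genS => z /= tz.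
    by apply: ideal_gen_in; rewrite /= mem_cat tz orbT.
  move=> ls'; apply: subset_trans ls' _.
  apply: lead_idealS; apply: ideal_genS => z /= tz.
  by apply: ideal_gen_in; rewrite /= mem_cat tz.
exists s; apply/seteqP; split; last exact: ideal_genP.
have hs := ideal_gen_ideal [set` s].
have {}ls n : lead_ideal L n `<=` lead_ideal (ideal_gen [set` s]) n.
  have [/ls//|/ltnW le0n] := leqP n n0.
  rewrite (max0 (lead_ideal L n)); last 2 first.
  - by exists n.
  - exact: lead_ideal_le.
  apply: subset_trans (lead_ideal_le _ le0n); last exact: ideal_gen_ideal.
  exact: ls.
have {}ls n (p : {poly R}) : (size p <= n)%N -> L p -> ideal_gen [set` s] p.
  elim: n p => [|n IH] p sp Lp.
    move: sp; rewrite leqn0 size_poly_eq0 => /eqP ->; exact: ideal0.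
  have [q [sq szq qn]] : lead_ideal (ideal_gen [set` s]) n p`_n.
    by apply: ls; exists p.
  apply: (@ideal_eqB _ _ _ q) => //; apply: IH; last first.
    apply: is_idealB => //; exact: ideal_genP sq.
  apply/leq_sizeP => j; rewrite leq_eqVlt coefB => /orP[/eqP <-|lt].
    by rewrite qn subrr.
  by rewrite !nth_default ?subrr //; [apply: leq_trans szq _|apply: leq_trans sp _].
by move=> p; apply: ls (leqnn _).
Qed.

End Hilbert.

Section ReesCover.
Variable A : comNzRingType.
Hypothesis noethA : noetherian A.

(** Adjoining the generators g of a one at a time, each new variable being sent to gX, exhibits the
    Rees algebra as an image of an iterated polynomial ring. Graded submodules will be pulled back
    to ideals of R. *)
Lemma rees_cover (a : set A) : is_ideal a ->
  exists (R : comNzRingType) (f : {rmorphism R -> {poly A}}),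
    noetherian R /\ range f = [set` @rees_pred A a].
Proof.
move=> ha; have [s sE] := noethA ha.
have sub_a : [set` s] `<=` a by rewrite sE => z sz; apply: ideal_gen_in.
have [R [f [noethR fC fs fa]]] : exists (R : comNzRingType)
    (f : {rmorphism R -> {poly A}}),
    [/\ noetherian R, forall c, range f c%:P, forall g, g \in s -> range f (g *: 'X)
      & range f `<=` [set` @rees_pred A a]].
  elim: s sub_a {sE} => [|g s IH] sa.
    exists A, (polyC : {rmorphism A -> {poly A}}); split=> //.
    move=> _ [c _ <-] /=; apply/asboolP => -[|n]; rewrite coefC //=.
    by case: (idealX_ideal a n.+1).
  have [|R [f [noethR fC fs fa]]] := IH.
    by move=> z zs; apply: sa; rewrite /= inE zs orbT.
  have comf : commr_rmorph f (g *: 'X) by move=> x; apply: mulrC.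
  exists {poly R}, (horner_morph comf); split.
  - exact: hilbert_basis.
  - by move=> c; have [r _ <-] := fC c; exists r%:P => //; rewrite /= horner_morphC.
  - move=> h; rewrite inE => /orP[/eqP ->|/fs[r _ <-]].
      by exists 'X => //; rewrite /= horner_morphX.
    by exists r%:P => //; rewrite /= horner_morphC.
  - move=> _ [p _ <-] /=; elim/poly_ind: p => [|p c IHp].
      by rewrite rmorph0 rpred0.
    rewrite rmorphD rmorphM /= horner_morphX horner_morphC rpredD //; last first.
      by apply: fa; exists c.
    rewrite rpredM //; apply/asboolP => -[//|[|n]]; rewrite coefZ coefX.
      by rewrite idealX1 // eqxx mulr1; apply: sa; apply: mem_head.
    by rewrite mulr0; case: (idealX_ideal a n.+2).
exists R, f; split=> //; apply/seteqP; split=> //.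
have fD p q : range f p -> range f q -> range f (p + q).
  by move=> [u _ <-] [v _ <-]; exists (u + v) => //; rewrite rmorphD.
have fM p q : range f p -> range f q -> range f (p * q).
  by move=> [u _ <-] [v _ <-]; exists (u * v) => //; rewrite rmorphM.
have f1 b : a b -> range f (b *: 'X).
  rewrite sE; apply: (ideal_genP (I := [set b | range f (b *: 'X)])).
    split=> /=.
    - by rewrite scale0r; exists 0 => //; rewrite rmorph0.
    - by move=> x y fx fy; rewrite scalerDl; apply: fD.
    - by move=> c x fx; rewrite -scalerA -mul_polyC; apply: fM.
  by move=> z /= /fs.
have fn n b : idealX a n b -> range f (b *: 'X^n).
  elim: n b => [|n IH] b /=.
    by move=> _; rewrite expr0 alg_polyC; apply: fC.
  apply: (idealM_sub (K := [set b | range f (b *: 'X^(n.+1))])).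
    split=> /=.
    - by rewrite scale0r; exists 0 => //; rewrite rmorph0.
    - by move=> x y fx fy; rewrite scalerDl; apply: fD.
    - by move=> c x fx; rewrite -scalerA -mul_polyC; apply: fM.
  move=> x y ax any /=.
  have -> : (x * y) *: 'X^(n.+1) = (x *: 'X) * (y *: 'X^n) :> {poly A}.
    by rewrite -scalerAl -scalerAr scalerA -exprS.
  by apply: fM; [apply: f1|apply: IH].
move=> p /= /asboolP hp; rewrite -[p]coefK poly_def.
elim/big_rec: _ => [|i q _ hq]; first by exists 0 => //; rewrite rmorph0.
by apply: fD => //; apply: fn.
Qed.

End ReesCover.

(** * Graded families of ideals *)

Section Span.
Variable A : comNzRingType.
Implicit Types (I J K Q : set A) (B : nat -> set A) (l : seq (nat * A)).

(* I^j in degree q j, shifted by k; zero outside degrees k + q N. *)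
Definition shiftX (q : nat) I (n k : nat) : set A :=
  if (k <= n)%N && (q %| n - k)%N then idealX I ((n - k) %/ q)%N else [set 0].

(** Degree n part of B plus the span of the elements z, placed in degree k for (k, z) in l, over the
    Rees algebra of I graded in multiples of q. The recursion gives each entry its coefficient in
    turn, which later allows triangular arguments on coordinates. *)
Fixpoint gspan (q : nat) I B l (n : nat) : set A :=
  if l is (k, z) :: l' then
    [set w | exists2 g, shiftX q I n k g & gspan q I B l' n (w - g * z)]
  else B n.

Section Props.
Variables (q : nat) (I : set A) (B : nat -> set A).
Hypothesis (q0 : (0 < q)%N) (hB : forall n, is_ideal (B n)).

Lemma shiftX_ideal n k : is_ideal (shiftX q I n k).
Proof. by rewrite /shiftX; case: ifP => _; [apply: idealX_ideal|apply: is_ideal_zero]. Qed.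

Lemma shiftX1 n : shiftX q I n n 1.
Proof. by rewrite /shiftX leqnn subnn dvdn0 /= div0n. Qed.

Lemma shiftX_mul n k e g h : idealX I e g -> shiftX q I n k h ->
  shiftX q I (n + q * e) k (g * h).
Proof.
rewrite /shiftX => Ig; case: ifP => [/andP[kn qn] Ih|_ ->]; last first.
  by rewrite mulr0; case: ifP => _; apply: ideal0; [apply: idealX_ideal|apply: is_ideal_zero].
rewrite (leq_trans kn (leq_addr _ _)) -addnBAC //=.
rewrite dvdn_addl // ?dvdn_mulr //= qn.
by rewrite divnDr ?dvdn_mulr // mulKn // addnC; apply: idealX_mul.
Qed.

Lemma gspan_ideal l n : is_ideal (gspan q I B l n).
Proof.
elim: l => [|[k z] l IH] /=; first exact: hB.
have hs := shiftX_ideal n k; split.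
- exists 0; first exact: ideal0.
  by rewrite mul0r subrr; apply: ideal0.
- move=> x y [g hg Hg] [h hh Hh]; exists (g + h); first exact: ideal_add.
  have -> : x + y - (g + h) * z = (x - g * z) + (y - h * z) by ring.
  exact: ideal_add.
- move=> c x [g hg Hg]; exists (c * g); first exact: ideal_mull.
  have -> : c * x - c * g * z = c * (x - g * z) by ring.
  exact: ideal_mull.
Qed.

Lemma gspan_cons p l n : gspan q I B l n `<=` gspan q I B (p :: l) n.
Proof.
case: p => k z w Hw; exists 0; last by rewrite mul0r subr0.
by apply: ideal0; apply: shiftX_ideal.
Qed.

Lemma gspan_base l n : B n `<=` gspan q I B l n.
Proof.
by elim: l => [//|p l IH]; apply: subset_trans IH _; apply: gspan_cons.
Qed.

Lemma gspan_mulgen l n k z g : (k, z) \in l -> shiftX q I n k g ->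
  gspan q I B l n (g * z).
Proof.
move=> + hg; elim: l => [//|[k' z'] l IH]; rewrite inE => /orP[|/IH].
  case/eqP => <- <-; exists g => //; rewrite subrr; apply: ideal0.
  exact: gspan_ideal.
exact: gspan_cons.
Qed.

Lemma gspan_gen l k z : (k, z) \in l -> gspan q I B l k z.
Proof. by move=> kl; rewrite -[z]mul1r; apply: gspan_mulgen kl (shiftX1 k). Qed.

Lemma gspan_le l n K : is_ideal K -> B n `<=` K ->
  (forall k z g, (k, z) \in l -> shiftX q I n k g -> K (g * z)) ->
  gspan q I B l n `<=` K.
Proof.
move=> hK BK; elim: l => [_ //|[k z] l IH] H w /= [g hg Hw].
apply: (@ideal_eqB _ _ _ (g * z)) => //.
  by apply: IH Hw => k' z' g' kl; apply: H; rewrite inE kl orbT.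
by apply: H hg; rewrite mem_head.
Qed.

Lemma gspan_mul l n e g w : (forall n x y, I x -> B n y -> B (n + q)%N (x * y)) ->
  idealX I e g -> gspan q I B l n w -> gspan q I B l (n + q * e) (g * w).
Proof.
move=> BM Ig; suff H : gspan q I B l n `<=` [set w | gspan q I B l (n + q * e) (w * g)].
  by move/H; rewrite /= mulrC.
have hS := gspan_ideal l (n + q * e).
apply: gspan_le; first exact: colon_ideal.
  move=> y By; apply: gspan_base; rewrite mulrC.
  elim: e g Ig {hS} => [|e IH] g.
    by move=> _; rewrite muln0 addn0; apply: ideal_mull.
  move=> Ig; move: g Ig.
  apply: (idealM_sub (K := [set g | B (n + q * e.+1)%N (g * y)])).
    exact: colon_ideal.
  move=> u v Iu /IH /(BM _ _ _ Iu) /=.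
  by rewrite mulrA mulnS [(q + _)%N]addnC addnA.
move=> k z h kl hh /=; rewrite mulrAC [h * g]mulrC.
by apply: gspan_mulgen kl _; apply: shiftX_mul.
Qed.

End Props.
End Span.

(** * Graded submodules of Rees algebras and the Artin-Rees property *)

Section GradedFamilies.
Variables (A : comNzRingType) (a : set A).
Hypotheses (noethA : noetherian A) (ha : is_ideal a).
Implicit Types (Q : set A) (L : nat -> set A).

(** For an ideal Q, the quotients of the [L n] by Q are the components of a graded submodule of the
    Rees algebra of the image of a in A/Q. *)
Definition graded_family Q L : Prop :=
  [/\ forall n, is_ideal (L n), forall n, Q `<=` L n,
      forall n, L n `<=` idealD (idealX a n) Q
    & forall n x y, a x -> L n y -> L n.+1 (x * y)].

Lemma graded_family_mul Q L e n x y : graded_family Q L ->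
  idealX a e x -> L n y -> L (e + n)%N (x * y).
Proof.
move=> [hL _ _ LM]; elim: e x => [|e IH] x.
  by move=> _; apply: ideal_mull; apply: hL.
move=> ax Ly; move: x ax.
apply: (idealM_sub (K := [set x | L (e.+1 + n)%N (x * y)])).
  by apply: colon_ideal; apply: hL.
by move=> u v au /IH /(_ Ly) /(LM _ _ _ au) /=; rewrite mulrA.
Qed.

(** A family is turned into the ideal of those elements of the covering ring R whose image has its
    n-th coefficient in [L n] for every n, and R is Noetherian. *)
Lemma graded_family_max Q (C : set (nat -> set A)) : is_ideal Q ->
  C `<=` graded_family Q -> C !=set0 ->
  exists2 L, C L & forall L', C L' -> (forall n, L n `<=` L' n) ->
    forall n, L' n `<=` L n.
Proof.
move=> hQ CQ [L0 CL0].
have [R [f [noethR rf]]] := rees_cover noethA ha.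
have fa r n : idealX a n (f r)`_n.
  have : range f (f r) by exists r.
  by rewrite rf /= => /asboolP.
pose idl L := [set r | forall n, L n (f r)`_n].
have [||_ [L CL <-] Lmax] := @noeth_max _ noethR (idl @` C).
- move=> _ [L /CQ FL <-]; have [hL _ _ _] := FL; split.
  + by move=> n; rewrite rmorph0 coef0; apply: ideal0.
  + by move=> x y Lx Ly n; rewrite rmorphD coefD; apply: ideal_add.
  + move=> c x Lx n; rewrite rmorphM coefM; apply: is_ideal_sum => // i _.
    rewrite -{1}(subnKC (leq_ord i)).
    exact: (graded_family_mul FL (fa _ _) (Lx _)).
- by exists (idl L0); exists L0.
exists L => // L' CL' LL' n b L'b.
have [hL QL _ _] := CQ _ CL; have [hL' QL' L'Q _] := CQ _ CL'.
(* Modulo Q, which lies in both families, b may be replaced by g in a^n; the monomial g X^n lifts to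
   R, where maximality applies. *)
have [g ag Qbg] := L'Q _ _ L'b.
have L'g : L' n g.
  by rewrite -(subKr b g); apply: is_idealB => //; apply: QL'.
have [r _ fr] : range f (g *: 'X^n).
  rewrite rf /=; apply/asboolP => k; rewrite coefZ coefXn.
  case: eqP => [->|_]; first by rewrite mulr1.
  by rewrite mulr0; apply: ideal0; apply: idealX_ideal.
have : idl L' r.
  move=> k; rewrite fr coefZ coefXn; case: eqP => [->|_]; first by rewrite mulr1.
  by rewrite mulr0; apply: ideal0.
rewrite (Lmax (idl L')) /=; last 2 first.
- by exists L'.
- by move=> s Ls k; apply: LL'.
move=> /(_ n); rewrite fr coefZ coefXn eqxx mulr1 => Lg.
by rewrite -(subrK g b); apply: ideal_add => //; apply: QL.
Qed.

Lemma idealX1_shiftX n k g : (k <= n)%N -> shiftX 1 a n k g = idealX a (n - k) g.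
Proof. by move=> kn; rewrite /shiftX kn dvd1n divn1. Qed.

Lemma shiftX_family Q L n k g z : graded_family Q L ->
  shiftX 1 a n k g -> L k z -> L n (g * z).
Proof.
move=> FL; rewrite /shiftX; case: ifP => [/andP[kn _]|_ ->].
  by rewrite divn1 => ag Lz; rewrite -(subnK kn); apply: graded_family_mul FL ag Lz.
by rewrite mul0r => _; have [hL _ _ _] := FL; apply: ideal0.
Qed.

Lemma gspan_graded_family Q L B (l : seq (nat * A)) : graded_family Q L ->
  (forall n, is_ideal (B n)) -> (forall n, Q `<=` B n) ->
  (forall n, B n `<=` L n) ->
  (forall n x y, a x -> B n y -> B n.+1 (x * y)) ->
  (forall k z, (k, z) \in l -> L k z) -> graded_family Q (gspan 1 a B l).
Proof.
move=> FL hB QB BL BM lL; have [hL QL LQ LM] := FL; split.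
- by move=> n; apply: gspan_ideal.
- by move=> n; apply: subset_trans (QB n) _; apply: gspan_base.
- move=> n; apply: subset_trans (LQ n); apply: gspan_le => //.
  by move=> k z g /lL Lz ag; apply: shiftX_family FL ag Lz.
- move=> n x y ax Sy; have := @gspan_mul _ 1 a B _ hB l n 1 x y.
  rewrite muln1 addn1; apply=> //; last by rewrite idealX1.
  by move=> k u v; rewrite addn1; apply: BM.
Qed.

(** Artin-Rees: a maximal finitely generated subfamily is all of L, and above the largest degree of
    a generator every coefficient lies in a positive power of a, so that a factor from a splits
    off. *)
Lemma graded_family_stable Q L : is_ideal Q -> graded_family Q L ->
  exists n0, forall n, (n0 <= n)%N -> L n.+1 `<=` idealD (idealM a (L n)) Q.
Proof.
move=> hQ FL; have [hL QL LQ LM] := FL.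
pose S l := gspan 1 a (fun _ => Q) l.
have hS l n : is_ideal (S l n) by apply: gspan_ideal.
have [||_ [l lL <-] lmax] := @graded_family_max Q
    (S @` [set l : seq (nat * A) | forall k z, (k, z) \in l -> L k z]) hQ.
- move=> _ [l lL <-]; apply: gspan_graded_family FL _ _ _ _ lL => //.
  + by move=> n; apply: subset_refl.
  + by move=> n x y _; apply: ideal_mull.
- by exists (S [::]); exists [::].
have SL n : S l n `<=` L n.
  apply: gspan_le => // k z g /lL Lz ag; exact: shiftX_family FL ag Lz.
have LS n : L n `<=` S l n.
  move=> z Lz; apply: (lmax (S ((n, z) :: l))); last first.
  - by apply: gspan_gen => //; apply: mem_head.
  - by move=> k; apply: gspan_cons.
  - exists ((n, z) :: l) => // k y; rewrite inE => /orP[|/lL//].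
    by case/eqP => -> ->.
exists (\max_(p <- l) p.1)%N => n ln.
apply: subset_trans (LS _) _; apply: gspan_le.
- by apply: idealD_ideal => //; apply: idealM_ideal.
- by apply: idealD_subr; apply: idealM_ideal.
move=> k z g kl; have kn : (k <= n)%N.
  by apply: leq_trans ln; apply: (@leq_bigmax_seq _ _ _ (fun p => p.1) (k, z)).
rewrite idealX1_shiftX ?(leq_trans kn) // subSn // => ag.
apply: idealD_subl => //; apply: idealM_mul_le ag; first exact: idealM_ideal.
move=> u v au av; rewrite -mulrA; apply: idealM_mul => //.
rewrite -(subnK kn); apply: graded_family_mul FL av _; exact: lL.
Qed.

End GradedFamilies.

(** * Integral dependence from asymptotic containment *)

Section AsymptoticIntegral.
Variables (A : comNzRingType) (a : set A).
Hypotheses (noethA : noetherian A) (ha : is_ideal a).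

Let comb (I : set A) b J K : set A := [set w | exists2 c : nat -> A,
  (forall i, (i <= J)%N -> idealX I (K - i) (c i)) & w = \sum_(i < J.+1) c i * b ^+ i].

Let comb_ideal I b J K : is_ideal (comb I b J K).
Proof.
split.
- exists (fun=> 0); first by move=> i _; apply: ideal0; apply: idealX_ideal.
  by rewrite big1 // => i _; rewrite mul0r.
- move=> _ _ [c hc ->] [d hd ->]; exists (fun i => c i + d i).
    by move=> i iJ; apply: ideal_add; [apply: idealX_ideal|apply: hc|apply: hd].
  by rewrite -big_split; apply: eq_bigr => i _; rewrite mulrDl.
- move=> e _ [c hc ->]; exists (fun i => e * c i).
    by move=> i iJ; apply: ideal_mull; [apply: idealX_ideal|apply: hc].
  by rewrite mulr_sumr; apply: eq_bigr => i _; rewrite mulrA.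
Qed.

(* The ideals (I + bA)^J, I = a^n, form a family in a shift of the Rees algebra
   of I, hence (I + bA)^(J+1) = I (I + bA)^J for some J. *)
Lemma int_closure_asymp b n C : (0 < n)%N ->
  (forall j, idealX a (n * j - C) (b ^+ j)) -> int_closure (idealX a n) b.
Proof.
move=> n0 hb; set I := idealX a n.
have hI : is_ideal I by apply: idealX_ideal.
have combS J : idealM I (comb I b J J) `<=` comb I b J J.+1.
  apply: idealM_sub => // e _ Ie [c hc ->]; exists (fun i => e * c i).
    by move=> i iJ; rewrite subSn //; apply: idealM_mul => //; apply: hc.
  by rewrite mulr_sumr; apply: eq_bigr => i _; rewrite mulrA.
(* The shift by C makes the family fit: I^(J + C - i) b^i lies in a^(n(J + C) - C), and nC >= C puts
   this inside a^(nJ) = I^J. *)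
have FL : graded_family I [set 0] (fun J => comb I b (J + C) (J + C)).
  split=> // [J _ ->|J w [c hc ->]|J x _ Ix [c hc ->]].
  - exact: ideal0.
  - apply: idealD_subl; first exact: is_ideal_zero.
    apply: is_ideal_sum => [|i _]; first exact: idealX_ideal.
    have := idealX_mul (_ : idealX a (n * (J + C - i)) (c i)) (hb i).
    rewrite -/I idealXM => H; move: (H (hc _ (leq_ord i))).
    rewrite -idealXM; apply: idealX_le; rewrite mulnBr.
    have iJ := leq_ord i.
    have : (n * i <= n * (J + C))%N by rewrite leq_mul2l iJ orbT.
    rewrite !mulnDr; nia.
  - have [d hd ->] : comb I b (J + C) (J + C).+1 (x * \sum_(i < (J + C).+1) c i * b ^+ i).
      by apply: combS; apply: idealM_mul => //; exists c.
    exists (fun i => if (i <= J + C)%N then d i else 0).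
      move=> i; rewrite addSn; case: ifP => [/hd //|_ _].
      by apply: ideal0; apply: idealX_ideal.
    rewrite [RHS]big_ord_recr /= addSn ltnn mul0r addr0.
    by apply: eq_bigr => i _; rewrite leq_ord.
have [J /(_ _ (leqnn _)) HJ] := graded_family_stable noethA hI (@is_ideal_zero A) FL.
(* The power b^(J + C + 1) belongs to the family in degree J + 1, hence to I (I + bA)^(J + C): an
   equation of integral dependence. *)
have /HJ : comb I b (J.+1 + C) (J.+1 + C) (b ^+ (J + C).+1).
  exists (fun i => (i == (J + C).+1)%:R).
    move=> i; case: eqP => [->|_ _]; last by apply: ideal0; apply: idealX_ideal.
    by rewrite addSn subnn.
  rewrite addSn (bigD1 ord_max) //= eqxx mul1r big1 ?addr0 // => i.
  by rewrite -val_eqE /= => /negbTE ->; rewrite mul0r.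
move=> [f /combS [c hc ->] /= /eqP]; rewrite subr_eq0 => /eqP eq_b.
exists (J + C).+1, (fun i => - c ((J + C).+1 - i)%N); split=> //.
  move=> i /andP[i1 iJ]; apply: is_idealN; first exact: idealX_ideal.
  by rewrite -[i in idealX _ i](subKn iJ); apply: hc; lia.
rewrite eq_b big_add1 /= big_mkord (reindex_inj rev_ord_inj) -big_split /=.
by rewrite big1 // => i _; rewrite mulNr subrr.
Qed.

End AsymptoticIntegral.

(** * Prime avoidance in the Rees algebra *)

Section PowerContainment.
Variable A : comNzRingType.
Hypothesis noethA : noetherian A.
Implicit Types (I J K Q : set A) (x y z : A).

(** Each term in the expansion of a product of n + r elements of K + gA has n factors from K or r
    factors from gA. *)
Lemma idealX_addgen K g k n r : is_ideal K -> k = (n + r)%N ->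
  idealX (addgen K g) k `<=` addgen (idealX K n) (g ^+ r).
Proof.
move=> hK; elim: k n r => [|k IH] n r.
  by case: n => // _; apply: addgen_sub.
have hX i := idealX_ideal K i.
case: n => [|n]; first by move=> _; apply: subset_trans (addgen_sub _ _).
case: r => [|r].
  move=> _ w _; exists w; rewrite expr0 mulr1 subrr; apply: ideal0.
  exact: (hX n.+1).
rewrite addnS => -[knr]; have hT : is_ideal (addgen (idealX K n.+1) (g ^+ r.+1)).
  exact: addgen_ideal.
apply: idealM_sub => // v w [c Kv] Hw.
have [d Hd] : addgen (idealX K n) (g ^+ r.+1) w by apply: IH Hw; lia.
have [e He] : addgen (idealX K n.+1) (g ^+ r) w by apply: IH Hw; lia.
have -> : v * w = ((v - c * g) * (w - d * g ^+ r.+1) + (c * g) * (w - e * g ^+ r))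
    + (d * (v - c * g) + c * e) * g ^+ r.+1 by rewrite exprS; ring.
apply: ideal_add => //; last exact: addgen_mul.
apply: ideal_add => //; apply: addgen_sub => //; first exact: idealM_mul.
exact: (ideal_mull _ (hX n.+1)).
Qed.

Lemma idealX_radical I Q : is_ideal I -> is_ideal Q ->
  (forall x, I x -> exists n, Q (x ^+ n)) -> exists N, idealX I N `<=` Q.
Proof.
move=> hI hQ IQ.
have [||K [hK KI [N KN]] maxK] := @noeth_max _ noethA
    [set K | [/\ is_ideal K, K `<=` I & exists N, idealX K N `<=` Q]].
- by move=> K [].
- exists [set 0]; split; first exact: is_ideal_zero.
    by move=> _ ->; apply: ideal0.
  exists 1%N; rewrite idealX1; last exact: is_ideal_zero.
  by move=> _ ->; apply: ideal0.
exists N; suff -> : I = K by [].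
apply/seteqP; split=> // g Ig.
rewrite -(maxK (addgen K g)); first exact: addgen_gen.
  split; [exact: addgen_ideal|exact: addgen_le|].
  have [r Qr] := IQ _ Ig; exists (N + r)%N.
  apply: (subset_trans (idealX_addgen hK (erefl _))); exact: addgen_le.
exact: addgen_sub.
Qed.

End PowerContainment.

Section HomogeneousPrimes.
Variables (A : comNzRingType) (a : set A).
Implicit Types (P : nat -> set A) (l : seq (nat -> set A)).

(* homogeneous primes of the Rees algebra of a not containing a in degree 1 *)
Definition hprime P : Prop :=
  [/\ (forall e, is_ideal (P e)) /\ (forall e, P e `<=` idealX a e),
      forall e e' r r', P e r -> idealX a e' r' -> P (e + e')%N (r * r'),
      forall e e' r r', idealX a e r -> idealX a e' r' -> P (e + e')%N (r * r') ->
        P e r \/ P e' r'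
    & exists2 r, a r & ~ P 1%N r].

Definition sub_family P P' : Prop := forall e, P e `<=` P' e.

Lemma hprime_expr P e r n : hprime P -> idealX a e r -> P (e * n.+1)%N (r ^+ n.+1) -> P e r.
Proof.
move=> [_ _ Ppr _] ar; elim: n => [|n IH]; first by rewrite muln1.
rewrite exprS mulnS => /Ppr[] // ; exact: idealX_exprM.
Qed.

Lemma hprime_exprm P e r n : hprime P -> idealX a e r -> P e r -> P (e * n.+1)%N (r ^+ n.+1).
Proof.
move=> [_ PM _ _] ar Pr; rewrite exprS mulnS; apply: PM => //.
exact: idealX_exprM.
Qed.

(** A product of elements outside P, one from each prime not below P, stays outside P. It starts
    from an element of a outside P, which makes the degree e positive. *)
Lemma hprime_separate P l : is_ideal a -> hprime P ->
  (forall P', List.In P' l -> hprime P') ->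
  exists e w, [/\ (0 < e)%N, idealX a e w, ~ P e w &
    forall P', List.In P' l -> ~ sub_family P' P -> P' e w].
Proof.
move=> ha hP; have [_ _ Ppr [r ar Pr]] := hP.
elim: l => [|P' l IH] hl.
  by exists 1%N, r; split=> //; rewrite idealX1.
have [|e [w [e0 aw Pw lw]]] := IH; first by move=> P'' lP; apply: hl; right.
have [[_ P'a] P'M _ _] := hl P' (or_introl (erefl _)).
have [P'P|P'P] := pselect (sub_family P' P).
  by exists e, w; split=> // P'' [<-|]; [|apply: lw].
have [e' [u P'u Pu]] : exists e', exists2 u, P' e' u & ~ P e' u.
  apply: contrapT => H; apply: P'P => e' u P'u; apply: contrapT => Pu.
  by apply: H; exists e', u.
exists (e' + e)%N, (u * w); split.
- by rewrite addn_gt0 e0 orbT.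
- by apply: idealX_mul => //; apply: P'a.
- by move=> /Ppr[] //; apply: P'a.
- move=> P'' [<- _|lP nP]; first exact: P'M.
  have [_ P''M _ _] := hl P'' (or_intror lP).
  by rewrite addnC mulrC; apply: P''M; [apply: lw|apply: P'a].
Qed.

(** Graded prime avoidance. If x lies in the new prime P, it is replaced by x^e + w^s, with w
    outside P but in every listed prime not contained in P; the exponents equalise the degrees. A
    listed prime contained in P misses this element because P does. *)
Lemma hprime_avoid l : is_ideal a -> (forall P, List.In P l -> hprime P) ->
  exists s x, [/\ (0 < s)%N, idealX a s x & forall P, List.In P l -> ~ P s x].
Proof.
move=> ha; elim: l => [|P l IH] hl.
  exists 1%N, 0; split=> //; apply: ideal0; exact: (idealX_ideal a 1).
have [|s [x [s0 ax lx]]] := IH; first by move=> P' lP; apply: hl; right.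
have hP := hl P (or_introl (erefl _)).
have [Px|Px] := pselect (P s x); last first.
  by exists s, x; split=> // P' [<-|]; [|apply: lx].
have [|e [w [e0 aw Pw lw]]] := hprime_separate (l := l) ha hP.
  by move=> P' lP; apply: hl; right.
have aX : idealX a (s * e) (w ^+ s) by rewrite mulnC; apply: idealX_exprM.
have Pn : ~ P (s * e)%N (x ^+ e + w ^+ s).
  case: (hP) => -[Pi _] _ _ _ H; apply: Pw.
  move: aX; rewrite -(prednK s0) mulnC => aX.
  apply: (hprime_expr hP aw (n := s.-1)); rewrite prednK // mulnC.
  rewrite -[w ^+ s](addKr (x ^+ e)) addrC; apply: is_idealB => //.
  rewrite -(prednK e0); apply: hprime_exprm => //.
exists (s * e)%N, (x ^+ e + w ^+ s); split.
- by rewrite muln_gt0 s0.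
- by apply: ideal_add => //; [apply: idealX_ideal|apply: idealX_exprM].
- move=> P' [<- //|lP H].
  have [P'P|P'P] := pselect (sub_family P' P); first by apply: Pn; apply: P'P.
  have hP' := hl P' (or_intror lP).
  have := lw _ lP P'P => P'w.
  apply: (lx _ lP); apply: (hprime_expr hP' ax (n := e.-1)); rewrite prednK //.
  case: (hP') => -[P'i _] _ _ _; rewrite -[x ^+ e](addrK (w ^+ s)).
  apply: is_idealB => //; rewrite mulnC -(prednK s0); exact: hprime_exprm.
Qed.

End HomogeneousPrimes.

(** * Superficial elements *)

Section Superficial.
Variables (A : comNzRingType) (m a : set A) (F : nat -> set A) (c q : nat).
Hypotheses (noethA : noetherian A) (locA : is_local m) (ha : is_ideal a)
  (am : a `<=` m) (maq : idealX m q `<=` a)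
  (hF : forall n, is_ideal (F n)) (Fdec : forall n, F n.+1 `<=` F n)
  (FM : forall n x y, a x -> F n y -> F n.+1 (x * y))
  (aF : forall n, idealX a n `<=` F n) (Fa : forall n, F (n + c) `<=` idealX a n).
Implicit Types (Q : set A).

Definition nzd Q x : Prop := forall z, Q (x * z) -> Q z.
(** No nonzero element of A/Q is killed by m; for a proper ideal Q this says that A/Q has positive
    depth. *)
Definition socle_free Q : Prop := forall z, (forall r, m r -> Q (r * z)) -> Q z.

Let Fle n p : (n <= p)%N -> F p `<=` F n.
Proof. exact: decreasing_sub. Qed.

Let N Q n := idealD (F n) Q.

Let hN Q n : is_ideal Q -> is_ideal (N Q n).
Proof. by move=> hQ; apply: idealD_ideal. Qed.

Let Nle Q n p : (n <= p)%N -> N Q p `<=` N Q n.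
Proof. by move=> np; apply: idealDS => //; apply: Fle. Qed.

Let N_family Q n1 : is_ideal Q -> (c <= n1)%N ->
  graded_family a Q (fun n => N Q (n + n1)).
Proof.
move=> hQ c1; split.
- by move=> n; apply: hN.
- by move=> n; apply: idealD_subr.
- move=> n; apply: idealDS => // w Fw; apply: Fa; apply: Fle Fw; lia.
- move=> n x y ax [f Ff Qf]; exists (x * f); first exact: FM.
  by rewrite -mulrBr; apply: ideal_mull.
Qed.

(** The elements whose classes are killed by a form a graded family L. In high degrees its members
    are, modulo Q, sums of products r y with r in a and y in L, and these lie one step deeper in the
    filtration. *)
Lemma eventually_no_torsion Q : is_ideal Q ->
  exists2 n1, (c <= n1)%N & forall n, (n1 <= n)%N -> forall z, N Q n z ->
    (forall r, a r -> N Q n.+2 (r * z)) -> N Q n.+1 z.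
Proof.
move=> hQ; have [FI FQ FS FMM] := N_family hQ (leqnn c).
pose L n := [set z | N Q (n + c) z /\ forall r, a r -> N Q (n + c).+2 (r * z)].
have FL : graded_family a Q L.
  split.
  - move=> n; split.
    + by split=> [|r _]; rewrite ?mulr0; apply: ideal0; apply: hN.
    + move=> x y [Nx Hx] [Ny Hy]; split=> [|r ar]; first by apply: ideal_add => //; apply: hN.
      by rewrite mulrDr; apply: ideal_add; [apply: hN|apply: Hx|apply: Hy].
    + move=> d x [Nx Hx]; split=> [|r ar]; first by apply: ideal_mull => //; apply: hN.
      by rewrite mulrCA; apply: ideal_mull; [apply: hN|apply: Hx].
  - move=> n z Qz; split=> [|r _]; first exact: FQ.
    by apply: idealD_subr => //; apply: ideal_mull.
  - by move=> n z [Nz _]; apply: FS.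
  - move=> n r z ar [Nz Hz]; split=> [|r' ar']; first exact: FMM.
    have := Hz _ ar => -[f Ff Qf]; exists (r' * f); first exact: FM.
    by rewrite -mulrBr; apply: ideal_mull.
have [n0 Hn0] := graded_family_stable noethA ha hQ FL.
exists (n0 + c).+1; first lia.
move=> n n0n z Nz Hz; have nE : n = ((n - c).-1.+1 + c)%N by lia.
have kn : (n0 <= (n - c).-1)%N by lia.
have [f af Qf] : idealD (idealM a (L (n - c).-1)) Q z.
  by apply: Hn0 => //; split; rewrite -nE.
rewrite -(subrK f z) addrC; apply: ideal_add; first exact: hN; last first.
  exact: idealD_subr.
move: af; apply: idealM_sub; first exact: hN.
by move=> r y ar [_ /(_ _ ar)]; have -> : n.+1 = ((n - c).-1 + c).+2 by lia.
Qed.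

(* The primes are the maximal annihilators of homogeneous elements of
   \bigoplus_(n >= n1) N_n / N_(n+1); these are finitely many because that module
   is Noetherian. *)
Lemma associated_hprimes Q : is_ideal Q ->
  exists n1 (l : seq (nat -> set A)), (forall P, List.In P l -> hprime a P) /\
    forall s x, idealX a s x -> (forall P, List.In P l -> ~ P s x) ->
      forall n z, (n1 <= n)%N -> N Q n z -> N Q (n + s).+1 (x * z) -> N Q n.+1 z.
Proof.
move=> hQ; have [n1 c1 notors] := eventually_no_torsion hQ.
pose M n := N Q (n + n1).
have FM' : graded_family a Q M by apply: N_family.
have [hM QM _ _] := FM'.
(* The annihilator of the class of z in the associated graded module of A/Q, for w = (n, z); degrees
   are shifted by n1. *)
pose Ann (w : nat * A) (e : nat) : set A :=
  [set r | idealX a e r /\ M (w.1 + e).+1 (r * w.2)].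
have Mmul e n x y : idealX a e x -> M n y -> M (n + e)%N (x * y).
  by rewrite addnC; apply: graded_family_mul FM'.
have FAnn w : graded_family a [set 0] (Ann w).
  have hA e : is_ideal (Ann w e).
    split.
    - split; first by apply: ideal0; apply: idealX_ideal.
      by rewrite mul0r; apply: ideal0.
    - move=> x y [ax Mx] [ay My]; split.
        by apply: ideal_add => //; apply: idealX_ideal.
      by rewrite mulrDl; apply: ideal_add.
    - move=> d x [ax Mx]; split; first by apply: ideal_mull => //; apply: idealX_ideal.
      by rewrite -mulrA; apply: ideal_mull.
  split=> // [e _ ->|e r [ar _]|e x y ax [ay My]].
  - exact: ideal0.
  - by apply: idealD_subl => //; apply: is_ideal_zero.
  - split; first exact: idealM_mul.
    by rewrite -mulrA addnS -[in M _]addn1 -addSn; apply: Mmul; rewrite ?idealX1.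
pose wit (w : nat * A) := M w.1 w.2 /\ ~ M w.1.+1 w.2.
pose mwit w := wit w /\ forall w', wit w' -> sub_family (Ann w) (Ann w') ->
  sub_family (Ann w') (Ann w).
have mwit_ex w : wit w -> exists2 w', mwit w' & sub_family (Ann w) (Ann w').
  move=> ww; have [||_ [w' [ww' ww2] <-] w'max] := graded_family_max noethA ha
    (@is_ideal_zero A) (C := Ann @` [set w' | wit w' /\ sub_family (Ann w) (Ann w')]).
  - by move=> _ [w' _ <-].
  - exists (Ann w); exists w => //; split=> //; move=> e; apply: subset_refl.
  exists w' => //; split=> // w2 hw2 w2w'; apply: w'max => //.
  by exists w2 => //; split=> // e; apply: subset_trans (ww2 e) (w2w' e).
have mwit_prime w : mwit w -> hprime a (Ann w).
  case: w => n z [[/= Mz nMz] wmax]; split.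
  - by split=> e; [case: (FAnn (n, z))|move=> r []].
  - move=> e e' r r' [ar Mr] ar'; split; first exact: idealX_mul.
    by rewrite /= [r * _]mulrC -mulrA addnA -addSn; apply: Mmul.
  - move=> e e' r r' ar ar' [arr' Mrr'].
    have [Pr|Pr] := pselect (Ann (n, z) e r); [by left|right].
    have wrz : wit ((n + e)%N, r * z).
      by split=> /=; [apply: Mmul|move=> H; apply: Pr].
    apply: (wmax _ wrz).
      move=> k t [at_ Mt]; split=> //=.
      by rewrite mulrCA addnAC -addSn; apply: Mmul.
    by split=> //=; rewrite mulrA [r' * r]mulrC -addnA.
  (* If all of a annihilated the class of z, the choice of n1 would make this class vanish. *)
  - apply: contrapT => H; apply: nMz.
    apply: (notors (n + n1)%N); [exact: leq_addl|exact: Mz|].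
    move=> r ar; apply: contrapT => nMr; apply: H; exists r => // -[_ /=].
    by rewrite addn1.
pose S l := gspan 1 a (fun n => M n.+1) l.
have FS l : (forall k z, (k, z) \in l -> mwit (k, z)) -> graded_family a Q (S l).
  move=> lw; apply: (gspan_graded_family (B := fun n => M n.+1) ha FM').
  - by move=> n; apply: hM.
  - by move=> n; apply: QM.
  - by move=> n; apply: Nle; lia.
  - by move=> n x y ax My; rewrite -addn1; apply: Mmul; rewrite ?idealX1.
  - by move=> k z /lw[[]].
have [||_ [l lw <-] lmax] := graded_family_max noethA ha hQ
    (C := S @` [set l : seq (nat * A) | forall k z, (k, z) \in l -> mwit (k, z)]).
- by move=> _ [l lw <-]; apply: FS.
- by exists (S [::]); exists [::].
exists n1, (map Ann l); split.
  move=> P /List.in_map_iff [[k z] [<- kl]]; apply: mwit_prime; apply: lw.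
  by elim: (l) kl => //= p l' IH [->|/IH]; rewrite inE ?eqxx // => ->; rewrite orbT.
move=> s x ax lx n z n1n Nz Nxz; apply: contrapT => nNz.
have nE : n = ((n - n1) + n1)%N by lia.
have wz : wit ((n - n1)%N, z).
  by rewrite /wit /M /= addSn -nE.
have [[n' z'] mw' zw'] := mwit_ex _ wz.
have {nNz} xw' : Ann (n', z') s x.
  apply: zw'; split=> //=; rewrite /M addSn addnAC -nE; exact: Nxz.
have hP := mwit_prime _ mw'.
have : S l n' z'.
  apply: (lmax (S ((n', z') :: l))); last first.
  - by apply: gspan_gen; [move=> k; apply: hM|apply: mem_head].
  - by move=> k; apply: gspan_cons.
  - exists ((n', z') :: l) => // k y; rewrite inE => /orP[|/lw//].
    by case/eqP => -> ->.
(* The prime of z' contains x, so by maximality no prime of a generator lies below it. Hence t,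
   chosen outside the prime of z', kills every generator of S but not z', although z' lies in S. *)
have [|e [t [e0 at_ Pt lt]]] := hprime_separate (l := map Ann l) ha hP.
  move=> P /List.in_map_iff [[k y] [<- kl]]; apply: mwit_prime; apply: lw.
  by elim: (l) kl => //= p l' IH [->|/IH]; rewrite inE ?eqxx // => ->; rewrite orbT.
have lIn k y : (k, y) \in l -> List.In (Ann (k, y)) (map Ann l).
  move=> kl; apply/List.in_map_iff; exists (k, y); split=> //.
  by elim: (l) kl => //= p l' IH; rewrite inE => /orP[/eqP ->|/IH]; [left|right].
move=> Sz'; apply: Pt; split=> //=.
rewrite mulrC; move: z' Sz' {mw' zw' xw' hP lt} (xw') (mw') (lt) => z' Sz' xw' mw' lt.
suff : S l n' `<=` [set y | M (n' + e).+1 (y * t)] by apply.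
apply: gspan_le; first exact: colon_ideal.
  by move=> y My /=; rewrite mulrC -addSn; apply: Mmul.
move=> k y g kl hg /=.
have [Ayw|Ayw] := pselect (sub_family (Ann (k, y)) (Ann (n', z'))).
  case: (lx _ (lIn _ _ kl)).
  have [_ kmax] := lw _ _ kl; apply: (kmax (n', z')) => //; exact: (proj1 mw').
have [_ /= Mty] := lt _ (lIn _ _ kl) Ayw.
move: hg; rewrite /shiftX; case: ifP => [/andP[kn' _]|_ ->]; last first.
  rewrite mul0r mul0r; exact: ideal0 (hM _).
rewrite divn1 => ag; rewrite mulrAC -mulrA.
have -> : (n' + e).+1 = ((k + e).+1 + (n' - k))%N by lia.
exact: Mmul.
Qed.

(** The intersection K gives a constant graded family, so the Artin-Rees property reads K <= aK + Q
    and Nakayama's lemma applies. *)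
Lemma krull_intersection Q z : is_ideal Q -> (forall n, N Q n z) -> Q z.
Proof.
move=> hQ Nz; pose K : set A := [set z | forall n, N Q n z].
have hK : is_ideal K.
  split=> [n|x y Kx Ky n|d x Kx n].
  - exact: ideal0 (hN _ hQ).
  - exact: ideal_add (hN _ hQ) (Kx n) (Ky n).
  - exact: ideal_mull (hN _ hQ) (Kx n).
have FK : graded_family a Q (fun=> K).
  split=> // [n x Qx k|n x Kx|n x y _ Kx]; last exact: ideal_mull hK Kx.
    exact: idealD_subr.
  exact: (idealDS (Fa (n := n)) (@subset_refl _ Q) (Kx (n + c)%N)).
have [n0 /(_ _ (leqnn _)) KaK] := graded_family_stable noethA ha hQ FK.
exact: (nakayama noethA locA hK hQ am KaK).
Qed.

Lemma socle_free_expr Q n z : socle_free Q -> is_ideal Q ->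
  (forall r, idealX m n r -> Q (r * z)) -> Q z.
Proof.
move=> sQ hQ; elim: n z => [|n IH] z H.
  by rewrite -[z]mul1r; apply: H.
apply: sQ => r mr; apply: IH => t mt; rewrite mulrA; apply: H.
by rewrite mulrC; apply: idealM_mul.
Qed.

(* An element avoiding the associated primes in high degrees is superficial; it
   is regular modulo Q because (Q : x) is then killed by a power of a modulo
   \bigcap_n (F_n + Q) = Q, and the exact colon formula follows from the
   Artin-Rees property of the family (Q + xA) :&: (F_n + Q). *)
Lemma superficial_of_avoid Q s x n1 : is_ideal Q -> socle_free Q -> (0 < s)%N ->
  idealX a s x ->
  (forall n z, (n1 <= n)%N -> N Q n z -> N Q (n + s).+1 (x * z) -> N Q n.+1 z) ->
  nzd Q x /\ exists n0, forall n z, (n0 <= n)%N -> N Q (n + s) (x * z) -> N Q n z.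
Proof.
move=> hQ sQ s0 ax Hx.
have reg : nzd Q x.
  (* A multiplier h in m^(q n1) lies in a^(n1), so h z has degree at least n1; as x h z is in Q, the
     one-step colon property raises this degree indefinitely. *)
  move=> z Qxz; apply: (socle_free_expr (n := (q * n1)%N) sQ hQ) => h.
  rewrite idealXM => /(idealXS maq) ah.
  have Qxhz : Q (x * (h * z)) by rewrite mulrCA; apply: ideal_mull.
  apply: krull_intersection => // n.
  suff H k : N Q (n1 + k) (h * z).
    by apply: (Nle (p := (n1 + n)%N)) (H n); apply: leq_addl.
  elim: k => [|k IH].
    rewrite addn0; apply: idealD_subl => //; exact: (ideal_mulr z (hF n1) (aF ah)).
  rewrite addnS; apply: Hx => //; first exact: leq_addr.
  exact: idealD_subr.
split=> //; pose L n := N Q (n + c) `&` addgen Q x.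
have hT := addgen_ideal x hQ.
have [FI FQ FS FMM] := N_family hQ (leqnn c).
have FL : graded_family a Q L.
  split=> [n|n z Qz|n z [Nz _]|n r z ar [Nz Tz]].
  - split=> [|u v [Nu Tu] [Nv Tv]|d u [Nu Tu]].
    + by split; [exact: ideal0 (hN _ hQ)|exact: ideal0].
    + by split; [exact: ideal_add (hN _ hQ) Nu Nv|exact: ideal_add].
    + by split; [exact: ideal_mull (hN _ hQ) Nu|exact: ideal_mull].
  - by split; [exact: FQ|apply: addgen_sub].
  - exact: FS.
  - by split; [exact: FMM|exact: ideal_mull].
have [n2 Hn2] := graded_family_stable noethA ha hQ FL.
(* Elements of Q + xA deep in the filtration are u x modulo Q with u in a^j. This gives z the
   initial degree n1, from which the one-step colon property climbs to n. *)
have LB j : L (n2 + j)%N `<=` [set w | exists2 u, idealX a j u & Q (w - u * x)].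
  have hB i : is_ideal [set w | exists2 u, idealX a i u & Q (w - u * x)].
    have hai := idealX_ideal a i; split=> /=.
    - exists 0; first exact: ideal0.
      by rewrite mul0r subrr; apply: ideal0.
    - move=> w w' [u au Qu] [u' au' Qu']; exists (u + u'); first exact: ideal_add.
      have -> : w + w' - (u + u') * x = (w - u * x) + (w' - u' * x) by ring.
      exact: ideal_add.
    - move=> d w [u au Qu]; exists (d * u); first exact: ideal_mull.
      have -> : d * w - d * u * x = d * (w - u * x) by ring.
      exact: ideal_mull.
  elim: j => [|j IH].
    by rewrite addn0 => w [_ [u Qu]]; exists u.
  rewrite addnS; apply: subset_trans (Hn2 _ (leq_addr _ _)) _.
  apply: idealD_le => //; last first.
    move=> w Qw; exists 0; first exact: ideal0 (idealX_ideal a j.+1).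
    by rewrite mul0r subr0.
  apply: idealM_sub => // r w ar /IH [u au Qu]; exists (r * u).
    exact: idealM_mul.
  by rewrite -mulrA -mulrBr; apply: ideal_mull.
exists (n1 + n2 + c)%N => n z n0n Nxz.
have [u au Qu] : [set w | exists2 u, idealX a n1 u & Q (w - u * x)] (x * z).
  apply: LB; split; last by rewrite mulrC; apply: addgen_mul.
  apply: (Nle (p := (n + s)%N)) Nxz; lia.
have Nz : N Q n1 z.
  exists u; first exact: aF.
  by apply: reg; rewrite mulrBr [x * u]mulrC.
suff H k : (n1 + k <= n)%N -> N Q (n1 + k) z.
  by rewrite -(subnKC (_ : n1 <= n)%N); [apply: H; lia|lia].
elim: k => [|k IH] kn; first by rewrite addn0.
rewrite addnS; apply: Hx; [exact: leq_addr|apply: IH; lia|].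
apply: (Nle (p := (n + s)%N)) Nxz; lia.
Qed.

(** Avoiding the associated primes of all Q in the list at once gives one element for all of them;
    exchanging regular sequences depends on such a common element. *)
Lemma superficial_exists (qs : seq (set A)) :
  (forall Q, List.In Q qs -> is_ideal Q /\ socle_free Q) ->
  exists s x, [/\ (0 < s)%N, idealX a s x & forall Q, List.In Q qs -> nzd Q x /\
    exists n0, forall n z, (n0 <= n)%N -> N Q (n + s) (x * z) -> N Q n z].
Proof.
move=> hqs.
have [l [lP lH]] : exists l, (forall P, List.In P l -> hprime a P) /\
    forall s x, idealX a s x -> (forall P, List.In P l -> ~ P s x) ->
    forall Q, List.In Q qs -> exists n1,
      forall n z, (n1 <= n)%N -> N Q n z -> N Q (n + s).+1 (x * z) -> N Q n.+1 z.
  elim: qs hqs => [|Q qs IH] hqs; first by exists [::].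
  have [|l [lP lH]] := IH; first by move=> Q' Qqs; apply: hqs; right.
  have [hQ _] := hqs Q (or_introl (erefl _)).
  have [n1 [l1 [l1P l1H]]] := associated_hprimes hQ.
  exists (l1 ++ l); split.
    by move=> P /List.in_app_iff [/l1P|/lP].
  move=> s x ax lx Q' [<-|Qqs].
    by exists n1; apply: l1H => // P lP1; apply: lx; apply/List.in_app_iff; left.
  by apply: lH => // P lP1; apply: lx; apply/List.in_app_iff; right.
have [s [x [s0 ax lx]]] := hprime_avoid ha lP.
exists s, x; split=> // Q Qqs; have [hQ sQ] := hqs _ Qqs.
have [n1 Hn1] := lH _ _ ax lx _ Qqs.
exact: superficial_of_avoid Hn1.
Qed.

End Superficial.

(** * Regular sequences and dimension *)

Lemma In_cat (T : Type) (x : T) (s t : seq T) :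
  List.In x (s ++ t) <-> List.In x s \/ List.In x t.
Proof. by elim: s => [|y s IH] /=; [tauto|rewrite IH; tauto]. Qed.

Lemma In_map (S : eqType) (T : Type) (f : S -> T) (y : T) (s : seq S) :
  List.In y (map f s) <-> exists2 x, x \in s & y = f x.
Proof.
elim: s => [|x s IH] /=; first by split=> [//|[]].
rewrite IH; split=> [[<-|[z zs ->]]|[z]].
- by exists x; rewrite ?mem_head.
- by exists z; rewrite // inE zs orbT.
- by rewrite inE => /orP[/eqP -> ->|zs ->]; [left|right; exists z].
Qed.

Section RegularSequences.
Variable A : comNzRingType.
Implicit Types (Q J P : set A) (x y w z : A) (xs ys : seq A).

Fixpoint regl Q xs : Prop :=
  if xs is x :: xs' then nzd Q x /\ regl (addgen Q x) xs' else True.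

Definition gens Q xs : set A := foldl (@addgen A) Q xs.

Lemma gens_ideal Q xs : is_ideal Q -> is_ideal (gens Q xs).
Proof. by elim: xs Q => //= x xs IH Q hQ; apply: IH; apply: addgen_ideal. Qed.

Lemma gens_rcons Q xs x : gens Q (rcons xs x) = addgen (gens Q xs) x.
Proof. by rewrite /gens foldl_rcons. Qed.

Lemma gens_addgen Q xs x : gens (addgen Q x) xs = addgen (gens Q xs) x.
Proof. by elim: xs Q => //= y xs IH Q; rewrite addgenC IH. Qed.

Lemma gens_sub Q xs : is_ideal Q -> Q `<=` gens Q xs.
Proof.
elim: xs Q => [Q _|x xs IH Q hQ] /=; first exact: subset_refl.
by apply: (subset_trans (addgen_sub x hQ)); apply: IH; apply: addgen_ideal.
Qed.

Lemma gens_mem Q xs x : is_ideal Q -> x \in xs -> gens Q xs x.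
Proof.
elim: xs Q => [//|y xs IH] Q hQ; rewrite inE => /orP[/eqP ->|xxs] /=.
  by apply: gens_sub; [apply: addgen_ideal|apply: addgen_gen].
by apply: IH => //; apply: addgen_ideal.
Qed.

Lemma gens_le Q xs J : is_ideal J -> Q `<=` J -> (forall x, x \in xs -> J x) ->
  gens Q xs `<=` J.
Proof.
move=> hJ; elim: xs Q => [//|y xs IH] Q QJ H /=; apply: IH.
  by apply: addgen_le => //; apply: H; apply: mem_head.
by move=> x xxs; apply: H; rewrite inE xxs orbT.
Qed.

Lemma regl_rcons Q xs x : regl Q (rcons xs x) <-> regl Q xs /\ nzd (gens Q xs) x.
Proof.
elim: xs Q => [|y xs IH] Q /=; first by tauto.
by rewrite IH; tauto.
Qed.

Lemma regl_nth Q xs : regl Q xs <->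
  forall i, (i < size xs)%N -> nzd (gens Q (take i xs)) xs`_i.
Proof.
elim/last_ind: xs => [|xs x IH]; first by split.
rewrite regl_rcons IH size_rcons; split=> [[H Hx] i|H].
  rewrite ltnS leq_eqVlt nth_rcons => /orP[/eqP ->|lt].
    by rewrite ltnn eqxx -cats1 take_size_cat.
  by rewrite lt -cats1 takel_cat; [apply: H|apply: ltnW].
split=> [i lt|].
  have := H i (ltnW lt); rewrite nth_rcons lt -cats1 takel_cat //.
  exact: ltnW.
by have := H _ (ltnSn _); rewrite nth_rcons ltnn eqxx -cats1 take_size_cat.
Qed.

Lemma regl_take Q xs i : regl Q xs -> regl Q (take i xs).
Proof. by elim: xs Q i => [//|x xs IH] Q [//|i] /= [? ?]; split=> //; apply: IH. Qed.

Lemma nzd_swap Q x y : is_ideal Q -> nzd Q x -> nzd (addgen Q x) y -> nzd (addgen Q y) x.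
Proof.
move=> hQ rx ry w [e Qe].
have [e' Qe'] : addgen Q x e.
  apply: ry; exists w; have -> : y * e - w * x = - (x * w - e * y) by ring.
  exact: is_idealN.
exists e'; apply: rx.
have -> : x * (w - e' * y) = (x * w - e * y) + y * (e - e' * x) by ring.
by apply: ideal_add => //; apply: ideal_mull.
Qed.

Lemma regl_addgen Q w xs : is_ideal Q -> regl Q xs ->
  (forall i, (i <= size xs)%N -> nzd (gens Q (take i xs)) w) -> regl (addgen Q w) xs.
Proof.
elim: xs Q => [//|x xs IH] Q hQ /= [rx rxs] rw; split.
  by apply: nzd_swap => //; have := rw 1%N isT; rewrite /= take0.
rewrite addgenC; apply: IH => //; first exact: addgen_ideal.
by move=> i le; apply: (rw i.+1).
Qed.

End RegularSequences.

Section Depth.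
Variables (A : comNzRingType) (m : set A).
Hypotheses (noethA : noetherian A) (locA : is_local m).
Implicit Types (Q J P : set A) (x y w z : A) (xs ys : seq A).

Let hm : is_ideal m := local_ideal locA.

Lemma nzd_socle_free Q y : m y -> nzd Q y -> socle_free m Q.
Proof. by move=> my ry z H; apply: ry; apply: H. Qed.

(** A socle element z modulo x yields u with w z = u x modulo Q, and u is a socle element modulo w.
    For x and w in m this correspondence identifies both socles with Ext^1(A/m, A/Q). *)
Lemma socle_free_exchange Q x w : is_ideal Q -> m w -> nzd Q x -> nzd Q w ->
  socle_free m (addgen Q w) -> socle_free m (addgen Q x).
Proof.
move=> hQ mw rx rw sw z Hz; have [u Qu] := Hz _ mw.
have [v Qv] : addgen Q w u.
  apply: sw => t mt; have [v Qv] := Hz _ mt.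
  exists v; apply: rx.
  have -> : x * (t * u - v * w) = w * (t * z - v * x) - t * (w * z - u * x) by ring.
  by apply: is_idealB => //; apply: ideal_mull.
exists v; apply: rw.
have -> : w * (z - v * x) = (w * z - u * x) + x * (u - v * w) by ring.
by apply: ideal_add => //; apply: ideal_mull.
Qed.

Lemma nzd_all_exists (qs : seq (set A)) :
  (forall Q, List.In Q qs -> is_ideal Q /\ socle_free m Q) ->
  exists2 w, m w & forall Q, List.In Q qs -> nzd Q w.
Proof.
move=> hqs.
have m1 : idealX m 1 `<=` m by rewrite idealX1.
have mS n : idealX m (n + 0) `<=` idealX m n by rewrite addn0; apply: subset_refl.
have mM n x y : m x -> idealX m n y -> idealX m n.+1 (x * y) by apply: idealM_mul.
have [s [w [s0 mw H]]] := superficial_exists noethA locA hm (@subset_refl _ m) m1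
  (idealX_ideal m) (@idealX_succ_sub A m) mM (fun n => @subset_refl _ (idealX m n)) mS hqs.
exists w; last by move=> Q /H[].
by case: s s0 mw {H} => // s _; apply: idealX_subI.
Qed.

Lemma regl_socle_free Q xs : is_ideal Q -> (forall x, x \in xs -> m x) -> regl Q xs ->
  forall i, (i < size xs)%N -> is_ideal (gens Q (take i xs)) /\ socle_free m (gens Q (take i xs)).
Proof.
move=> hQ mxs /regl_nth rxs i lt; split; first exact: gens_ideal.
by apply: nzd_socle_free (rxs _ lt); apply: mxs; apply: mem_nth.
Qed.

(* A common nonzerodivisor w for all the partial quotients can be moved to the
   front of both sequences. *)
Lemma regl_longer_socle_free Q xs ys : is_ideal Q ->
  (forall x, x \in xs -> m x) -> (forall y, y \in ys -> m y) ->
  regl Q xs -> regl Q ys -> (size xs < size ys)%N -> socle_free m (gens Q xs).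
Proof.
move En: (size xs) => n; elim: n Q xs ys En => [|n IH] Q xs ys.
  case: xs ys => [|//] [//|y ys] _ hQ _ mys _ [ry _] _.
  by apply: nzd_socle_free ry; apply: mys; apply: mem_head.
case/lastP: xs => [//|xs x]; rewrite size_rcons => -[En] hQ mxs mys rxs rys lt.
case/lastP: ys lt mys rys => [//|ys y]; rewrite size_rcons ltnS => lt mys rys.
pose qs := [seq gens Q (take i xs) | i <- iota 0 n.+1] ++
           [seq gens Q (take i ys) | i <- iota 0 (size ys).+1].
have [|w mw wqs] := @nzd_all_exists qs.
  move=> P; rewrite In_cat !In_map => -[] [i]; rewrite mem_iota => /andP[_ ilt] ->.
    have le : (i <= size xs)%N by rewrite En -ltnS.
    rewrite -(takel_cat [:: x] le) cats1.
    by apply: (regl_socle_free hQ mxs rxs); rewrite size_rcons.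
  have le : (i <= size ys)%N by rewrite -ltnS.
  rewrite -(takel_cat [:: y] le) cats1.
  by apply: (regl_socle_free hQ mys rys); rewrite size_rcons.
have wxs i : (i <= size xs)%N -> nzd (gens Q (take i xs)) w.
  move=> le; apply: wqs; rewrite In_cat !In_map; left.
  by exists i; rewrite // mem_iota add0n ltnS -En.
have wys i : (i <= size ys)%N -> nzd (gens Q (take i ys)) w.
  move=> le; apply: wqs; rewrite In_cat !In_map; right.
  by exists i; rewrite // mem_iota add0n ltnS.
move/regl_rcons: rxs => [rxs rx]; move/regl_rcons: rys => [rys _].
rewrite gens_rcons; apply: (socle_free_exchange (w := w)) => //.
- exact: gens_ideal.
- by have := wxs _ (leqnn _); rewrite take_size.
rewrite -gens_addgen; apply: (IH _ _ ys) => //.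
- exact: addgen_ideal.
- by move=> u uxs; apply: mxs; rewrite mem_rcons inE uxs orbT.
- by move=> u uys; apply: mys; rewrite mem_rcons inE uys orbT.
- exact: regl_addgen.
- exact: regl_addgen.
Qed.

Lemma smulM_gens (s : seq A) : @smulM _ (A^o : lmodType A) s = gens [set 0] s.
Proof.
have hz := @is_ideal_zero A; apply/seteqP; split.
  move=> _ [y ->]; apply: is_ideal_sum => [|i _]; first exact: gens_ideal.
  apply: (@ideal_mulr A _ (y i) s`_i); first exact: gens_ideal.
  by apply: gens_mem => //; apply: mem_nth.
have hS : is_ideal (@smulM _ (A^o : lmodType A) s).
  split.
  - by exists (fun=> 0); rewrite big1 // => i _; rewrite scaler0.
  - move=> _ _ [y ->] [y' ->]; exists (fun i => y i + y' i).
    by rewrite -big_split; apply: eq_bigr => i _; rewrite scalerDr.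
  - move=> c _ [y ->]; exists (fun i => c * y i).
    by rewrite mulr_sumr; apply: eq_bigr => i _; rewrite mulrCA.
apply: gens_le => //; first by move=> _ ->; apply: ideal0.
move=> x xs; exists (fun i => (i == index x s)%:R).
have lt : (index x s < size s)%N by rewrite index_mem.
rewrite (bigD1 (Ordinal lt)) //= eqxx nth_index // big1 ?addr0.
  by rewrite -[LHS]mulr1.
by move=> i; rewrite -val_eqE /= => /negbTE ->; rewrite scaler0.
Qed.

Lemma depth_ge_regl n : depth_ge (A^o : lmodType A) m n ->
  exists ys, [/\ size ys = n, forall y, y \in ys -> m y & regl [set 0] ys].
Proof.
move=> [s [ns ms [rs _]]]; exists (take n s); split.
- by rewrite size_takel.
- by move=> y /mem_take; apply: ms.
- apply: regl_take; apply/regl_nth => i lt z; rewrite -smulM_gens.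
  exact: rs.
Qed.

Lemma prime_exists Q (S : set A) : is_ideal Q -> S 1 ->
  (forall u v, S u -> S v -> S (u * v)) -> (forall u, S u -> ~ Q u) ->
  exists P, [/\ is_prime P, Q `<=` P & forall u, S u -> ~ P u].
Proof.
move=> hQ S1 SM QS.
have [||P [hP QP PS] Pmax] := @noeth_max _ noethA
   [set J | [/\ is_ideal J, Q `<=` J & forall u, S u -> ~ J u]].
- by move=> P [].
- by exists Q; split=> //; apply: subset_refl.
exists P; split=> //; split=> //; first exact: PS.
have meets x : ~ P x -> exists2 u, S u & addgen P x u.
  move=> Px; apply: contrapT => H; apply: Px.
  rewrite -(Pmax (addgen P x)); first exact: addgen_gen.
    split; [exact: addgen_ideal| |].
      by apply: subset_trans QP _; apply: addgen_sub.
    by move=> u Su Pu; apply: H; exists u.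
  exact: addgen_sub.
move=> x y Pxy; have [|/meets [u Su [c Pu]]] := pselect (P x); [by left|right].
apply: contrapT => /meets [v Sv [d Pv]]; apply: (PS _ (SM _ _ Su Sv)).
have -> : u * v = (u - c * x) * v + c * x * (v - d * y) + c * d * (x * y) by ring.
apply: ideal_add => //; last exact: ideal_mull.
by apply: ideal_add => //; [apply: ideal_mulr|apply: ideal_mull].
Qed.

(** The products s x^j with s outside P form a multiplicative set, which misses Q because x is
    regular modulo Q and Q <= P. *)
Lemma nzd_prime_below Q x P : is_ideal Q -> nzd Q x -> is_prime P -> Q `<=` P ->
  exists P', [/\ is_prime P', Q `<=` P', P' `<=` P & ~ P' x].
Proof.
move=> hQ rx [hP P1 Ppr] QP.
have [|||P' [pP' QP' HP']] := @prime_exists Q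
    [set u | exists s j, ~ P s /\ u = s * x ^+ j] hQ.
- by exists 1, 0%N; rewrite expr0 mulr1.
- move=> _ _ [s [i [Ps ->]]] [t [j [Pt ->]]]; exists (s * t), (i + j)%N.
  by split; [move=> /Ppr[]|rewrite exprD; ring].
- move=> _ [s [j [Ps ->]]]; elim: j => [|j IH]; first by rewrite expr0 mulr1 => /QP.
  by rewrite exprS mulrCA => /rx.
exists P'; split=> //.
  move=> s P's; apply: contrapT => Ps; apply: HP' P's.
  by exists s, 0%N; rewrite expr0 mulr1.
by apply: HP'; exists 1, 1%N; rewrite mul1r expr1.
Qed.

(** Each term of the sequence, removed from the end, lets the prime drop strictly: the length of a
    regular sequence in P bounds the height of P from below. *)
Lemma regl_chain Q xs P : is_ideal Q -> regl Q xs -> is_prime P -> gens Q xs `<=` P ->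
  exists C : nat -> set A, [/\ forall i, (i <= size xs)%N -> is_prime (C i),
    forall i, (i < size xs)%N -> C i `<` C i.+1 & C (size xs) = P].
Proof.
move=> hQ; elim/last_ind: xs P => [|xs x IH] P rxs pP QP.
  by exists (fun=> P).
move: rxs QP => /regl_rcons [rxs rx]; rewrite gens_rcons => QP.
have hG := gens_ideal xs hQ.
have [|P' [pP' QP' P'P P'x]] := nzd_prime_below hG rx pP.
  by apply: subset_trans QP; apply: addgen_sub.
have [C [Cp Cs CE]] := IH _ rxs pP' QP'.
exists (fun i => if (i <= size xs)%N then C i else P); rewrite size_rcons; split.
- by move=> i _; case: ifP => // /Cp.
- move=> i; rewrite ltnS => le; rewrite le; case: ltnP => [|ge]; first exact: Cs.
  have {ge le}-> : i = size xs by apply/eqP; rewrite eqn_leq le.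
  rewrite CE; split=> // PP'; apply: P'x; apply: PP'.
  by apply: QP; apply: addgen_gen.
- by rewrite ltnn.
Qed.

Hypothesis cmA : cohen_macaulay m.

(** Otherwise a prime P containing the sequence misses the powers of g, so P < m and the dimension
    exceeds the length of the sequence. Then so does the depth, and a longer regular sequence would
    make the quotient socle free. *)
Lemma cm_gens_radical xs : (forall x, x \in xs -> m x) -> regl [set 0] xs ->
  ~ socle_free m (gens [set 0] xs) -> forall g, m g -> exists n, gens [set 0] xs (g ^+ n).
Proof.
move=> mxs rxs nsf g mg; apply: contrapT => H.
have hz := @is_ideal_zero A; have hG := gens_ideal xs hz.
have [|||P [pP GP gP]] := @prime_exists _ (range (fun n => g ^+ n)) hG.
- by exists 0%N.
- by move=> _ _ [i _ <-] [j _ <-]; exists (i + j)%N; rewrite // exprD.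
- by move=> _ [n _ <-] Gg; apply: H; exists n.
have [C [Cp Cs CE]] := regl_chain hz rxs pP GP.
have Pm : P `<` m.
  have [hP P1 _] := pP; split; first exact: (proper_sub_local noethA locA).
  by move=> /(_ _ mg); apply: gP; exists 1%N.
have : krull_dim_ge A (size xs).+1.
  exists (fun i => if (i <= size xs)%N then C i else m); split.
    by move=> i _; case: ifP => [/Cp //|_]; apply: is_prime_local.
  move=> i; rewrite ltnS => le; rewrite le; case: ltnP => [|ge]; first exact: Cs.
  have {ge le}-> : i = size xs by apply/eqP; rewrite eqn_leq le.
  by rewrite CE.
move=> /(cmA _) /depth_ge_regl [ys [sys mys rys]]; apply: nsf.
by apply: regl_longer_socle_free mxs mys rxs rys _ => //; rewrite sys.
Qed.

End Depth.

(** * Superficial sequences *)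

Section Powers.
Variable A : comNzRingType.
Implicit Types (Q J P : set A) (x y w z : A) (xs ys : seq A).

Lemma nzd_pow Q x n : nzd Q x -> nzd Q (x ^+ n).
Proof.
move=> rx; elim: n => [|n IH] z; first by rewrite expr0 mul1r.
by rewrite exprS -mulrA => /rx /IH.
Qed.

Lemma nzd_addgen_pow Q x y u : is_ideal Q -> nzd Q x -> nzd (addgen Q x) y ->
  nzd (addgen Q (x ^+ u)) y.
Proof.
move=> hQ rx ry; elim: u => [|u IH] z.
  by move=> _; exists z; rewrite expr0 mulr1 subrr; apply: ideal0.
move=> [c Qc]; have [z' Qz'] : addgen Q x z.
  by apply: ry; exists (c * x ^+ u); rewrite -mulrA -exprSr.
have [|d Qd] := IH z'.
  exists c; apply: rx.
  have -> : x * (y * z' - c * x ^+ u) = (y * z - c * x ^+ u.+1) - y * (z - z' * x).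
    by rewrite exprS; ring.
  by apply: is_idealB => //; apply: ideal_mull.
exists d; have -> : z - d * x ^+ u.+1 = (z - z' * x) + x * (z' - d * x ^+ u).
  by rewrite exprS; ring.
by apply: ideal_add => //; apply: ideal_mull.
Qed.

Lemma regl_addgen_pow Q x u ys : is_ideal Q -> nzd Q x -> regl (addgen Q x) ys ->
  regl (addgen Q (x ^+ u)) ys.
Proof.
elim: ys Q => [//|y ys IH] Q hQ rx /= [ry rys]; split.
  exact: nzd_addgen_pow.
rewrite addgenC; apply: IH; first exact: addgen_ideal.
  exact: nzd_swap.
by rewrite addgenC.
Qed.

Lemma regl_pow Q (l : seq (nat * A)) : is_ideal Q -> regl Q (unzip2 l) ->
  regl Q [seq p.2 ^+ p.1 | p <- l].
Proof.
elim: l Q => [//|[u x] l IH] Q hQ /= [rx rl]; split; first exact: nzd_pow.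
by apply: IH; [apply: addgen_ideal|apply: regl_addgen_pow].
Qed.

End Powers.

Section SuperficialSequences.
Variables (A : comNzRingType) (m a : set A) (F : nat -> set A) (c q : nat).
Hypotheses (noethA : noetherian A) (locA : is_local m) (ha : is_ideal a)
  (am : a `<=` m) (maq : idealX m q `<=` a)
  (hF : forall n, is_ideal (F n)) (Fdec : forall n, F n.+1 `<=` F n)
  (FM : forall n x y, a x -> F n y -> F n.+1 (x * y))
  (aF : forall n, idealX a n `<=` F n) (Fa : forall n, F (n + c) `<=` idealX a n).
Implicit Types (Q I : set A) (l : seq (nat * A)).

Fixpoint supseq Q l : Prop :=
  if l is (s, x) :: l' then
    [/\ (0 < s)%N, idealX a s x, nzd Q x,
       exists n0, forall n z, (n0 <= n)%N ->
         idealD (F (n + s)) Q (x * z) -> idealD (F n) Q z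
     & supseq (addgen Q x) l']
  else True.

Lemma supseq_rcons Q l s x : supseq Q l -> (0 < s)%N -> idealX a s x ->
  nzd (gens Q (unzip2 l)) x ->
  (exists n0, forall n z, (n0 <= n)%N ->
    idealD (F (n + s)) (gens Q (unzip2 l)) (x * z) ->
    idealD (F n) (gens Q (unzip2 l)) z) -> supseq Q (rcons l (s, x)).
Proof.
elim: l Q => [|[s' x'] l IH] Q /=; first by [].
by move=> [? ? ? ? Sl] s0 ax rx Hx; split=> //; apply: IH.
Qed.

Lemma supseq_regl Q l : supseq Q l -> regl Q (unzip2 l).
Proof. by elim: l Q => [//|[s x] l IH] Q /= [_ _ ? _ /IH]. Qed.

Lemma supseq_mem Q l p : supseq Q l -> p \in l -> (0 < p.1)%N /\ idealX a p.1 p.2.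
Proof.
elim: l Q => [//|[s x] l IH] Q /= [s0 ax _ _ /IH Hl].
by rewrite inE => /orP[/eqP ->|/Hl].
Qed.

Lemma supseq_local Q l x : supseq Q l -> x \in unzip2 l -> m x.
Proof.
move=> Sl /mapP [[s y] /(supseq_mem Sl) /= [s0 ay] ->].
by apply: am; case: s s0 ay => // s _; apply: idealX_subI.
Qed.

(** Take a superficial sequence whose ideal G is maximal. If A/G had positive depth, a further
    superficial element would lie in G by maximality and be regular modulo G, forcing 1 into G. *)
Lemma supseq_exists : exists l, supseq [set 0] l /\
  ~ socle_free m (gens [set 0] (unzip2 l)).
Proof.
have hz := @is_ideal_zero A.
have [||_ [l Sl <-] lmax] := @noeth_max _ noethA
   ((fun l => gens [set 0] (unzip2 l)) @` [set l : seq (nat * A) | supseq [set 0] l]).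
- by move=> _ [l _ <-]; apply: gens_ideal.
- by exists (gens [set 0] (unzip2 ([::] : seq (nat * A)))); exists [::].
exists l; split=> // sl; pose G := gens [set 0] (unzip2 l).
have hG : is_ideal G by apply: gens_ideal.
have [|s [x [s0 ax H]]] := superficial_exists noethA locA ha am maq hF Fdec FM aF Fa
  (qs := [:: G]).
  by move=> _ [<-|//].
have [rx Hx] := H G (or_introl (erefl _)).
have Gx : G x.
  suff <- : gens [set 0] (unzip2 (rcons l (s, x))) = G.
    by apply: gens_mem => //; apply/mapP; exists (s, x); rewrite // mem_rcons mem_head.
  apply: lmax; first by exists (rcons l (s, x)) => //; apply: supseq_rcons.
  by rewrite /unzip2 map_rcons gens_rcons; apply: addgen_sub.
apply: (local_proper locA).
have : G `<=` m.
  apply: gens_le => [|_ ->|y]; [exact: local_ideal| |exact: supseq_local Sl].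
  exact: ideal0 (local_ideal locA).
by apply; apply: rx; rewrite mulr1.
Qed.

Let Fle n p : (n <= p)%N -> F p `<=` F n.
Proof. exact: decreasing_sub. Qed.

Let FMX e n x y : idealX a e x -> F n y -> F (e + n)%N (x * y).
Proof.
elim: e x => [|e IH] x; first by move=> _; apply: ideal_mull.
move=> ax Fy; move: x ax.
apply: (idealM_sub (K := [set x | F (e.+1 + n)%N (x * y)])).
  exact: colon_ideal.
by move=> u v au /IH /(_ Fy) /(FM au) /=; rewrite mulrA.
Qed.

(** The sum of the ideals x_i F_(n - s_i) over the entries (s_i, x_i). *)
Fixpoint red l n : set A :=
  if l is (s, x) :: l' then
    [set w | exists2 f, F (n - s) f & red l' n (w - f * x)] else [set 0].

Let red_ideal l n : is_ideal (red l n).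
Proof.
elim: l => [|[s x] l IH] /=; first exact: is_ideal_zero.
split.
- by exists 0; [apply: ideal0|rewrite mul0r subrr; apply: ideal0].
- move=> u v [f Ff Hf] [g Fg Hg]; exists (f + g); first exact: ideal_add.
  have -> : u + v - (f + g) * x = (u - f * x) + (v - g * x) by ring.
  exact: ideal_add.
- move=> d u [f Ff Hf]; exists (d * f); first exact: ideal_mull.
  have -> : d * u - d * f * x = d * (u - f * x) by ring.
  exact: ideal_mull.
Qed.

Let red_sub l n : (forall p, p \in l -> idealX a p.1 p.2) -> red l n `<=` F n.
Proof.
elim: l => [_ _ ->|[s x] l IH H w] /=; first exact: ideal0 (hF n).
move=> [f Ff Hf]; apply: (@ideal_eqB _ _ _ (f * x)) => //.
  by apply: IH Hf => p pl; apply: H; rewrite inE pl orbT.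
have /FMX/(_ Ff) := H _ (mem_head _ _); rewrite mulrC.
by apply: Fle => /=; lia.
Qed.

Let red_mul l n s x : idealX a s x -> forall w, red l (n - s) w -> red l n (x * w).
Proof.
move=> ax; elim: l => [_ ->|[s' x'] l IH] /=; first by rewrite mulr0.
move=> w [f Ff Hf]; exists (x * f).
  by apply: Fle (FMX ax Ff); lia.
by rewrite -mulrA -mulrBr; apply: IH.
Qed.

(** A condition of Valabrega-Valla type in high degrees. The tail of the sequence is handled first,
    modulo Q + xA; what remains is d x modulo Q, and superficiality of x puts d in F_(n - s) + Q. *)
Lemma supseq_red Q l : is_ideal Q -> supseq Q l -> exists n0, forall n, (n0 <= n)%N ->
  forall w, F n w -> gens Q (unzip2 l) w -> exists2 r, red l n r & Q (w - r).
Proof.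
move=> hQ Sl; have lmem p : p \in l -> idealX a p.1 p.2 by move=> /(supseq_mem Sl)[].
elim: l Q hQ Sl lmem => [|[s x] l IH] Q hQ /=.
  by move=> _ _; exists 0%N => n _ w _ Qw; exists 0; rewrite ?subr0.
move=> [s0 ax rx [n1 Hx] Sl] lmem.
have [|n2 H2] := IH _ (addgen_ideal x hQ) Sl.
  by move=> p pl; apply: lmem; rewrite inE pl orbT.
exists (n1 + n2 + s)%N => n n0 w Fw Gw.
have [|r Rr [d Qd]] := H2 n _ w Fw Gw; first lia.
have Fr : F n r.
  by apply: red_sub Rr => p pl; apply: lmem; rewrite inE pl orbT.
have [f Ff Qf] : idealD (F (n - s)) Q d.
  apply: Hx; first lia.
  rewrite subnK; last lia.
  exists (w - r); first exact: is_idealB.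
  have -> : x * d - (w - r) = - (w - r - d * x) by ring.
  exact: is_idealN.
exists (r + f * x).
  by exists f; rewrite ?addrK.
have -> : w - (r + f * x) = (w - r - d * x) + x * (d - f) by ring.
by apply: ideal_add => //; apply: ideal_mull.
Qed.

(** The terms x F_(n - t) are removed one entry at a time: substituting F_n <= X_n + x F_(n - t)
    into itself u times replaces the last term by x^u F_(n - ut), where x^u is in I and ut = s. *)
Lemma red_powers I s l : is_ideal I ->
  (forall p, p \in l -> idealX a p.1 p.2 /\
     exists2 u, (u * p.1)%N = s & I (p.2 ^+ u)) ->
  (exists n0, forall n, (n0 <= n)%N -> F n `<=` idealD (idealM I (F (n - s))) (red l n)) ->
  exists n0, forall n, (n0 <= n)%N -> F n `<=` idealM I (F (n - s)).
Proof.
move=> hI; elim: l => [|[t x] l IH] Hl [n0 Hn0].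
  exists n0 => n /Hn0 H w /H [f If /= /eqP]; rewrite subr_eq0 => /eqP ->.
  exact: If.
have [/= ax [u us Iu]] := Hl _ (mem_head _ _).
apply: IH; first by move=> p pl; apply: Hl; rewrite inE pl orbT.
pose X n := idealD (idealM I (F (n - s))) (red l n).
have hX n : is_ideal (X n) by apply: idealD_ideal => //; apply: idealM_ideal.
have X_mul n w : X (n - t)%N w -> X n (x * w).
  move=> [f If Rf]; exists (x * f); last first.
    by rewrite -mulrBr; apply: red_mul Rf.
  rewrite mulrC; apply: idealM_mul_le If; first exact: idealM_ideal.
  move=> g h Ig Fh; rewrite -mulrA; apply: idealM_mul => //.
  by rewrite mulrC; apply: Fle (FMX ax Fh); lia.
have HX n : (n0 <= n)%N -> F n `<=` [set w | exists2 f, F (n - t) f & X n (w - f * x)].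
  move=> /Hn0 H w /H [g Ig [f Ff Rf]]; exists f => //; exists g => //.
  by have -> : w - f * x - g = w - g - f * x by ring.
have HXu v n : (n0 + v * t <= n)%N ->
    F n `<=` [set w | exists2 f, F (n - v * t) f & X n (w - f * x ^+ v)].
  elim: v n => [|v IH] n le w Fw.
    by exists w; rewrite ?subn0 // expr0 mulr1 subrr; apply: ideal0.
  have [|f Ff Xf] := HX n _ w Fw; first lia.
  have [|g Fg Xg] := IH (n - t)%N _ f Ff.
    by rewrite mulSn in le; lia.
  exists g; first by rewrite mulSn subnDA.
  have -> : w - g * x ^+ v.+1 = (w - f * x) + x * (f - g * x ^+ v).
    by rewrite exprS; ring.
  by apply: ideal_add => //; apply: X_mul.
exists (n0 + s)%N => n le w Fw; rewrite -us in le.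
have [f Ff Xf] := HXu u n le w Fw; rewrite us in Ff.
apply: (ideal_eqB (hX n) Xf); apply: idealD_subl; first exact: red_ideal.
by rewrite mulrC; apply: idealM_mul.
Qed.

Lemma filt_sub_powers I s : (exists n0, forall n, (n0 <= n)%N -> F n `<=` idealM I (F (n - s))) ->
  exists n0, forall j, F (n0 + s * j)%N `<=` idealX I j.
Proof.
move=> [n0 H]; exists n0; elim=> [|j IH]; first by [].
apply: (subset_trans (H _ _)); first exact: leq_addr.
by apply: idealMS => //; rewrite mulnS addnCA addKn.
Qed.

End SuperficialSequences.

(** * The associated graded ring of a regular sequence *)

#[local] Hint Extern 0 (subset _ _) => exact: subset_refl : core.

Section Forms.
Variables (A : comNzRingType) (m : set A).
Hypotheses (noethA : noetherian A) (locA : is_local m).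
Implicit Types (I J K : set A) (x y z w g b t : A) (p : {poly A}).

Let hm : is_ideal m := local_ideal locA.

(** J^k K. For ideals J <= K its quotient by J^(k+1) is the degree k part of K gr_J(A); K = m gives
    the kernel of the map to the fiber cone. *)
Definition powM J K k : set A := idealM (idealX J k) K.

Lemma powM_ideal J K k : is_ideal (powM J K k). Proof. exact: idealM_ideal. Qed.

Lemma powMT J k : powM J [set: A] k = idealX J k.
Proof. by rewrite /powM idealMC idealM1 //; apply: idealX_ideal. Qed.

Lemma powM0 J K : is_ideal K -> powM J K 0 = K.
Proof. exact: idealM1. Qed.

Lemma powMJ J k : powM J J k = idealX J k.+1.
Proof. by rewrite /powM idealMC. Qed.

Lemma powMS J J' K K' k : J `<=` J' -> K `<=` K' -> powM J K k `<=` powM J' K' k.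
Proof. by move=> JJ KK; apply: idealMS => //; apply: idealXS. Qed.

Lemma powM_sub J K k : powM J K k `<=` idealX J k.
Proof. by apply: idealM_subl; apply: idealX_ideal. Qed.

Lemma powM_mul J K K' L e n x y : (forall u v, K u -> K' v -> L (u * v)) ->
  powM J K e x -> powM J K' n y -> powM J L (e + n) (x * y).
Proof.
move=> KL; have hL := powM_ideal J L (e + n).
move=> Jx Jy; move: x Jx; apply: idealM_mul_le => // u v Ju Kv.
rewrite mulrC; move: y Jy; apply: (idealM_sub (K := [set y | powM J L (e + n) (y * (u * v))])).
  exact: colon_ideal.
move=> u' v' Ju' Kv' /=.
have -> : u' * v' * (u * v) = (u * u') * (v * v') by ring.
by apply: idealM_mul; [apply: idealX_mul|apply: KL].
Qed.

Lemma powM_mull J K e n x y : is_ideal K -> idealX J e x -> powM J K n y ->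
  powM J K (e + n) (x * y).
Proof.
rewrite -powMT => hK; apply: powM_mul => u v _; exact: ideal_mull.
Qed.

(** An expansion of p(z) as an element of (J + zA)^n K, with the variable standing for the initial
    form of z. *)
Definition isdec J K n p : Prop :=
  (size p <= n.+1)%N /\ forall i, (i <= n)%N -> powM J K (n - i) p`_i.

Lemma powM_addgenP J K z n w : is_ideal J -> is_ideal K ->
  powM (addgen J z) K n w <-> exists2 p, isdec J K n p & w = p.[z].
Proof.
move=> hJ hK; have hI := addgen_ideal z hJ; split; last first.
  move=> [p [sp Kp] ->]; rewrite (horner_coef_wide _ sp).
  apply: is_ideal_sum => [|i _]; first exact: powM_ideal.
  rewrite -{1}(subnK (leq_ord i)) addnC mulrC.
  apply: powM_mull => //; first by apply: idealX_expr; apply: addgen_gen.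
  by apply: powMS (Kp _ (leq_ord i)) => //; apply: addgen_sub.
suff H k : powM (addgen J z) K k `<=` [set w | exists2 p, isdec J K k p & w = p.[z]].
  exact: H.
have hD k0 : is_ideal [set w | exists2 p, isdec J K k0 p & w = p.[z]].
  split.
  - exists 0; last by rewrite horner0.
    by split=> [|i _]; rewrite ?size_poly0 // coef0; apply: ideal0 (powM_ideal _ _ _).
  - move=> _ _ [p [sp Jp] ->] [p' [sp' Jp'] ->]; exists (p + p'); last by rewrite hornerD.
    split; first by rewrite (leq_trans (size_polyD _ _)) // geq_max sp.
    move=> i le; rewrite coefD; exact: ideal_add (powM_ideal _ _ _) (Jp _ le) (Jp' _ le).
  - move=> c _ [p [sp Jp] ->]; exists (c *: p); last by rewrite hornerZ.
    split; first exact: leq_trans (size_scale_leq _ _) sp.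
    move=> i le; rewrite coefZ; exact: ideal_mull (powM_ideal _ _ _) (Jp _ le).
elim: k => [|k IH].
  rewrite powM0 // => u Ku; exists u%:P; last by rewrite hornerC.
  split; first exact: size_polyC_leq1.
  by move=> [|//] _; rewrite coefC eqxx powM0.
rewrite /powM /= -idealMA; apply: idealM_sub => // u _ [c Jc] /IH [p [sp Jp] ->].
exists ((u - c * z) *: p + c *: (p * 'X)); last first.
  by rewrite hornerD !hornerZ hornerMX; ring.
split.
  rewrite (leq_trans (size_polyD _ _)) // geq_max.
  rewrite (leq_trans (size_scale_leq _ _)) ?(leq_trans sp) //=.
  rewrite (leq_trans (size_scale_leq _ _)) // (leq_trans (size_polyMleq _ _)) //.
  by rewrite size_polyX addn2.
move=> i le; rewrite coefD !coefZ coefMX; apply: (ideal_add (powM_ideal _ _ _)).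
  have [le'|gt] := leqP i k.
    rewrite subSn // -add1n; apply: powM_mull => //; last exact: Jp.
    by rewrite idealX1.
  by rewrite nth_default ?mulr0 ?(leq_trans sp) //; apply: ideal0 (powM_ideal _ _ _).
apply: (ideal_mull _ (powM_ideal _ _ _)).
case: i le => [_|i le] /=; first exact: ideal0 (powM_ideal _ _ _).
by rewrite subSS; apply: Jp.
Qed.

Lemma idealX_addgenP J z n w : is_ideal J ->
  idealX (addgen J z) n w <-> exists2 p, isdec J [set: A] n p & w = p.[z].
Proof. by move=> hJ; rewrite -powMT; apply: powM_addgenP. Qed.

Section Unique.
Variables (J : set A) (z : A).
Hypotheses (hJ : is_ideal J) (Jz : forall n w, idealX J n (z * w) -> idealX J n w).

(** Uniqueness of expansions modulo J + zA. From p(z) = 0 the constant term is -z r(z), so r(z) lies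
    in J^n after cancelling z, with one power of J to spare; r - r(z) vanishes at z and has lower
    degree. *)
Lemma isdec_root n p : isdec J [set: A] n p -> p.[z] = 0 ->
  isdec J (addgen J z) n p.
Proof.
have hI := addgen_ideal z hJ.
elim: n p => [|n IH] p [sp Jp] pz; split=> //.
  move=> [|//] _; rewrite powM0 //; move: pz; rewrite (size1_polyC sp) hornerC coefC /= => ->.
  exact: ideal0.
pose r := \poly_(i < n.+1) p`_i.+1.
have rE i : r`_i = p`_i.+1.
  rewrite coef_poly; case: ltnP => // ge; rewrite nth_default //.
  exact: leq_trans sp _.
have pE : p = (p`_0)%:P + r * 'X.
  apply/polyP => -[|i]; rewrite coefD coefC coefMX ?addr0 //=.
  by rewrite add0r rE.
have p0 : p`_0 = - (r.[z] * z).
  have := pz; rewrite {1}pE hornerD hornerC hornerMX => /eqP.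
  by rewrite addr_eq0 => /eqP.
have Jr : idealX J n.+1 r.[z].
  apply: Jz; rewrite mulrC -[_ * z]opprK -p0.
  by apply: (is_idealN (idealX_ideal J n.+1)); have := Jp 0%N isT; rewrite powMT.
have Jr' : powM J (addgen J z) n r.[z].
  by apply: (powMS (K := J) (@subset_refl _ J) (addgen_sub z hJ)); rewrite powMJ.
pose r' := r - r.[z]%:P.
have [||_ Hr'] := IH r'; last 1 first.
- move=> [_|i le].
    rewrite subn0 p0; apply: (is_idealN (powM_ideal _ _ _)).
    by apply: idealM_mul => //; apply: addgen_gen.
  rewrite subSS -rE; case: i le => [_|i le]; last first.
    by have := Hr' _ (le : i.+1 <= n)%N; rewrite coefB coefC subr0.
  have := Hr' 0%N isT; rewrite coefB coefC /= subn0 => H.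
  by apply: ideal_eqB H Jr'; apply: powM_ideal.
- split.
    rewrite (leq_trans (size_polyD _ _)) // geq_max size_poly size_polyN.
    exact: leq_trans (size_polyC_leq1 _) _.
  move=> i le; rewrite powMT coefB coefC rE; apply: (is_idealB (idealX_ideal _ _)).
    by have := Jp i.+1 le; rewrite powMT subSS.
  case: i le => [_|i _]; last exact: ideal0 (idealX_ideal _ _).
  by rewrite subn0; apply: idealX_succ_sub.
- by rewrite hornerD hornerN hornerC subrr.
Qed.

Lemma isdec_coef K n p : is_ideal K -> addgen J z `<=` K ->
  isdec J [set: A] n p -> powM (addgen J z) K n p.[z] -> isdec J K n p.
Proof.
move=> hK IK [sp Jp] /(powM_addgenP _ _ _ hJ hK)[p' [sp' Jp'] pp'].
have [||_ H] := @isdec_root n (p - p').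
- split; first by rewrite (leq_trans (size_polyD _ _)) // geq_max sp size_polyN.
  move=> i le; rewrite coefB; apply: (is_idealB (powM_ideal _ _ _)).
    exact: Jp.
  by apply: powMS (Jp' _ le) => //; apply: subset_refl.
- by rewrite hornerD hornerN pp' subrr.
split=> // i le; have := H _ le; rewrite coefB => Hi.
apply: (ideal_eqB (powM_ideal _ _ _) _ (Jp' _ le)).
by apply: powMS Hi.
Qed.

End Unique.

Lemma nat_least (P : nat -> Prop) : (exists n, P n) ->
  exists n, P n /\ forall k, (k < n)%N -> ~ P k.
Proof.
move=> [n Pn]; have ex : exists n, `[< P n >] by exists n; apply/asboolP.
case: (ex_minnP ex) => k /asboolP Pk kmin; exists k; split=> // j lt Pj.
by have := kmin j (asboolT Pj); rewrite leqNgt lt.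
Qed.

(* gr_J(A) is a polynomial ring over A/J: gr_J(A) (x) A/K has the same
   nonzerodivisors t as A/K, and a form with a unit coefficient is a
   nonzerodivisor on K gr_J(A) / K' gr_J(A) when m K <= K'. *)
Definition quasi_regular J : Prop :=
  [/\ is_ideal J, J `<=` m,
      forall K t e b, is_ideal K -> J `<=` K -> nzd K t -> idealX J e b ->
        powM J K e (t * b) -> powM J K e b
    & forall K K' e n g b, is_ideal K -> is_ideal K' -> K' `<=` K ->
        (forall r k, m r -> K k -> K' (r * k)) -> J `<=` K' ->
        idealX J e g -> ~ powM J m e g -> powM J K n b ->
        powM J K' (e + n) (g * b) -> powM J K' n b].

Lemma quasi_regular0 : quasi_regular [set 0].
Proof.
have hz := @is_ideal_zero A.
have X0 e b : idealX [set 0] e.+1 b -> b = 0 by move/(idealX_subI hz).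
split=> //; first by move=> _ ->; apply: ideal0.
- move=> K t [|e] b hK _ rt; first by rewrite !powM0 // => _; apply: rt.
  by move=> /X0 -> _; apply: ideal0 (powM_ideal _ _ _).
- move=> K K' [|e] n g b hK hK' _ _ _; last first.
    by move=> /X0 -> []; apply: ideal0 (powM_ideal _ _ _).
  rewrite powM0 // add0n => _ mg; case: n => [_|n].
    by rewrite powM0 //; apply: (unit_cancel noethA locA hK' mg).
  by move=> /powM_sub /X0 -> _; apply: ideal0 (powM_ideal _ _ _).
Qed.

Lemma quasi_regular_colon J z n w : quasi_regular J -> nzd J z ->
  idealX J n (z * w) -> idealX J n w.
Proof.
move=> [hJ Jm PJ _] rz; elim: n => [//|n IH] H.
rewrite -powMJ; apply: (PJ J z) => //; last by rewrite powMJ.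
by apply: IH; apply: idealX_succ_sub.
Qed.

(** By uniqueness of expansions gr of J + zA behaves as a polynomial ring over gr of J, and both
    cancellation properties are checked on coefficients. *)
Lemma quasi_regularS J z : quasi_regular J -> m z -> nzd J z ->
  quasi_regular (addgen J z).
Proof.
move=> qJ mz rz; have Jz n w := quasi_regular_colon (n := n) (w := w) qJ rz.
have [hJ Jm PJ DJ] := qJ; have hI := addgen_ideal z hJ.
split=> //; first exact: addgen_le.
- move=> K t e b hK IK rt /(idealX_addgenP _ _ _ hJ)[p [sp Jp] ->].
  have -> : t * p.[z] = (t *: p).[z] by rewrite hornerZ.
  move=> /(isdec_coef hJ Jz hK IK) H; apply/powM_addgenP => //; exists p => //.
  have [|_ Hc] := H.
    split; first exact: leq_trans (size_scale_leq _ _) sp.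
    by move=> i le; rewrite coefZ; apply: (ideal_mull _ (powM_ideal _ _ _)); apply: Jp.
  split=> // i le; have := Hc _ le; rewrite coefZ; apply: PJ => //.
    by apply: subset_trans IK; apply: addgen_sub.
  by have := Jp _ le; rewrite powMT.
- move=> K K' e n g b hK hK' K'K mKK' IK' /(idealX_addgenP _ _ _ hJ)[p [sp Jp] ->] ng.
  move=> /(powM_addgenP _ _ _ hJ hK)[p' [sp' Jp'] ->]; rewrite -hornerM.
  have JK' : J `<=` K' by apply: subset_trans IK'; apply: addgen_sub.
  have dec_pp' : isdec J [set: A] (e + n) (p * p').
    split.
      by rewrite (leq_trans (size_polyMleq _ _)) //; move: sp sp'; lia.
    move=> l le; rewrite coefM powMT; apply: is_ideal_sum => [|i _].
      exact: idealX_ideal.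
    have il := leq_ord i.
    have [ie|ei] := leqP i e; last first.
      rewrite [p`_i]nth_default ?mul0r; first exact: ideal0 (idealX_ideal _ _).
      exact: leq_trans sp ei.
    have [jn|nj] := leqP (l - i) n; last first.
      rewrite [p'`_ _]nth_default ?mulr0; first exact: ideal0 (idealX_ideal _ _).
      exact: leq_trans sp' nj.
    have -> : (e + n - l = (e - i) + (n - (l - i)))%N by lia.
    apply: idealX_mul; first by have := Jp _ ie; rewrite powMT.
    by have /powM_sub := Jp' _ jn.
  move=> /(isdec_coef hJ Jz hK' IK' dec_pp')[_ Hc].
  have [i0 [[i0e ni0] i0min]] : exists i, ((i <= e)%N /\ ~ powM J m (e - i) p`_i) /\
      forall k, (k < i)%N -> ~ ((k <= e)%N /\ ~ powM J m (e - k) p`_k).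
    apply: nat_least; apply: contrapT => H; apply: ng; apply/powM_addgenP => //.
    exists p => //; split=> // i le; apply: contrapT => Hi; apply: H.
    by exists i.
  apply/powM_addgenP => //; exists p' => //; split=> // j0.
  elim/ltn_ind: j0 => j0 IH j0n.
  (* [i0] is the least index at which g has a coefficient outside m J^(e - i). In the coefficient i0
     + j0 of the product, terms with i < i0 fall into K' since m K <= K', and those with i > i0 by
     induction on j0. *)
  have [l lD] : exists l, l = (i0 + j0)%N by exists (i0 + j0)%N.
  have le_l : (l <= e + n)%N by rewrite lD leq_add.
  have ltl : (i0 < l.+1)%N by rewrite lD ltnS leq_addr.
  have lE : (e + n - l = (e - i0) + (n - j0))%N by lia.
  apply: (DJ K K' (e - i0)%N _ p`_i0) => //; last 1 first.
  - have := Hc _ le_l; rewrite coefM (bigD1 (Ordinal ltl)) //= lE.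
    have -> : (l - i0 = j0)%N by rewrite lD addKn.
    apply: ideal_subr; first exact: powM_ideal.
    rewrite -lE; apply: is_ideal_sum => [|i]; first exact: powM_ideal.
    rewrite -val_eqE /= => ne; have il := leq_ord i.
    have [ie|ei] := leqP i e; last first.
      rewrite [p`_i]nth_default ?mul0r; first exact: ideal0 (powM_ideal _ _ _).
      exact: leq_trans sp ei.
    have [jn|nj] := leqP (l - i) n; last first.
      rewrite [p'`_ _]nth_default ?mulr0; first exact: ideal0 (powM_ideal _ _ _).
      exact: leq_trans sp' nj.
    have -> : (e + n - l = (e - i) + (n - (l - i)))%N by lia.
    have [lt|gt] : (i < i0)%N \/ (i0 < i)%N by move: ne; lia.
      apply: (powM_mul mKK'); last exact: Jp'.
      by apply: contrapT => Hi; apply: (i0min _ lt).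
    apply: powM_mull => //; first by have := Jp _ ie; rewrite powMT.
    by apply: IH => //; lia.
  - by have := Jp _ i0e; rewrite powMT.
  - exact: Jp'.
Qed.

Section QuasiRegular.
Variable J : set A.
Hypothesis qJ : quasi_regular J.

(** The case K = A, K' = m: the fiber cone is a domain. *)
Lemma quasi_regular_mul e n g h : idealX J e g -> ~ powM J m e g ->
  idealX J n h -> ~ powM J m n h -> ~ powM J m (e + n) (g * h).
Proof.
have [hJ Jm _ DJ] := qJ; rewrite -(powMT J n) => Jg ng Jh nh Jgh; apply: nh.
by apply: (DJ [set: A] m e n g h) => // r k mr _; apply: ideal_mulr.
Qed.

(** A/J is filtered by the ideals m^i + J; a form with a unit coefficient cancels on each layer, and
    the filtration ends at J because m^N <= J. *)
Lemma quasi_regular_cancel N e n g b : idealX m N `<=` J -> idealX J e g ->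
  ~ powM J m e g -> idealX J (e + n) (g * b) -> idealX J n b.
Proof.
have [hJ Jm _ DJ] := qJ => mNJ Jg ng; elim: n => [//|n IH].
rewrite addnS => Jgb; have Jb : idealX J n b by apply: IH; apply: idealX_succ_sub.
pose K i := idealD (idealX m i) J.
have hK i : is_ideal (K i) by apply: idealD_ideal => //; apply: idealX_ideal.
have JK i : J `<=` K i by apply: idealD_subr; apply: idealX_ideal.
suff : powM J (K N) n b.
  rewrite -powMJ; apply: powMS => //; exact: idealD_le.
elim: (N) => [|i IHi].
  rewrite -(powMT J n) in Jb; apply: powMS Jb => // w _.
  by apply: idealD_subl.
apply: (DJ (K i) (K i.+1) e n g b) => //.
- by apply: idealDS => //; apply: idealX_succ_sub.
- move=> r k mr [f mf Jkf]; exists (r * f); first exact: idealM_mul.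
  by rewrite -mulrBr; apply: ideal_mull.
- by move: Jgb; rewrite -powMJ; apply: powMS.
Qed.

End QuasiRegular.

(* x and y are part of a basis of the linear forms. *)
Definition separated J x y : Prop :=
  [/\ J x, J y, ~ powM J m 1 x
    & forall e (p : nat) g h, (e < p)%N -> idealX J e g -> idealX J e h ->
        powM J m (e + p) (y ^+ p * g - x ^+ p * h) -> powM J m e g].

(** Expand in powers of y: the coefficient of y^(p + i) in y^p g - x^p h is that of y^i in g,
    because h has degree at most e < p in y. *)
Lemma separated_base J x y : quasi_regular J -> J x -> ~ powM J m 1 x -> m y ->
  nzd J y -> separated (addgen J y) x y.
Proof.
move=> qJ Jx nx my ry; have Jy n w := quasi_regular_colon (n := n) (w := w) qJ ry.
have [hJ Jm _ _] := qJ; have [hI Im _ _] := quasi_regularS qJ my ry.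
split; [exact: addgen_sub|exact: addgen_gen| |].
- move=> H; apply: nx.
  have [||_ /(_ 0%N isT)] := isdec_coef hJ Jy hm Im (n := 1) (p := x%:P).
  + split; first exact: leq_trans (size_polyC_leq1 _) _.
    move=> [_|[_|//]]; rewrite coefC ?powMT ?idealX1 //=.
  + by rewrite hornerC.
  + by rewrite coefC.
- move=> e p g h ep /(idealX_addgenP _ _ _ hJ)[P [sP JP] ->].
  move=> /(idealX_addgenP _ _ _ hJ)[R [sR JR] ->].
  pose S := 'X^p * P - x ^+ p *: R.
  have -> : y ^+ p * P.[y] - x ^+ p * R.[y] = S.[y].
    by rewrite /S hornerD hornerN hornerM hornerXn hornerZ.
  move=> H; have [|_ Hc] := isdec_coef hJ Jy hm Im (n := (e + p)%N) (p := S) _ H.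
    split.
      rewrite (leq_trans (size_polyD _ _)) // size_polyN geq_max; apply/andP; split.
        by rewrite (leq_trans (size_polyMleq _ _)) // size_polyXn; move: sP; lia.
      by rewrite (leq_trans (size_scale_leq _ _)) // (leq_trans sR) // ltnS leq_addr.
    move=> i le; rewrite powMT coefB coefXnM coefZ; apply: (is_idealB (idealX_ideal _ _)).
      case: ltnP => [_|pi]; first exact: ideal0 (idealX_ideal _ _).
      have -> : (e + p - i = e - (i - p))%N by lia.
      by have := JP (i - p)%N; rewrite powMT; apply; lia.
    have [ie|ei] := leqP i e; last first.
      by rewrite nth_default ?mulr0 ?(leq_trans sR) //; apply: ideal0 (idealX_ideal _ _).
    have -> : (e + p - i = p + (e - i))%N by lia.
    apply: idealX_mul; first exact: idealX_expr.
    by have := JR _ ie; rewrite powMT.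
  apply/powM_addgenP => //; exists P => //; split=> // i ie.
  have := Hc (p + i)%N; rewrite coefB coefXnM coefZ ltnNge leq_addr /= addKn.
  rewrite [R`_ _]nth_default ?mulr0 ?subr0 ?(leq_trans sR) //; last by lia.
  have -> : (e + p - (p + i) = e - i)%N by lia.
  by apply; lia.
Qed.

Lemma separatedS J x y z : quasi_regular J -> separated J x y -> m z -> nzd J z ->
  separated (addgen J z) x y.
Proof.
move=> qJ [Jx Jy nx sJ] mz rz.
have Jz n w := quasi_regular_colon (n := n) (w := w) qJ rz.
have [hJ Jm _ _] := qJ; have [hI Im _ _] := quasi_regularS qJ mz rz.
split; [exact: addgen_sub|exact: addgen_sub| |].
- move=> H; apply: nx.
  have [||_ /(_ 0%N isT)] := isdec_coef hJ Jz hm Im (n := 1) (p := x%:P).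
  + split; first exact: leq_trans (size_polyC_leq1 _) _.
    move=> [_|[_|//]]; rewrite coefC ?powMT ?idealX1 //=.
  + by rewrite hornerC.
  + by rewrite coefC.
- move=> e p g h ep /(idealX_addgenP _ _ _ hJ)[P [sP JP] ->].
  move=> /(idealX_addgenP _ _ _ hJ)[R [sR JR] ->].
  pose S := y ^+ p *: P - x ^+ p *: R.
  have -> : y ^+ p * P.[z] - x ^+ p * R.[z] = S.[z].
    by rewrite /S hornerD hornerN !hornerZ.
  have JXP k u v : J u -> (k <= e)%N -> idealX J (e - k) v ->
      idealX J (e + p - k) (u ^+ p * v).
    move=> Ju ke Jv; have -> : (e + p - k = p + (e - k))%N by lia.
    by apply: idealX_mul => //; apply: idealX_expr.
  move=> H; have [|_ Hc] := isdec_coef hJ Jz hm Im (n := (e + p)%N) (p := S) _ H.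
    split.
      rewrite (leq_trans (size_polyD _ _)) // size_polyN geq_max; apply/andP; split.
        by rewrite (leq_trans (size_scale_leq _ _)) // (leq_trans sP) // ltnS leq_addr.
      by rewrite (leq_trans (size_scale_leq _ _)) // (leq_trans sR) // ltnS leq_addr.
    move=> i le; rewrite powMT coefB !coefZ.
    have [ie|ei] := leqP i e; last first.
      rewrite !nth_default ?mulr0 ?subr0 ?(leq_trans sR) ?(leq_trans sP) //.
      exact: ideal0 (idealX_ideal _ _).
    apply: (is_idealB (idealX_ideal _ _)); apply: JXP => //.
      by have := JP _ ie; rewrite powMT.
    by have := JR _ ie; rewrite powMT.
  apply/powM_addgenP => //; exists P => //; split=> // i ie.
  apply: (sJ _ p _ R`_i); first by lia.
  + by have := JP _ ie; rewrite powMT.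
  + by have := JR _ ie; rewrite powMT.
  + have := Hc i; rewrite coefB !coefZ.
    have -> : (e + p - i = e - i + p)%N by lia.
    by apply; lia.
Qed.

Lemma separated_gens J x y zs : quasi_regular J -> separated J x y -> regl J zs ->
  (forall z, z \in zs -> m z) ->
  quasi_regular (gens J zs) /\ separated (gens J zs) x y.
Proof.
elim: zs J => [//|z zs IH] J qJ sJ /= [rz rzs] mzs.
have mz : m z by apply: mzs; apply: mem_head.
apply: IH => //; [exact: quasi_regularS|exact: separatedS|].
by move=> w wzs; apply: mzs; rewrite inE wzs orbT.
Qed.

Lemma regl_forms x y zs : (forall z, z \in (x :: y :: zs) -> m z) ->
  regl [set 0] (x :: y :: zs) ->
  quasi_regular (gens [set 0] (x :: y :: zs)) /\ separated (gens [set 0] (x :: y :: zs)) x y.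
Proof.
move=> mzs /= [rx [ry rzs]].
have mx : m x by apply: mzs; apply: mem_head.
have my : m y by apply: mzs; rewrite !inE eqxx orbT.
have q0 := quasi_regular0; have qx := quasi_regularS q0 mx rx.
have qy := quasi_regularS qx my ry.
apply: separated_gens => //; last first.
  by move=> z zzs; apply: mzs; rewrite !inE zzs !orbT.
have hz := @is_ideal_zero A; have [hJ Jm _ _] := qx.
apply: separated_base => //; first exact: addgen_gen.
(* If x were in m (x), comparing ['X] with an expansion over m would put its coefficient 1 into
   m. *)
move=> H; apply: (local_proper locA).
have [||_ /(_ 1%N isT)] := isdec_coef hz (fun n w => quasi_regular_colon q0 rx) hm Jm
    (n := 1) (p := 'X).
- split; first by rewrite size_polyX.
  move=> [_|[_|//]]; rewrite coefX ?powMT //=.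
  exact: (ideal0 (idealX_ideal [set (0 : A)] 1)).
- by rewrite hornerX.
- by rewrite coefX powM0.
Qed.

End Forms.

(** * The asymptotic order *)

Section Levels.
Variables (A : comNzRingType) (I : set A).
Implicit Types (q i j e k : nat) (b z x y g : A).

(* elements of asymptotic I-order at least i / q *)
Definition lv q i : set A :=
  [set b | exists C, forall j, idealX I (i * j - C) (b ^+ (q * j))].

Lemma lv_expr q i b : lv q i b ->
  exists C, forall k, idealX I (i * (k %/ q) - C) (b ^+ k).
Proof.
move=> [C HC]; exists C => k; rewrite {2}(divn_eq k q) exprD [(k %/ q * q)%N]mulnC.
exact: ideal_mulr _ (idealX_ideal _ _) (HC _).
Qed.

(** In the binomial expansion the two exponents are divided by q with rounding; this costs at most
    one extra i, which the additive constant absorbs. *)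
Lemma lv_ideal q i : (0 < q)%N -> is_ideal (lv q i).
Proof.
move=> q0; have hX k := idealX_ideal I k; split.
- exists i => -[|j]; first by rewrite muln0.
  by rewrite expr0n muln_eq0 /= -leqn0 leqNgt q0; apply: ideal0 (hX _).
- move=> b b' /lv_expr[C HC] /lv_expr[C' HC']; exists (i + C + C')%N => j.
  rewrite exprDn; apply: is_ideal_sum => // r _; rewrite -mulr_natl.
  apply: (ideal_mull _ (hX _)); have rq := leq_ord r.
  apply: idealX_le (idealX_mul (HC (q * j - r)%N) (HC' r)).
  have := leq_divDl q (q * j - r)%N r; rewrite subnK // mulKn // => le.
  have : (i * j <= i * ((q * j - r) %/ q + r %/ q + 1))%N by rewrite leq_mul2l le orbT.
  rewrite !mulnDr muln1; lia.
- move=> c b [C HC]; exists C => j; rewrite exprMn.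
  exact: ideal_mull _ (hX _) (HC _).
Qed.

Lemma lv_le q i i' : (i <= i')%N -> lv q i' `<=` lv q i.
Proof.
move=> le b [C HC]; exists C => j; apply: idealX_le (HC j).
by apply: leq_sub2r; rewrite leq_mul2r le orbT.
Qed.

Lemma lv0 q b : lv q 0 b.
Proof. by exists 0%N => j; rewrite mul0n. Qed.

Lemma lv_mul q i i' b b' : lv q i b -> lv q i' b' -> lv q (i + i') (b * b').
Proof.
move=> [C HC] [C' HC']; exists (C + C')%N => j; rewrite exprMn.
by apply: idealX_le (idealX_mul (HC j) (HC' j)); rewrite mulnDl; lia.
Qed.

Lemma lv_exp q i b j : lv q i b -> lv q (i * j) (b ^+ j).
Proof.
move=> Lb; elim: j => [|j IH]; first by rewrite muln0; apply: lv0.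
by rewrite exprS mulnS; apply: lv_mul.
Qed.

Lemma lv_idealX q e b : idealX I e b -> lv q (q * e) b.
Proof.
move=> Ib; exists 0%N => j; rewrite subn0 -mulnA mulnCA.
exact: idealX_exprM.
Qed.

Lemma lv_root q i b j : (0 < j)%N -> lv q (i * j) (b ^+ j) -> lv q i b.
Proof.
move=> j0 [C HC]; exists (C + i * j)%N => k.
rewrite {2}(divn_eq k j) mulnDr exprD.
apply: (ideal_mulr _ (idealX_ideal _ _)).
have -> : (q * (k %/ j * j) = j * (q * (k %/ j)))%N by ring.
rewrite exprM; apply: idealX_le (HC _).
have : (i * k <= i * (k %/ j * j + j))%N.
  by rewrite leq_mul2l {1}(divn_eq k j) leq_add2l (ltnW (ltn_pmod _ _)) ?orbT.
rewrite mulnDr; have -> : (i * (k %/ j * j) = i * j * (k %/ j))%N by ring.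
lia.
Qed.

Lemma lv_comp q j i b : lv (q * j) i b <-> lv q i (b ^+ j).
Proof.
split=> -[C HC]; exists C => k; have := HC k;
  by rewrite -?exprM // mulnA [(j * q)%N]mulnC.
Qed.

(** * Leading forms over the fiber cone *)

Section Residue.
Variables (m : set A) (q : nat).
Hypotheses (q0 : (0 < q)%N) (noethA : noetherian A) (locA : is_local m)
  (mqI : idealX m q `<=` I) (qI : quasi_regular m I).

Let hI : is_ideal I. Proof. by case: qI. Qed.
Let hlv i : is_ideal (lv q i) := lv_ideal i q0.

(** This is the role of q: multiplication by m raises the level, so the quotients of successive
    levels form a graded module over the fiber cone of I. *)
Lemma lv_maximal : m `<=` lv q 1.
Proof.
move=> b mb; exists 0%N => j; rewrite subn0 mul1n exprM.
by apply: idealX_expr; apply: mqI; apply: idealX_expr.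
Qed.

Lemma lv_powM e k g z : powM I m e g -> lv q k z -> lv q (k + q * e).+1 (g * z).
Proof.
move=> + Lz; move: g; apply: idealM_mul_le => //.
move=> u v Iu mv; have := lv_mul (lv_mul (lv_idealX q Iu) (lv_maximal mv)) Lz.
by rewrite addn1 addnC addnS.
Qed.

Lemma powM_expr e g k : idealX I e g -> ~ powM I m e g -> ~ powM I m (e * k) (g ^+ k).
Proof.
move=> Ig ng; elim: k => [|k IH].
  by rewrite muln0 powM0; [apply: local_proper|apply: local_ideal].
rewrite mulnS exprS; apply: (quasi_regular_mul locA qI) => //.
exact: idealX_exprM.
Qed.

(** The powers of g remain nonzero in the fiber cone, hence cancel from the powers of g b modulo
    powers of I. *)
Lemma lv_cancel e i g b : idealX I e g -> ~ powM I m e g ->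
  lv q (i + q * e) (g * b) -> lv q i b.
Proof.
move=> Ig ng [C HC]; exists C => j; have := HC j; rewrite exprMn.
have [le|gt] := leqP C (i * j); last first.
  by move=> _; have -> : (i * j - C = 0)%N by lia.
have -> : ((i + q * e) * j - C = e * (q * j) + (i * j - C))%N.
  by rewrite mulnDl [(q * e)%N]mulnC mulnA; lia.
apply: (quasi_regular_cancel qI mqI); first exact: idealX_exprM.
exact: powM_expr.
Qed.

Definition mshift n k : set A :=
  if (k <= n)%N && (q %| n - k)%N then powM I m ((n - k) %/ q) else [set 0].

(* Triangular form of linear independence over the fiber cone of I in
   \bigoplus_i lv q i / lv q i.+1. *)
Fixpoint indep (T : seq (nat * A)) : Prop :=
  if T is (k, z) :: T' then
    (forall n g, shiftX q I n k g -> gspan q I (fun n => lv q n.+1) T' n (g * z) ->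
       mshift n k g) /\ indep T'
  else True.

Let Sp T n := gspan q I (fun n => lv q n.+1) T n.

Let hSp T n : is_ideal (Sp T n).
Proof. by apply: gspan_ideal => k; apply: hlv. Qed.

Let Sp_mul T n e g w : idealX I e g -> Sp T n w -> Sp T (n + q * e) (g * w).
Proof.
move=> Ig; apply: gspan_mul => //.
  move=> k x y; rewrite -{1}[I]idealX1 // => /(lv_idealX q) Lx Ly.
  by have := lv_mul Lx Ly; rewrite muln1 addnS addnC.
Qed.

(** A generator is kept if it is independent of those kept so far; otherwise the nonzero coefficient
    g of a relation is multiplied into d, which stays nonzero as the fiber cone is a domain. *)
Lemma lv_fgen_sub (l : seq (nat * A)) : (forall k z, (k, z) \in l -> lv q k z) ->
  exists T e d, [/\ forall k z, (k, z) \in T -> lv q k z, indep T, idealX I e d,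
    ~ powM I m e d & forall k z, (k, z) \in l -> Sp T (k + q * e) (d * z)].
Proof.
elim: l => [|[k z] l IH] Ll.
  exists [::], 0%N, 1; split=> //.
  by rewrite powM0; [apply: local_proper|apply: local_ideal].
have [|T [e [d [LT iT Id nd HT]]]] := IH.
  by move=> k' z' kl; apply: Ll; rewrite inE kl orbT.
have Lz := Ll _ _ (mem_head _ _).
have [ind|dep] := pselect (forall n g, shiftX q I n k g -> Sp T n (g * z) -> mshift n k g).
  exists ((k, z) :: T), e, d; split=> //.
    by move=> k' z'; rewrite inE => /orP[/eqP[-> ->]|/LT].
  move=> k' z'; rewrite inE => /orP[/eqP[-> ->]|/HT H]; last exact: gspan_cons.
  apply: gspan_mulgen; [by move=> n; apply: hlv|exact: mem_head|].
  by rewrite -[d]mulr1; apply: shiftX_mul => //; apply: shiftX1.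
have [n [g [Sg Hg ng]]] : exists n g, [/\ shiftX q I n k g, Sp T n (g * z) & ~ mshift n k g].
  apply: contrapT => H; apply: dep => n g Sg Hg; apply: contrapT => ng.
  by apply: H; exists n, g.
move: Sg ng; rewrite /shiftX /mshift; case: ifP => [/andP[kn qn] Ig ng|_ -> []] //.
have nE : n = (k + q * ((n - k) %/ q))%N by rewrite mulnC divnK // subnKC.
set e' := ((n - k) %/ q)%N in Ig ng nE.
exists T, (e + e')%N, (d * g); split=> //.
- exact: idealX_mul.
- exact: (quasi_regular_mul locA qI).
- move=> k' z'; rewrite inE => /orP[/eqP[-> ->]|/HT H].
    by rewrite -mulrA mulnDr addnCA addnC -nE; apply: Sp_mul.
  by rewrite [d * g]mulrC -mulrA mulnDr addnA; apply: Sp_mul.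
Qed.

(** Coordinates g of u and h of v satisfy y^p g = x^p h in the fiber cone. Since n < q p, the degree
    of g is below p, and separation of x and y makes g vanish. *)
Lemma indep_compare x y T n p u v : separated m I x y -> indep T ->
  (forall k z, (k, z) \in T -> lv q k z) -> (n < q * p)%N -> Sp T n u -> Sp T n v ->
  lv q (n + q * p).+1 (y ^+ p * u - x ^+ p * v) -> lv q n.+1 u.
Proof.
move=> [Ix Iy nx sI] + + np; have Ixp := idealX_expr p Ix; have Iyp := idealX_expr p Iy.
elim: T u v => [//|[k z] T IH] u v [ind iT] LT [g Sg Su'] [h Sh Sv'] Luv.
pose u' := u - g * z; pose v' := v - h * z; pose G := y ^+ p * g - x ^+ p * h.
have GE : G * z = (y ^+ p * u - x ^+ p * v) - (y ^+ p * u' - x ^+ p * v').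
  by rewrite /G /u' /v'; ring.
have SG : shiftX q I (n + q * p) k G.
  by apply: is_idealB; [apply: shiftX_ideal|apply: shiftX_mul|apply: shiftX_mul].
have mG : mshift (n + q * p) k G.
  apply: ind => //; rewrite GE; apply: is_idealB; first exact: hSp.
    by apply: gspan_base; exact: Luv.
  by apply: is_idealB; [apply: hSp|apply: Sp_mul|apply: Sp_mul].
have Lz := LT _ _ (mem_head _ _).
have LT' k' z' : (k', z') \in T -> lv q k' z'.
  by move=> kT; apply: LT; rewrite inE kT orbT.
have [LGz Lgz] : lv q (n + q * p).+1 (G * z) /\ lv q n.+1 (g * z).
  move: Sg Sh mG; rewrite /shiftX /mshift /G.
  case: ifP => [/andP[kn qn] Ig Ih|_ -> -> _]; last first.
    by rewrite !mulr0 subr0 mul0r; split; apply: ideal0 (hlv _).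
  rewrite (leq_trans kn (leq_addr _ _)) -addnBAC //= dvdn_addl ?dvdn_mulr // qn.
  rewrite divnDr ?dvdn_mulr // mulKn // => mG.
  have nE : (k + q * ((n - k) %/ q) = n)%N by rewrite mulnC divnK // subnKC.
  split; first by have := lv_powM mG Lz; rewrite mulnDr addnA nE.
  have /lv_powM/(_ Lz) : powM I m ((n - k) %/ q) g.
    apply: sI mG => //; rewrite ltn_divLR // mulnC; apply: leq_ltn_trans np.
    exact: leq_subr.
  by rewrite nE.
have Lu' : lv q n.+1 u'.
  apply: (IH u' v') => //.
  have -> : y ^+ p * u' - x ^+ p * v' = (y ^+ p * u - x ^+ p * v) - G * z.
    by rewrite GE; ring.
  exact: is_idealB.
by rewrite -(subrK (g * z) u); apply: ideal_add.
Qed.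

End Residue.
End Levels.

(** * Itoh's theorem *)

Section Core.
Variables (A : comNzRingType) (m a I : set A) (F : nat -> set A) (c n0 N q0 s : nat)
  (x y : A).
Hypotheses (noethA : noetherian A) (locA : is_local m) (qI : quasi_regular m I)
  (sI : separated m I x y) (s0 : (0 < s)%N) (Ias : I `<=` idealX a s)
  (mI : idealX m q0 `<=` I) (Fdec : forall n, F n.+1 `<=` F n)
  (Fa : forall n, F (n + c) `<=` idealX a n)
  (FX : forall n b j, F n b -> F (n * j) (b ^+ j))
  (ic : forall n b C, (0 < n)%N -> (N <= n)%N ->
     (forall j, idealX a (n * j - C) (b ^+ j)) -> F n b)
  (FI : forall j, F (n0 + s * j) `<=` idealX I j).

Let hI : is_ideal I. Proof. by case: qI. Qed.

Let Fle n p : (n <= p)%N -> F p `<=` F n.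
Proof. exact: decreasing_sub. Qed.

Let Ia k : idealX I k `<=` idealX a (s * k).
Proof. by rewrite idealXM; apply: idealXS. Qed.

Lemma lv_filt q i b : (0 < i)%N -> (N <= s * i)%N -> lv I q i b -> F (s * i) (b ^+ q).
Proof.
move=> i0 Nsi [C HC]; apply: (@ic _ _ (s * C)%N) => // [|j].
  by rewrite muln_gt0 s0.
rewrite -exprM; apply: idealX_le (Ia (HC j)); rewrite mulnBr; lia.
Qed.

(** The loss is independent of b, q and i: the asymptotic order makes b integral over a power of a,
    so b lies in F_(s i'), which is contained in a power of I. Finite generation of the levels rests
    on this uniformity. *)
Lemma lv_sub q i b : (0 < q)%N -> lv I q i b -> idealX I (i %/ q - (n0 + N)) b.
Proof.
move=> q_gt0 Lb; set i' := (i %/ q)%N.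
have [gt|le] := leqP i' (n0 + N).
  by have -> : (i' - (n0 + N) = 0)%N by lia.
have [C HC] := lv_expr Lb.
have : F (s * i') b.
  apply: (@ic _ _ (s * (i' * q + C))%N) => // [||j].
  - by rewrite muln_gt0 s0; lia.
  - by apply: (@leq_trans i'); [lia|apply: leq_pmull].
  apply: idealX_le (Ia (HC j)).
  have h1 : (i' * q <= i)%N by apply: leq_trunc_div.
  have h2 : (j <= j %/ q * q + q)%N.
    by rewrite {1}(divn_eq j q) leq_add2l ltnW // ltn_pmod.
  have h3 : (i' * j <= i * (j %/ q) + i' * q)%N.
    apply: (@leq_trans (i' * (j %/ q * q + q))); first by rewrite leq_mul2l h2 orbT.
    rewrite mulnDr leq_add2r mulnA mulnAC [(i * _)%N]mulnC mulnC leq_mul2l.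
    by rewrite h1 orbT.
  have h4 : (i' * j - (i' * q + C) <= i * (j %/ q) - C)%N by lia.
  rewrite -mulnA -mulnBr leq_mul2l; apply/orP; right; exact: h4.
move=> Fb; apply: FI; apply: Fle Fb.
have -> : (s * i' = s * (i' - (n0 + N)) + s * (n0 + N))%N by rewrite -mulnDr subnK // ltnW.
have : (n0 <= s * (n0 + N))%N.
  by apply: (@leq_trans (n0 + N)); [lia|apply: leq_pmull].
lia.
Qed.

Section FixedDenominator.
Variable q : nat.
Hypotheses (q_gt0 : (0 < q)%N) (mqI : idealX m q `<=` I).

Let hlv i : is_ideal (lv I q i) := lv_ideal I i q_gt0.

(** In each residue class modulo q the levels, shifted by the uniform loss [k0], form a graded
    family over the Rees algebra of I; there are finitely many classes. *)
Lemma lv_stable : exists i0, forall i, (i0 <= i)%N ->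
  lv I q (i + q) `<=` idealM I (lv I q i).
Proof.
pose k0 := (n0 + N)%N.
have residue r : (r < q)%N -> exists n1, forall n, (n1 <= n)%N ->
    lv I q (q * (n.+1 + k0) + r) `<=` idealM I (lv I q (q * (n + k0) + r)).
  move=> rq; pose L n := lv I q (q * (n + k0) + r).
  have FL : graded_family I [set 0] L.
    split=> [n|n _ ->|n b Lb|n u b Iu Lb].
    - exact: hlv.
    - exact: ideal0 (hlv _).
    - apply: idealD_subl; first exact: is_ideal_zero.
      have := lv_sub q_gt0 Lb; rewrite mulnC divnMDl // divn_small // addn0.
      by rewrite addnK.
    - have Lu : lv I q q u by rewrite -{2}[q]muln1; apply: lv_idealX; rewrite idealX1.
      by have := lv_mul Lu Lb; rewrite /L addSn mulnS addnA.
  have [n1 Hn1] := graded_family_stable noethA hI (@is_ideal_zero A) FL.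
  exists n1 => n /Hn1 H b /H [f If /= /eqP]; rewrite subr_eq0 => /eqP ->.
  exact: If.
have [n1 Hn1] : exists n1, forall r, (r < q)%N -> forall n, (n1 <= n)%N ->
    lv I q (q * (n.+1 + k0) + r) `<=` idealM I (lv I q (q * (n + k0) + r)).
  suff : forall k, (k <= q)%N -> exists n1, forall r, (r < k)%N -> forall n, (n1 <= n)%N ->
      lv I q (q * (n.+1 + k0) + r) `<=` idealM I (lv I q (q * (n + k0) + r)) by exact.
  elim=> [|k IH] kq; first by exists 0%N.
  have [n1 Hn1] := IH (ltnW kq); have [n2 Hn2] := residue _ kq.
  exists (n1 + n2)%N => r; rewrite ltnS leq_eqVlt => /orP[/eqP ->|/Hn1 H] n le.
    by apply: (Hn2 n); apply: leq_trans le; apply: leq_addl.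
  by apply: (H n); apply: leq_trans le; apply: leq_addr.
exists (q * (n1 + k0))%N => i le; have rq := ltn_pmod i q_gt0.
have le' : (n1 + k0 <= i %/ q)%N by rewrite leq_divRL // mulnC.
have le'' : (n1 <= i %/ q - k0)%N by lia.
move: (Hn1 _ rq _ le'').
have -> : ((i %/ q - k0).+1 + k0 = (i %/ q).+1)%N by lia.
have -> : (i %/ q - k0 + k0 = i %/ q)%N by lia.
have -> : (q * (i %/ q).+1 + i %% q = i + q)%N by rewrite {3}(divn_eq i q) mulnS [(q * _)%N]mulnC; lia.
have -> : (q * (i %/ q) + i %% q = i)%N by rewrite mulnC -divn_eq.
by [].
Qed.

Lemma lv_fgen : exists l : seq (nat * A), (forall k z, (k, z) \in l -> lv I q k z) /\
  forall i, lv I q i `<=` gspan q I (fun=> [set 0]) l i.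
Proof.
have [i0 Hi0] := lv_stable; have hz := @is_ideal_zero A.
have gI l i : is_ideal (gspan q I (fun=> [set 0]) l i) by apply: gspan_ideal.
have [l [lL Hl]] : exists l : seq (nat * A), (forall k z, (k, z) \in l -> lv I q k z) /\
    forall i, (i < i0 + q)%N -> lv I q i `<=` gspan q I (fun=> [set 0]) l i.
  elim: (i0 + q)%N => [|i1 [l [lL Hl]]]; first by exists [::].
  have [t tE] := noethA (hlv i1).
  exists ([seq (i1, z) | z <- t] ++ l); split.
    move=> k z; rewrite mem_cat => /orP[/mapP[w wt [-> ->]]|/lL //].
    by rewrite tE; apply: ideal_gen_in.
  move=> i; rewrite ltnS leq_eqVlt => /orP[/eqP ->|/Hl H].
    rewrite {1}tE; apply: ideal_genP => // z /= zt; apply: gspan_gen => //.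
    by rewrite mem_cat map_f.
  apply: subset_trans H _; apply: gspan_le => // [_ ->|k z g kl Sg].
    exact: ideal0.
  by apply: gspan_mulgen Sg => //; rewrite mem_cat kl orbT.
exists l; split=> //; elim/ltn_ind => i IH.
have [/Hl //|le] := ltnP i (i0 + q).
have -> : i = ((i - q) + q)%N by lia.
apply: (subset_trans (Hi0 _ _)); first by lia.
apply: idealM_sub => // u b Iu /(IH (i - q)%N) Sb.
rewrite -[X in (_ + X)%N]muln1; apply: gspan_mul => //.
- by move=> n v w _ ->; rewrite mulr0.
- by rewrite idealX1.
- by apply: Sb; lia.
Qed.

(* If b1^j had level i_j < j (T - 1) for all j, then b1^j y^(kj) and b2^j x^(kj)
   would have the same leading form, for arbitrarily large j; multiplied by d
   this gives a form of negative degree in the free module spanned by Tl. *)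
Lemma lv_no_pole b1 b2 k T : (0 < T)%N -> (T <= q * k)%N ->
  lv I q (T + q * k) (b1 * y ^+ k - b2 * x ^+ k) -> lv I q T.-1 b1.
Proof.
move=> T0 Tqk Lf; apply: contrapT => nb1; have [Ix Iy nx _] := sI.
have [l [lL Hl]] := lv_fgen.
have [Tl [e [d [LT iT Id nd HT]]]] := lv_fgen_sub q_gt0 locA qI lL.
pose Sp n := gspan q I (fun n => lv I q n.+1) Tl n.
have hSp n : is_ideal (Sp n) by apply: gspan_ideal => k'; apply: hlv.
have dSp i b : lv I q i b -> Sp (i + q * e)%N (d * b).
  move=> /Hl; rewrite mulrC.
  apply: (gspan_le (K := [set w | Sp (i + q * e)%N (w * d)])).
  - exact: colon_ideal.
  - by move=> _ -> /=; rewrite mul0r; apply: ideal0.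
  move=> k' z g kl; rewrite /shiftX; case: ifP => [/andP[ki qi] Ig|_ ->] /=; last first.
    by rewrite !mul0r; apply: ideal0.
  have iE : (i = k' + q * ((i - k') %/ q))%N by rewrite mulnC divnK // subnKC.
  have -> : (i + q * e = k' + q * e + q * ((i - k') %/ q))%N by lia.
  rewrite -mulrA [z * d]mulrC; apply: gspan_mul => //; last exact: HT.
  move=> n u w; rewrite -{1}[I]idealX1 // => /(lv_idealX q) Lu Lw.
  by have := lv_mul Lu Lw; rewrite muln1 addnS addnC.
(* A missing level in b1 costs at least j levels in b1^j, more than the q e levels gained from d; so
   d b1^j has level below j T <= q p. *)
pose j := (q * e).+1; pose p := (k * j)%N.
have [i [Li [nLi ij]]] : exists i, lv I q i (b1 ^+ j) /\ ~ lv I q i.+1 (b1 ^+ j) /\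
    (i < j * T.-1)%N.
  have [|n [nLn Ln]] := @nat_least (fun n => ~ lv I q n (b1 ^+ j)).
    by exists (T.-1 * j)%N => /(lv_root (isT : (0 < j)%N)).
  have le : (n <= T.-1 * j)%N.
    rewrite leqNgt; apply/negP => /Ln; apply=> /(lv_root (isT : (0 < j)%N)).
    exact: nb1.
  case: n nLn Ln le => [nL0|n nLn Ln le]; first by case: nL0; apply: lv0.
  exists n; split; first by apply: contrapT; apply: Ln.
  by split=> //; rewrite mulnC.
have Tj : (j * T.-1 = j * T - j)%N by rewrite -subn1 mulnBr muln1.
have jT : (j <= j * T)%N by apply: leq_pmulr.
have qkj : (j * T <= q * p)%N by rewrite mulnA [(j * _)%N]mulnC leq_mul2r Tqk.
pose lam := (i + q * p)%N.
pose X := b1 * y ^+ k; pose Y := b2 * x ^+ k; pose f := X - Y.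
have LX : lv I q lam (X ^+ j).
  rewrite exprMn -exprM; apply: lv_mul => //; apply: lv_idealX.
  exact: idealX_expr.
have Lfj : lv I q ((T + q * k) * j) (f ^+ j) by apply: lv_exp.
have TqkE : ((T + q * k) * j = j * T + q * p)%N by rewrite mulnDl mulnC mulnA.
have hlv' i' : is_ideal (lv I (q * j) i') by apply: lv_ideal; rewrite muln_gt0 q_gt0.
(* Level [lam] of a j-th power for denominator q is level [lam] of the base for denominator q j,
   where levels are closed under subtraction. *)
have LY : lv I q lam (Y ^+ j).
  rewrite -lv_comp; have -> : Y = X - f by rewrite /f; ring.
  apply: is_idealB; rewrite ?lv_comp //; apply: lv_le Lfj.
  by rewrite TqkE leq_add2r; lia.
have Lpow u k' : lv I q lam (u ^+ j) -> lv I q (lam * k') ((u ^+ k') ^+ j).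
  by move=> Lu; rewrite exprAC; apply: lv_exp.
(* X - Y = f is a factor of X^j - Y^j. Each term is estimated through its j-th power, whose level is
   at least j (lam + 1) because i + j <= j T. *)
have Ldiff : lv I q lam.+1 (X ^+ j - Y ^+ j).
  rewrite subrXX mulr_sumr; apply: is_ideal_sum => // r _.
  apply: (lv_root (j := j)) => //; rewrite exprMn exprMn.
  apply: lv_le (lv_mul Lfj (lv_mul (Lpow X (j.-1 - r)%N LX) (Lpow Y r LY))).
  have rj := leq_ord r; rewrite -mulnDr subnK // TqkE mulSn [(lam * j)%N]mulnC.
  have -> : (j * lam = lam + lam * j.-1)%N by rewrite mulnC -mulnS.
  by rewrite addnA leq_add2r /lam; lia.
have Lx : lv I q i (b2 ^+ j).
  apply: (@lv_cancel _ _ _ _ q_gt0 locA mqI qI p i (x ^+ p)).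
  - exact: idealX_expr.
  - have := @powM_expr _ _ _ locA qI 1 x p; rewrite mul1n; apply=> //.
    by rewrite idealX1.
  - by move: LY; rewrite /Y exprMn -exprM mulrC.
apply: nLi; apply: (lv_cancel q_gt0 locA mqI qI Id nd).
rewrite addSn; apply: (indep_compare q_gt0 mqI qI sI iT LT (p := p) _ (dSp _ _ Li) (dSp _ _ Lx)).
  by rewrite /j; lia.
have -> : y ^+ p * (d * b1 ^+ j) - x ^+ p * (d * b2 ^+ j) = d * (X ^+ j - Y ^+ j).
  by rewrite /X /Y !exprMn -!exprM -/p; ring.
have := lv_mul (lv_idealX q Id) Ldiff.
by have -> : (q * e + lam.+1 = (i + q * e + q * p).+1)%N by rewrite /lam; lia.
Qed.

End FixedDenominator.

(* Itoh: (x^k, y^k) :&: F_(tk + sk) = x^k F_(tk) + y^k F_(tk) for t <= s. *)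
Lemma filt_no_pole b1 b2 k t : (0 < k)%N -> (0 < t <= s)%N -> (N <= t * k)%N ->
  F (t * k + s * k) (b1 * y ^+ k - b2 * x ^+ k) -> F (t * k) b1.
Proof.
move=> k0 /andP[t0 ts] Ntk Ff; have tk0 : (0 < t * k)%N by rewrite muln_gt0 t0.
pose q1 := (q0 + N + c + 2)%N; pose w := (t * k)%N.
have wr r : (r <= r * w)%N by apply: leq_pmulr.
have ws e : (e <= s * e)%N by apply: leq_pmull.
(* With denominator s r the I-order of b1 falls short of w / s by at most 1 / (s r). Taking r = j /
   s below, the loss for b1^j stays bounded as j grows. *)
have level r : (q1 <= r)%N -> lv I (s * r) (r * w).-1 b1.
  move=> q1r; have r0 : (0 < r)%N by rewrite /q1 in q1r; lia.
  have sr0 : (0 < s * r)%N by rewrite muln_gt0 s0.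
  have q0r : (q0 <= s * r)%N by apply: leq_trans (ws r); rewrite /q1 in q1r; lia.
  have mqI : idealX m (s * r) `<=` I by apply: subset_trans mI; apply: idealX_le.
  apply: (@lv_no_pole _ sr0 mqI b1 b2 k).
  - by rewrite muln_gt0 r0.
  - by rewrite mulnA leq_mul2r [(s * r)%N]mulnC leq_mul2l ts !orbT.
  - exists n0 => j; have := FX (s * r * j) Ff.
    have -> : ((t * k + s * k) * (s * r * j) = s * ((r * w + s * r * k) * j))%N.
      by rewrite /w; ring.
    move: ((_ + _) * j)%N => e Fe; have [le|gt] := leqP n0 e; last first.
      by have -> : (e - n0 = 0)%N by lia.
    apply: FI; apply: Fle Fe; have := ws n0.
    have : (s * e = s * (e - n0) + s * n0)%N by rewrite -mulnDr subnK.
    lia.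
pose C := (w * s * q1.+1 + s + c)%N.
apply: (@ic _ _ C) => // j; pose r := (j %/ s)%N.
have js : (w * j <= w * s * r.+1)%N.
  by rewrite -mulnA leq_mul2l [(s * _)%N]mulnC ltnW ?orbT // ltn_ceil.
have [rq1|q1r] := ltnP r q1.
  have -> : (t * k * j - C = 0)%N; last by [].
  have : (w * s * r.+1 <= w * s * q1.+1)%N by rewrite leq_mul2l ltnS ltnW ?orbT.
  by rewrite /C -/w; lia.
have Lr := level r q1r.
have rw : (N + c + 1 <= (r * w).-1)%N by have := wr r; rewrite /q1 in q1r; lia.
have Fr : F (s * (r * w).-1) (b1 ^+ (s * r)).
  by apply: lv_filt Lr; have := ws (r * w).-1; lia.
have Fr' : F ((s * (r * w).-1 - c) + c) (b1 ^+ (s * r)).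
  by apply: Fle Fr; have := ws (r * w).-1; lia.
rewrite (divn_eq j s) exprD -/r; apply: (ideal_mulr _ (idealX_ideal _ _)).
rewrite [(r * s)%N]mulnC; apply: idealX_le (Fa Fr').
have h : (s * (r * w).-1 = w * s * r - s)%N.
  by rewrite -subn1 mulnBr muln1; congr (_ - _)%N; ring.
have jE : (s * r + j %% s = j)%N by rewrite mulnC -divn_eq.
rewrite jE h /C -/w; move: js; rewrite !mulnS.
have : (w * s <= w * s * q1.+1)%N by apply: leq_pmulr.
rewrite mulnS; lia.
Qed.

End Core.

(** * Associated graded modules of Veronese filtrations *)

Lemma radical_ideal (A : comNzRingType) (I : set A) : is_ideal I -> is_ideal (radical I).
Proof.
move=> hI; split.
- by exists 1%N; apply: ideal0.
- move=> x y [n Ix] [k Iy]; exists (n + k)%N.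
  rewrite exprDn; apply: is_ideal_sum => // i _; rewrite -mulr_natl.
  apply: (ideal_mull _ hI); have [ki|ik] := leqP k i.
    by apply: (ideal_mull _ hI); rewrite -(subnK ki) exprD; apply: ideal_mull.
  apply: (ideal_mulr _ hI); have -> : (n + k - i = (k - i) + n)%N by lia.
  by rewrite exprD; apply: ideal_mull.
- by move=> c x [n Ix]; exists n; rewrite exprMn; apply: ideal_mull.
Qed.

Lemma idealD0 (A : comNzRingType) (J : set A) : idealD J [set 0] = J.
Proof.
apply/seteqP; split=> [w [f Jf /= /eqP]|w Jw]; first by rewrite subr_eq0 => /eqP ->.
by exists w; rewrite //= subrr.
Qed.

Section FiltrationColon.
Variables (A : comNzRingType) (F : nat -> set A).
Hypothesis (hF : forall n, is_ideal (F n)).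
Implicit Types (Q : set A) (x y z w : A).

Lemma colon_expr Q x s n0 v n z :
  (forall n z, (n0 <= n)%N -> idealD (F (n + s)) Q (x * z) -> idealD (F n) Q z) ->
  (n0 <= n)%N -> idealD (F (n + v * s)) Q (x ^+ v * z) -> idealD (F n) Q z.
Proof.
move=> Hx; elim: v n z => [|v IH] n z le; first by rewrite addn0 expr0 mul1r.
rewrite mulSn addnCA addnC exprS -mulrA => H.
apply: (IH _ _ le); apply: Hx H; exact: leq_trans le (leq_addr _ _).
Qed.

(** Modulo x1, c is some f in F_n; in c = f + x1 d the cofactor d satisfies the same relation with p
    - 1 for p and n - s1 for n. The bound on n leaves room for all p divisions. *)
Lemma colon_mod_expr x1 y s1 t n1 n2 p n c e :
  (forall n z, (n1 <= n)%N -> F (n + s1) (x1 * z) -> F n z) ->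
  (forall n z, F n z -> F (n + t) (y * z)) ->
  (forall n z, F n z -> F (n + s1) (x1 * z)) ->
  (forall n z, (n2 <= n)%N -> idealD (F (n + t)) (addgen [set 0] x1) (y * z) ->
     idealD (F n) (addgen [set 0] x1) z) ->
  (n1 + n2 + p * s1 <= n)%N ->
  F (n + t) (y * c - x1 ^+ p * e) -> exists b, F n (c - x1 ^+ p * b).
Proof.
move=> Hx Fy Fx Hy; elim: p n c e => [|p IH] n c e le Fc.
  by exists c; rewrite expr0 mul1r subrr; apply: ideal0.
have [f Ff [d /eqP]] : idealD (F n) (addgen [set 0] x1) c.
  apply: Hy; first by lia.
  exists (y * c - x1 ^+ p.+1 * e) => //; exists (x1 ^+ p * e).
  by rewrite exprS /=; ring.
rewrite subr_eq0 => /eqP cE.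
rewrite mulSn in le.
have [||b Fb] := IH (n - s1)%N d e; first by lia.
  apply: Hx; first by lia.
  have -> : (n - s1 + t + s1 = n + t)%N by lia.
  have -> : x1 * (y * d - x1 ^+ p * e) = (y * c - x1 ^+ p.+1 * e) - y * f.
    by rewrite -(subrK f c) cE exprS; ring.
  by apply: is_idealB => //; apply: Fy.
exists b; have -> : c - x1 ^+ p.+1 * b = f + x1 * (d - x1 ^+ p * b).
  by rewrite -(subrK f c) cE exprS; ring.
apply: ideal_add => //; have /Fx := Fb; rewrite subnK //; lia.
Qed.

End FiltrationColon.

(** * The regular pair in the Veronese subfiltrations *)

Section Main.
Variables (A : comNzRingType) (m a : set A) (F : filtration a).
Hypotheses (noethA : noetherian A) (locA : is_local m) (cmA : cohen_macaulay m)
  (dimA : krull_dim_ge A 2) (prim : is_primary_to m a) (asF : asymptotic_ic_filtration F).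

Let ha : is_ideal a. Proof. by case: prim. Qed.
Let am : a `<=` m.
Proof. by case: prim => _ _ _ <- z az; exists 1%N. Qed.

Let hF n : is_ideal (F n) := filt_ideal F n.

Let FMX e n z w : F e z -> F n w -> F (e + n)%N (z * w).
Proof. by move=> Fz Fw; apply: (@filt_mul _ _ F); apply: idealM_mul. Qed.

Let FX n b j : F n b -> F (n * j)%N (b ^+ j).
Proof.
move=> Fb; elim: j => [|j IH]; first by rewrite muln0 filt0.
by rewrite exprS mulnS; apply: FMX.
Qed.

Lemma stable_sub_idealX : exists c, forall n, F (n + c)%N `<=` idealX a n.
Proof.
have [[_ [c Hc]] _] := asF; exists c; elim=> [//|n IH].
by rewrite addSn -Hc ?leq_addl //; apply: idealMS.
Qed.

(* The pair (x^k, y^k) induces a regular sequence of degree s on the associated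
   graded module of the k-th Veronese subfiltration. *)
Lemma veronese_regular_pair : exists s x y k0, [/\ (0 < s)%N, idealX a s x, idealX a s y &
  forall k, (0 < k)%N -> (k0 <= k)%N ->
    (forall n z, F ((n + s) * k)%N (x ^+ k * z) -> F (n * k)%N z) /\
    (forall n z w, (0 < n)%N -> F ((n + s) * k)%N (y ^+ k * z - x ^+ k * w) ->
       exists b, F (n * k)%N (z - x ^+ k * b))].
Proof.
have hz := @is_ideal_zero A; have [_ [N icN]] := asF.
have [c Fa] := stable_sub_idealX.
have [q maq] : exists q, idealX m q `<=` a.
  apply: (idealX_radical noethA (local_ideal locA) ha).
  by move=> z; case: prim => _ _ _ <-.
have FM n z w : a z -> F n w -> F n.+1 (z * w).
  by move=> az; rewrite -add1n; apply: FMX; apply: (@filt_base _ _ F).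
have [l [Sl nsf]] := supseq_exists noethA locA ha am maq hF (@filt_decr _ _ F) FM
  (filt_idealX F) Fa.
have ml z : z \in unzip2 l -> m z := supseq_local ha am Sl.
have rl := supseq_regl Sl.
have rad := cm_gens_radical noethA locA cmA ml rl nsf.
(* With at most one term, a regular sequence of length 2, which exists as the depth is at least 2,
   would be longer and make the quotient socle free. *)
have size_l : (1 < size l)%N.
  rewrite ltnNge; apply/negP => le; apply: nsf.
  have [ys [sys mys rys]] := depth_ge_regl ((cmA 2).2 dimA).
  by apply: regl_longer_socle_free ml mys rl rys _ => //; rewrite size_map sys.
(* A common multiple of the degrees: the power of x_i with exponent S / s_i has degree S. *)
pose S := (\prod_(p <- l) p.1)%N.
pose l2 := [seq ((S %/ p.1)%N, p.2) | p <- l].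
pose zs := [seq p.2 ^+ p.1 | p <- l2].
pose I := gens [set 0] zs.
have hI : is_ideal I by apply: gens_ideal.
have lS p : p \in l -> (0 < p.1)%N /\ (S %/ p.1 * p.1 = S)%N.
  move=> pl; have [p0 _] := supseq_mem Sl pl; split=> //; apply: divnK.
  by rewrite /S (big_rem _ pl) /= dvdn_mulr.
have S0 : (0 < S)%N.
  rewrite /S big_seq; elim/big_ind: _ => // [u v|p pl]; first by rewrite muln_gt0 => -> ->.
  by have [] := supseq_mem Sl pl.
have u0 p : p \in l -> (0 < S %/ p.1)%N.
  by move=> pl; have [p0 pS] := lS _ pl; move: S0; rewrite -{1}pS muln_gt0 => /andP[].
have unzip_l2 : unzip2 l2 = unzip2 l by rewrite /unzip2 -map_comp; apply: eq_map.
have rzs : regl [set 0] zs by apply: regl_pow; rewrite ?unzip_l2.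
have zsE : zs = [seq p.2 ^+ (S %/ p.1) | p <- l] by rewrite /zs -map_comp.
have aS p : p \in l -> idealX a S (p.2 ^+ (S %/ p.1)).
  move=> pl; have [_ pS] := lS _ pl; have [_ ap] := supseq_mem Sl pl.
  by rewrite -{1}pS mulnC; apply: idealX_exprM.
have Izs p : p \in l -> I (p.2 ^+ (S %/ p.1)).
  by move=> pl; apply: gens_mem => //; rewrite zsE; apply: map_f.
have zsa z : z \in zs -> idealX a S z.
  by rewrite zsE => /mapP[p pl ->]; apply: aS.
have Ias : I `<=` idealX a S.
  apply: gens_le => //; first exact: idealX_ideal.
  by move=> _ ->; apply: ideal0 (idealX_ideal _ _).
have Sm : idealX a S `<=` m.
  by apply: subset_trans am; case: (S) S0 => // S' _; apply: idealX_subI.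
have mzs z : z \in zs -> m z by move=> /zsa; apply: Sm.
have [q0 mI] : exists q0, idealX m q0 `<=` I.
  apply: (idealX_radical noethA (local_ideal locA) hI) => g mg.
  have [n Gg] := rad _ mg.
  suff /(_ _ Gg)[k Ik] : gens [set 0] (unzip2 l) `<=` radical I.
    by exists (n * k)%N; rewrite exprM.
  apply: gens_le; first exact: radical_ideal.
    by move=> _ ->; exists 1%N; apply: ideal0.
  by move=> _ /mapP[p pl ->]; exists (S %/ p.1)%N; apply: Izs.
have [q1 mG] := idealX_radical noethA (local_ideal locA) (gens_ideal (unzip2 l) hz) rad.
have [n0 FI] : exists n0, forall j, F (n0 + S * j)%N `<=` idealX I j.
  apply: filt_sub_powers; apply: (red_powers hF (@filt_decr _ _ F) FM (l := l) hI).
    move=> p pl; have [_ ap] := supseq_mem Sl pl; split=> //.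
    by exists (S %/ p.1)%N; [case: (lS _ pl)|apply: Izs].
  have [n0 Hred] := supseq_red hF (@filt_decr _ _ F) FM hz Sl.
  exists (n0 + (q1 + c))%N => n le z Fz.
  (* For large n, F_n lies in a power of m contained in the ideal of the sequence, so the reduction
     applies to all of F_n. *)
  have Gz : gens [set 0] (unzip2 l) z.
    apply: mG; apply: (idealXS am); apply: Fa; apply: filt_le Fz.
    exact: leq_trans (leq_addl _ _) le.
  have [r Rr /= /eqP] := Hred n (leq_trans (leq_addr _ _) le) _ Fz Gz.
  rewrite subr_eq0 => /eqP ->; exists 0; last by rewrite subr0.
  exact: ideal0 (idealM_ideal _ _).
have ic n b C : (0 < n)%N -> (N <= n)%N ->
    (forall j, idealX a (n * j - C) (b ^+ j)) -> F n b.
  move=> n_gt0 Nn H; rewrite (icN _ Nn). exact: (int_closure_asymp noethA n_gt0 H).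
case: l @S @l2 @zs @I Sl size_l lS S0 u0 zsE aS Izs rzs zsa Ias mzs mI FI hI
  {nsf ml rl rad mG Sm unzip_l2} => [//|[s1 x1] [//|[s2 x2] l]] S l2 zs I Sl _ lS S0 u0
  zsE aS Izs rzs zsa Ias mzs mI FI hI.
have [_ us1] := lS (s1, x1) (mem_head _ _).
have l_x2 : (s2, x2) \in [:: (s1, x1), (s2, x2) & l] by rewrite inE mem_head orbT.
have [_ us2] := lS (s2, x2) l_x2; rewrite /= in us1 us2.
have [qI sI] : quasi_regular m I /\ separated m I (x1 ^+ (S %/ s1)) (x2 ^+ (S %/ s2)).
  by rewrite /I; move: rzs mzs; rewrite zsE /= => rzs mzs; apply: regl_forms.
have ax := aS _ (mem_head _ _); have ay := aS _ l_x2; rewrite /= in ax ay.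
move: Sl => /= [s1_gt0 ax1 _ [n1 H1] [s2_gt0 ax2 _ [n2 H2] _]].
exists S, (x1 ^+ (S %/ s1)), (x2 ^+ (S %/ s2)), (N + n1 + n2)%N; split=> // k k_gt0 k0k.
rewrite -!exprM; split.
  (* Degree 0 is trivial as F_0 = A; in positive degrees n k >= k is beyond the threshold [n1] of
     superficiality. *)
  move=> [|n] z; first by rewrite mul0n filt0.
  rewrite mulnDl -{1}us1 mulnAC -[F (_ * k)%N]idealD0 -[F (_ + _)%N]idealD0.
  apply: (colon_expr H1); apply: leq_trans (leq_pmull k (ltn0Sn n)); lia.
move=> n z w n_gt0; have kn : (k <= n * k)%N by apply: leq_pmull.
rewrite mulnDl; have [nS|Sn] := leqP n S => Fz.
  exists 0; rewrite mulr0 subr0.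
  apply: (filt_no_pole noethA locA qI sI S0 Ias mI (@filt_decr _ _ F) Fa FX ic FI
    (b2 := w) k_gt0) => //.
  - by rewrite n_gt0.
  - by apply: leq_trans kn; lia.
  - by rewrite -!exprM [z * _]mulrC [w * _]mulrC.
have pk : (S %/ s1 * k * s1 = S * k)%N by rewrite mulnAC us1.
apply: (colon_mod_expr hF (s1 := s1) (n1 := n1) (n2 := n2) _ _ _ _ _ Fz).
- by move=> i b n1i; rewrite -[F (_ + _)%N]idealD0 => /(H1 _ _ n1i); rewrite idealD0.
- move=> i b Fb; rewrite addnC; apply: FMX => //.
  by rewrite -{1}us2 mulnAC mulnC; apply: FX; apply: filt_idealX.
- by move=> i b Fb; rewrite addnC; apply: FMX => //; apply: filt_idealX.
- move=> i b n2i; rewrite -{1}us2 mulnAC; exact: colon_expr H2 n2i.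
- rewrite pk; have : (S.+1 * k <= n * k)%N by rewrite leq_mul2r Sn orbT.
  by rewrite mulSn; lia.
Qed.

End Main.

Local Open Scope quotient_scope.

Section AssociatedGraded.
Variables (A : comNzRingType) (b : set A) (V : filtration b).
Implicit Types (c : A) (n s : nat) (z w : filt_mod V).

Let piR (r : rees b) : gr_ring b := \pi_(quot_ring (@rees_shift_pred A b)) r.
Let piM (z : filt_mod V) : gr_mod V :=
  \pi_(quot_mod (@filt_shift_scale A b V) (@filt_shift_annihil A b V)) z.

Let piM_repr (z : gr_mod V) : exists z', z = piM z'.
Proof. by exists (repr z); rewrite /piM reprK. Qed.

Let piM_add z w : piM (z + w) = piM z + piM w.
Proof. exact: quot_mod_addE. Qed.

Let piM_scale r z : piR r *: piM z = piM (r *: z).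
Proof. by symmetry; apply: quot_scaleE. Qed.

Let piM_eqP z w : piM z = piM w <-> forall n, V n.+1 ((filt_val z)`_n - (filt_val w)`_n).
Proof.
split=> [/quot_mod_eqP /asboolP H n|H].
  by have := H n; rewrite -coefB.
by apply/quot_mod_eqP/asboolP => n; have := H n; rewrite -coefB.
Qed.

Let piM0 : piM 0 = 0.
Proof. by apply: (addrI (piM 0)); rewrite -piM_add !addr0. Qed.

Lemma rees_monomial_subproof c s : idealX b s c -> c *: 'X^s \in @rees_pred A b.
Proof.
move=> bc; apply/asboolP => n; rewrite coefZ coefXn; case: eqP => [->|_].
  by rewrite mulr1.
by rewrite mulr0; apply: ideal0 (idealX_ideal _ _).
Qed.

Definition rees_monomial c s (bc : idealX b s c) : rees b :=
  Rees (rees_monomial_subproof bc).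

Let monomial_coef c s (bc : idealX b s c) z n :
  (filt_val (rees_monomial bc *: z))`_n = if (n < s)%N then 0 else c * (filt_val z)`_(n - s).
Proof.
rewrite /= -scalerAl coefZ coefXnM; case: ifP => _ //; exact: mulr0.
Qed.

Let smulM0 (z : gr_mod V) : smulM [::] z <-> z = 0.
Proof.
split=> [[y ->]|->]; first by rewrite big_ord0.
by exists (fun=> 0); rewrite big_ord0.
Qed.

Let smulM1 (r : gr_ring b) (z : gr_mod V) : smulM [:: r] z <-> exists w : gr_mod V, z = r *: w.
Proof.
split=> [[y ->]|[w ->]]; first by exists (y 0%N); rewrite big_ord1.
by exists (fun=> w); rewrite big_ord1.
Qed.

Lemma filt_polyP (p : {poly A}) : (forall n, V n p`_n) -> p \in @filt_pred A b V.
Proof. by move=> H; apply/asboolP. Qed.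

(** The initial forms are homogeneous of the same degree s, so regularity is tested on coefficients.
    The class of 1 shows that they do not generate everything, because s > 0 and [V 1] is proper. *)
Lemma gr_depth_ge2 (m : set A) s x y (bx : idealX b s x) (bby : idealX b s y) :
  (0 < s)%N -> m 0 -> ~ V 1%N 1 ->
  (forall n (z : A), V (n + s)%N (x * z) -> V n z) ->
  (forall n (z w : A), V (n.+1 + s)%N (y * z - x * w) -> exists e, V n.+1 (z - x * e)) ->
  depth_ge (gr_mod V) (gr_max_ideal b m) 2.
Proof.
move=> s0 m0 V1 Hx Hy; have hV n := filt_ideal V n.
pose X := rees_monomial bx; pose Y := rees_monomial bby.
have VX n (z : A) : V n z -> V (n + s)%N (x * z).
  move=> Vz; rewrite addnC; apply: (@filt_mul _ _ V); apply: idealM_mul => //.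
  exact: filt_idealX.
exists [:: piR X; piR Y]; split=> //.
  move=> r; rewrite !inE => /orP[] /eqP ->.
    exists X => //=; rewrite coefZ coefXn eq_sym.
    by rewrite (gtn_eqF s0) mulr0.
  exists Y => //=; rewrite coefZ coefXn eq_sym.
  by rewrite (gtn_eqF s0) mulr0.
split; last first.
  have V0 n : V n (1 : {poly A})`_n.
    by case: n => [|n]; rewrite ?filt0 // coef1; apply: ideal0 (hV _).
  pose one : filt_mod V := FiltMod (filt_polyP V0).
  move=> HT; have [f] : smulM [:: piR X; piR Y] (piM one) by rewrite HT.
  rewrite big_ord_recl big_ord1 /=.
  have [u ->] := piM_repr (f 0%N); have [v ->] := piM_repr (f 1%N).
  rewrite !piM_scale -piM_add piM_eqP => /(_ 0%N).
  rewrite (_ : filt_val (X *: u + Y *: v) = filt_val (X *: u) + filt_val (Y *: v)) //.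
  by rewrite coefD !monomial_coef s0 addr0 subr0 coef1; apply: V1.
move=> [|[|//]] _ z; have [{}z ->] := piM_repr z.
  rewrite take0 /= !smulM0 piM_scale -piM0 !piM_eqP => H n.
  rewrite coef0 subr0; apply: (Hx n.+1).
  have := H (n + s)%N; rewrite coef0 subr0 monomial_coef.
  by rewrite ltnNge leq_addl addnK addSn.
rewrite /= !smulM1 => -[w]; have [{}w ->] := piM_repr w.
rewrite !piM_scale piM_eqP => H.
have {H}ex n : exists e, V n.+1 ((filt_val z)`_n - x * e).
  apply: (Hy _ _ (filt_val w)`_n); have := H (n + s)%N.
  by rewrite !monomial_coef ltnNge leq_addl addnK addSn.
have [e He] := choice ex.
(* The quotient by x drops the degree by s, hence the index j + s; beyond the size of z the
   coefficients of z vanish and 0 may be chosen. *)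
pose p := \poly_(j < size (filt_val z)) e (j + s)%N.
have Vp n : V n p`_n.
  rewrite coef_poly; case: ifP => _; last exact: ideal0 (hV _).
  (* Both z_(n + s) and its difference with x e lie in [V (n + s)], hence so does x e, and x can be
     cancelled. *)
  apply: Hx; have := He (n + s)%N => H.
  rewrite -[x * _](subKr (filt_val z)`_(n + s)); apply: is_idealB => //.
    exact: filt_coef.
  by apply: (@filt_decr _ _ V).
exists (piM (FiltMod (filt_polyP Vp))).
rewrite piM_scale piM_eqP => n; rewrite monomial_coef.
case: ltnP => [lt|le].
  (* Below degree s the product has no coefficient, but there x e lies in [V s], which is contained
     in [V n.+1]. *)
  rewrite subr0 -(subrK (x * e n) (filt_val z)`_n); apply: ideal_add => //.
  by apply: (filt_le (p := (0 + s)%N)) => //; apply: VX; rewrite filt0.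
rewrite coef_poly; case: ltnP => [lt|ge]; first by rewrite subnK.
rewrite mulr0 nth_default ?subr0; first exact: ideal0 (hV _).
by apply: leq_trans ge _; apply: leq_subr.
Qed.

End AssociatedGraded.

Theorem theorem1p6 (A : comNzRingType) (m a : set A) (F : filtration a) :
  noetherian A -> is_local m -> cohen_macaulay m ->
  analytically_unramified m -> krull_dim_ge A 2 -> is_primary_to m a ->
  asymptotic_ic_filtration F ->
  exists k0 : nat, forall k : nat, (1 <= k)%N -> (k0 <= k)%N ->
    depth_ge (gr_mod (veronese F k)) (gr_max_ideal (idealX a k) m) 2.
Proof.
move=> noethA locA cmA _ dimA prim asF.
have [s [x [y [k0 [s0 ax ay H]]]]] := veronese_regular_pair noethA locA cmA dimA prim asF.
exists k0 => k k_gt0 /(H k k_gt0) [Hx Hy].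
have aXk z : idealX a s z -> idealX (idealX a k) s (z ^+ k).
  by move=> az; rewrite -idealXM mulnC; apply: idealX_exprM.
apply: (gr_depth_ge2 (aXk _ ax) (aXk _ ay) s0).
- exact: ideal0 (local_ideal locA).
- rewrite /= mul1n => Fk1; have [[F1 _] _] := asF; apply: F1.
  apply/seteqP; split=> // z _; rewrite -[z]mulr1.
  exact: ideal_mull _ (filt_ideal F 1) (filt_le k_gt0 Fk1).
- exact: Hx.
- by move=> n z w; apply: (Hy n.+1).
Qed.
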